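(* Let $\Omega\subset\mathbb{R}^2$ be a bounded and simply connected open set with Lipschitz boundary. Suppose that $\sigma\in L^2(\mathcal{S}^2;\mathbb{R}^2)$ has support contained in $\Omega$ and satisfies $\mathrm{Div}(\sigma)=0$ in the distributional sense on $\mathbb{R}^2$. Then there exists a unique $\psi\in\dot H^2_0(\mathbb{R}^2)$ such that $\mathrm{supp}(\psi)\subset\Omega$ and $$\sigma=(d^\perp)^2\psi\quad\text{on }\mathbb{R}^2 .$$ Furthermore, $$\|\psi\|_{\dot H^2_0(\mathbb{R}^2)}\le M\,\|\sigma\|_{L^2(\mathcal{S}^2;\mathbb{R}^2)}$$ for a constant $M>0$ which depends on $\Omega$ but not on $\sigma$.
   Context: $L^2(\mathcal{S}^2;\mathbb{R}^2)$ is the space of square-integrable symmetric $2$-tensor fields on $\mathbb{R}^2$. $(\mathrm{Div}\,\sigma)_i=\partial\sigma_{ij}/\partial x_j$ (summation over $j$). $\dot H^2_0(\mathbb{R}^2)$ is the homogeneous Sobolev space obtained as the closure of $\mathcal{C}_c^\infty(\mathbb{R}^2)$ in the norm $\|\psi\|_{\dot H^2_0(\mathbb{R}^2)}=\|\Delta\psi\|_{L^2(\mathbb{R}^2)}$. The perpendicular symmetric gradient $d^\perp$ is, on scalar functions, $d^\perp\psi=(-\partial_2\psi,\partial_1\psi)$, and on vector fields $d^\perp u=\tfrac12\big(\nabla^\perp\otimes u+(\nabla^\perp\otimes u)^T\big)$ with $\nabla^\perp=(-\partial_2,\partial_1)$. Thus $$(d^\perp)^2\psi=\begin{pmatrix}\partial_2^2\psi&-\partial_1\partial_2\psi\\-\partial_1\partial_2\psi&\partial_1^2\psi\end{pmatrix},$$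 with derivatives in the distributional sense. *)

(* Defs.v *)
(* The plane is R * R with its product topology and Borel sigma-algebra, R : realType. *)
From HB Require Import structures.
From mathcomp Require Import all_boot all_order all_algebra.
From mathcomp Require Import all_classical all_reals all_analysis.
Import Order.TTheory GRing.Theory Num.Theory.
Import numFieldNormedType.Exports.

Set Implicit Arguments.
Unset Strict Implicit.
Unset Printing Implicit Defensive.

Local Open Scope classical_set_scope.
Local Open Scope ring_scope.

Section Domains.
Context {R : realType}.
Implicit Type Omega : set (R * R).

Definition path_connected_set Omega :=
  forall x y, Omega x -> Omega y -> exists g : R -> R * R,
    [/\ {within `[0, 1], continuous g}, g @` `[0, 1] `<=` Omega,
        g 0 = x & g 1 = y].

Definition null_homotopic_loop Omega (g : R -> R * R) :=
  exists H : R * R -> R * R,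
    [/\ {within `[0, 1] `*` `[0, 1], continuous H},
        H @` (`[0, 1] `*` `[0, 1]) `<=` Omega,
        forall t : R, t \in `[0, 1] -> H (0, t) = g t,
        forall t : R, t \in `[0, 1] -> H (1, t) = g 0 &
        forall s : R, s \in `[0, 1] -> H (s, 0) = g 0 /\ H (s, 1) = g 0].

Definition simply_connected Omega :=
  path_connected_set Omega /\
  forall g : R -> R * R, {within `[0, 1], continuous g} ->
    g @` `[0, 1] `<=` Omega -> g 0 = g 1 -> null_homotopic_loop Omega g.

(* Near each boundary point p, in the orthonormal frame (c, s), (- s, c)
   centred at p, Omega is the strict epigraph of a Lipschitz function. *)
Definition lipschitz_boundary Omega :=
  forall p, (closure Omega `\` Omega°) p ->
  exists c s r h : R, exists g : R -> R,
    [/\ c ^+ 2 + s ^+ 2 = 1, 0 < r, 0 < h, lipschitz g &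
      forall a b, `|a| < r -> `|b| < h ->
        Omega (p.1 + a * c - b * s, p.2 + a * s + b * c) <-> g a < b].

End Domains.

Section Plane.
Context {R : realType}.

Definition lebesgue2 := ((@lebesgue_measure R) \x (@lebesgue_measure R))%E.

Definition basis_vec (i : 'I_2) : R * R := if i == 0 then (1, 0) else (0, 1).

Definition partial (i : 'I_2) (f : R * R -> R) : R * R -> R :=
  fun x => 'D_(basis_vec i) f x.

Definition laplacian (f : R * R -> R) : R * R -> R :=
  fun x => \sum_i partial i (partial i f) x.

Fixpoint Cn (n : nat) (f : R * R -> R) : Prop :=
  match n with
  | 0 => continuous f
  | m.+1 => continuous f /\ forall i : 'I_2,
      (forall x, derivable f x (basis_vec i)) /\ Cn m (partial i f)
  end.

Definition test_function (f : R * R -> R) :=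
  (forall n, Cn n f) /\ compact (closure [set x | f x != 0]).

(* The closed support of the almost-everywhere class of f. *)
Definition ess_support (V : nmodType) (f : R * R -> V) : set (R * R) :=
  [set x | forall U, open U -> U x ->
     ~ {ae lebesgue2, forall y, U y -> f y = 0}].

Definition locally_integrable2 (f : R * R -> R) :=
  measurable_fun setT f /\
  forall K : set (R * R), compact K ->
    (\int[lebesgue2]_(x in K) `|f x|%:E < +oo)%E.

Definition L2_norm (f : R * R -> R) : \bar R :=
  Lnorm lebesgue2 2%:E (EFin \o f).

(* Only values at test functions are meaningful; equality of distributions
   is dist_eq. *)
Definition dist := (R * R -> R) -> R.

Definition dist_eq (S T : dist) := forall phi, test_function phi -> S phi = T phi.

Definition dist_of (f : R * R -> R) : dist :=
  fun phi => \int[lebesgue2]_x (f x * phi x).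

Definition dist_partial (i : 'I_2) (T : dist) : dist :=
  fun phi => - T (partial i phi).

Definition dist_laplacian (T : dist) : dist :=
  fun phi => \sum_i dist_partial i (dist_partial i T) phi.

Definition dist_Div (S : 'I_2 -> 'I_2 -> dist) (i : 'I_2) : dist :=
  fun phi => \sum_j dist_partial j (S i j) phi.

Definition nabla_perp (i : 'I_2) (T : dist) : dist :=
  fun phi => if i == 0 then - dist_partial 1 T phi else dist_partial 0 T phi.

Definition dperp_scalar (T : dist) : 'I_2 -> dist := fun i => nabla_perp i T.

Definition dperp_vector (U : 'I_2 -> dist) : 'I_2 -> 'I_2 -> dist :=
  fun i j phi => 2^-1 * (nabla_perp i (U j) phi + nabla_perp j (U i) phi).

Definition dist_of_tensor (sigma : R * R -> 'M[R]_2) : 'I_2 -> 'I_2 -> dist :=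
  fun i j => dist_of (fun x => sigma x i j).

Definition L2_sym_tensor (sigma : R * R -> 'M[R]_2) :=
  (forall x, (sigma x)^T = sigma x) /\
  forall i j, (fun x => sigma x i j) \in Lfun lebesgue2 2%:E.

Definition L2_norm_tensor (sigma : R * R -> 'M[R]_2) : \bar R :=
  L2_norm (fun x => Num.sqrt (\sum_i \sum_j sigma x i j ^+ 2)).

Definition is_weak_laplacian (psi w : R * R -> R) :=
  w \in Lfun lebesgue2 2%:E /\
  dist_eq (dist_laplacian (dist_of psi)) (dist_of w).

(* The completion of the test functions for the norm of the Laplacian, realized
   by locally integrable functions: in dimension 2 a Cauchy sequence for this
   norm determines its limit up to an affine function, and requiring
   convergence as distributions excludes the other harmonic functions. *)
Definition homogeneous_H20 (psi : R * R -> R) :=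
  locally_integrable2 psi /\
  exists w, is_weak_laplacian psi w /\
  exists phi_ : nat -> R * R -> R,
    [/\ forall n, test_function (phi_ n),
        forall eta, test_function eta ->
          dist_of (phi_ n) eta @[n --> \oo] --> dist_of psi eta &
        L2_norm (fun x => laplacian (phi_ n) x - w x) @[n --> \oo] --> 0%E].

(* The default value 0 of xget is not reached when homogeneous_H20 psi holds. *)
Definition homogeneous_H20_norm (psi : R * R -> R) : \bar R :=
  L2_norm (xget (fun=> 0) [set w | is_weak_laplacian psi w]).

End Plane.

(* Main.v *)
(** A row [(f, g)] of [sigma] is divergence free and supported in [Omega], so it should
be [(d_2 u, - d_1 u)] for a function [u] supported in [Omega].  Take for [u] the integral
of [g] along horizontal half-lines, cut off on the right of the support.  Pairing [u] with
a test function [T] amounts to pairing [g] with the horizontal sliding integral [Phi] of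
[T], and both the derivatives of [u] and its vanishing far away follow by testing the
divergence equation with iterated sliding integrals.  If [T] vanishes on [Omega], then
[Phi dx_2] is a closed form on [Omega]; since [Omega] is simply connected it is exact, and
testing with a cut-off primitive shows that [u] is orthogonal to [T].  Hence [u] vanishes
outside the closure of [Omega], and the Lipschitz condition removes the boundary.
Symmetry of [sigma] says that the two row potentials [(u_1, u_2)] form again a
divergence-free pair, and its potential is [psi].  The Laplacian of [psi] is the trace of
[sigma], which gives the estimate; mollifying [psi] approximates it by test functions.
Uniqueness holds because a compactly supported [v] with [d_1 d_1 v = 0] vanishes. *)

Require Import Defs.
From HB Require Import structures.
From mathcomp Require Import all_boot all_order all_algebra.
From mathcomp Require Import all_classical all_reals all_analysis.
From mathcomp Require Import measurable_realfun ring lra.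
Import Order.TTheory GRing.Theory Num.Theory.
Import numFieldNormedType.Exports.
Set Implicit Arguments.
Unset Strict Implicit.
Unset Printing Implicit Defensive.
Local Open Scope classical_set_scope.
Local Open Scope ring_scope.

(** * Borel and Lebesgue structure of the plane *)

(** The equations are known only against compactly supported test functions, while a primitive of a
    test function along a line is compactly supported only if its line integrals vanish. The sliding
    integral over the segment from x to x + L e_i takes its place: it is again a test function, and
    its derivative along e_i is phi (x + L e_i) - phi x, whose first term is invisible to a
    compactly supported density once L is large. The integrations by parts below are instances of
    this. Simple connectedness provides merely continuous homotopies, along which no line integral
    can be formed; the closed form is therefore replaced by a locally additive function of two
    points, summed over fine meshes. Orthogonality to the tests vanishing on [Omega] controls the
    potential at exterior points only. A boundary point is reached because the potential is locally
    constant off the support of the data, which is a compact part of [Omega], and because exterior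
    balls lie arbitrarily close to it. *)

Lemma lebesgue2_sigma_finite (R : realType) : sigma_finite setT (@lebesgue2 R).
Proof.
have /sigma_finiteP[F [TF ndF Foo]] := sigma_finiteT (@lebesgue_measure R).
exists (fun n => F n `*` F n).
  rewrite -setXTT TF predeqE => -[x y]; split.
    move=> [/= [n _ Fnx] [k _ Fky]]; exists (maxn n k) => //; split.
    - by move: x Fnx; exact/subsetPset/ndF/leq_maxl.
    - by move: y Fky; exact/subsetPset/ndF/leq_maxr.
  by move=> [n _ []/= ? ?]; split; exists n.
move=> k; have [? ?] := Foo k.
split; first exact: measurableX.
by rewrite /lebesgue2 product_measure1E// lte_mul_pinfty// ge0_fin_numE.
Qed.

(** The sigma-finite structure lets the plane itself be a factor in Fubini's theorem. *)
HB.instance Definition _ (R : realType) :=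
  Measure.copy (@lebesgue2 R) ((@lebesgue_measure R) \x (@lebesgue_measure R))%E.
HB.instance Definition _ (R : realType) :=
  @Measure_isSigmaFinite.Build _ _ _ (@lebesgue2 R) (@lebesgue2_sigma_finite R).

Section PlaneMeasure.
Context {R : realType}.
Local Notation mu := (@lebesgue_measure R).
Local Notation mu2 := (@lebesgue2 R).

Lemma ballE2 (p : R * R) r : ball p r = ball p.1 r `*` ball p.2 r.
Proof. by []. Qed.

Lemma measurable_ball2 (p : R * R) r : measurable (ball p r : set (R * R)).
Proof. by rewrite ballE2; apply: measurableX; apply: open_measurable; exact: ball_open. Qed.

Definition rational_ball (q : (rat * rat) * rat) : set (R * R) :=
  ball ((ratr q.1.1, ratr q.1.2) : R * R) (ratr q.2 : R).

Lemma rational_ball_basis (U : set (R * R)) x : open U -> U x ->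
  exists2 q, rational_ball q x & rational_ball q `<=` U.
Proof.
move=> oU Ux.
have /nbhs_ballP[r /= r0 rU] : nbhs x U by exact: open_nbhs_nbhs.
have [q0 q0i] := rat_in_itvoo (divr_gt0 r0 (ltr0n R 4)).
have Q (y : R) : exists q : rat, `|y - ratr q| < r / 4.
  have [q] := @rat_in_itvoo R (y - r / 4) (y + r / 4) ltac:(lra).
  by rewrite in_itv/= => /andP[? ?]; exists q; rewrite ltr_norml; lra.
have [q1 h1] := Q x.1; have [q2 h2] := Q x.2.
(* The centre is within r / 4 of x: a radius above r / 4 catches x, and one below r / 2 keeps the
   ball inside the ball of radius r. *)
have [q3] := @rat_in_itvoo R (r / 4) (r / 2) ltac:(lra).
rewrite in_itv/= => /andP[h3 h4]; exists ((q1, q2), q3).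
  by split; rewrite /= -ball_normE /ball_ /= distrC; apply: lt_trans h3.
move=> y [/=]; rewrite -!ball_normE /ball_ /= => k1 k2; apply: rU.
have D (a b c : R) : `|a - b| < r / 4 -> `|b - c| < ratr q3 -> `|a - c| < r.
  move=> ? ?; rewrite (_ : a - c = (a - b) + (b - c)); last by ring.
  by rewrite (le_lt_trans (ler_normD _ _))//; lra.
by split; rewrite /= -ball_normE /ball_ /=; [exact: D h1 k1|exact: D h2 k2].
Qed.

Lemma open_bigcup_rational_ball (U : set (R * R)) : open U ->
  U = \bigcup_(q in [set q | rational_ball q `<=` U]) rational_ball q.
Proof.
move=> oU; apply/seteqP; split=> [x Ux|x [q qU qx]]; last exact: qU.
by have [q qx qU] := rational_ball_basis oU Ux; exists q.
Qed.

(** Measurable means measurable for the product sigma-algebra. Balls of the product metric are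
    squares, hence measurable, and countably many of them exhaust an open set. *)
Lemma open_measurable2 (U : set (R * R)) : open U -> measurable U.
Proof.
move=> /open_bigcup_rational_ball ->.
rewrite bigcup_mkcond; apply: countable_bigcupT_measurable => // q.
by case: ifP => // _; exact: measurable_ball2.
Qed.

Lemma continuous_measurable2 (f : R * R -> R) :
  continuous f -> measurable_fun setT f.
Proof.
move=> /continuousP cf; apply: (measurability _ (RGenOpens.measurableE R)).
move=> _ [_ [a [b ->] <-]]; rewrite setTI.
by apply: open_measurable2; apply: cf; exact: interval_open.
Qed.

Lemma closed_measurable2 (U : set (R * R)) : closed U -> measurable U.
Proof.
by move=> cU; rewrite -(setCK U); apply: measurableC; apply: open_measurable2;
  exact: closed_openC.
Qed.

Lemma measurable_shift2 (h : R * R) :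
  measurable_fun [set: R * R] (fun x : R * R => x + h : R * R).
Proof.
apply: (measurable_fun_pair (f := fun x : R * R => x.1 + h.1)
  (g := fun x : R * R => x.2 + h.2)).
- by apply: measurable_funD => //; exact: measurable_fst.
- by apply: measurable_funD => //; exact: measurable_snd.
Qed.

Lemma lebesgue_measure_shift (h : R) (A : set R) : measurable A ->
  pushforward mu ((fun x => x + h) : _ -> measurableTypeR R) A = mu A.
Proof.
have mh : measurable_fun setT ((fun x => x + h) : R -> measurableTypeR R).
  exact: measurable_funD.
move=> mA; apply/esym/lebesgue_measure_unique => //= _ [[a b]] _ <-.
rewrite /pushforward (_ : _ @^-1` _ = `]a - h, b - h]%classic); last first.
  by apply/seteqP; split=> x /=; rewrite !in_itv/= ltrBlDr lerBrDr.
rewrite !lebesgue_measure_itv/= !lte_fin ltrD2r.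
by case: ifP => // _; rewrite !EFinN -!EFinD; congr EFin; ring.
Qed.

Lemma lebesgue2_shift (h : R * R) (A : set (R * R)) : measurable A ->
  pushforward mu2 ((fun x => x + h) : _ -> R * R) A = mu2 A.
Proof.
pose T := (measurableTypeR R * measurableTypeR R)%type.
pose phi : T -> T := fun x => ((x : R * R) + h)%R.
have mh : measurable_fun setT phi := measurable_shift2 h.
move=> mA; apply/esym; rewrite [LHS]/lebesgue2.
apply: (@product_measure_unique _ _ _ _ _ mu mu (pushforward mu2 phi)) mA => B C mB mC.
rewrite /phi/=.
rewrite /pushforward (_ : _ @^-1` _ =
  ((fun x => x + h.1) @^-1` B) `*` ((fun x => x + h.2) @^-1` C)) //.
rewrite /lebesgue2 product_measure1E; last 2 first.
- rewrite -[X in measurable X]setTI; exact: measurable_funD.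
- rewrite -[X in measurable X]setTI; exact: measurable_funD.
by congr (_ * _)%E; exact: lebesgue_measure_shift.
Qed.

Lemma ge0_integral_shift2 (h : R * R) (f : R * R -> \bar R) :
  measurable_fun setT f -> (forall x, 0 <= f x)%E ->
  (\int[mu2]_x f ((x : R * R) + h)%R = \int[mu2]_x f x)%E.
Proof.
pose T := (measurableTypeR R * measurableTypeR R)%type.
pose phi : T -> T := fun x => ((x : R * R) + h)%R.
have mh : measurable_fun setT phi := measurable_shift2 h.
move=> mf f0.
have e := @ge0_integral_pushforward _ _ T T R phi mh mu2 setT f measurableT mf (fun y _ => f0 y).
rewrite preimage_setT in e.
transitivity (\int[pushforward mu2 phi]_y f y)%E; first exact/esym.
by apply: eq_measure_integral => A mA _; exact: lebesgue2_shift.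
Qed.

Lemma integral_shift2 (h : R * R) (f : R * R -> \bar R) :
  measurable_fun setT f ->
  (\int[mu2]_x f ((x : R * R) + h)%R = \int[mu2]_x f x)%E.
Proof.
move=> mf; rewrite integralE [RHS]integralE.
have mp := measurable_funepos mf; have mn := measurable_funeneg mf.
have ep := ge0_integral_shift2 h mp (fun x => funepos_ge0 f x).
have en := ge0_integral_shift2 h mn (fun x => funeneg_ge0 f x).
have cp := funepos_comp f (fun x : R * R => x + h).
have cn := funeneg_comp f (fun x : R * R => x + h).
apply: (congr2 (fun a b => a - b)%E).
  by apply: etrans ep; apply: eq_integral => x _; rewrite -[LHS]/(funepos (f \o _) x) cp.
by apply: etrans en; apply: eq_integral => x _; rewrite -[LHS]/(funeneg (f \o _) x) cn.
Qed.

Lemma integrable_shift2 (h : R * R) (f : R * R -> \bar R) :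
  mu2.-integrable setT f -> mu2.-integrable setT (fun x => f ((x : R * R) + h)).
Proof.
move=> /integrableP[mf foo]; apply/integrableP; split.
  exact: (measurableT_comp mf (measurable_shift2 h)).
have maf := measurableT_comp (@abse_measurable R setT) mf.
have e := ge0_integral_shift2 h maf (fun x => abse_ge0 (f x)).
by move: foo; rewrite -[X in (X < _)%E]e.
Qed.

(** * Half-open boxes as a generating pi-system of the plane *)

Definition oc_boxes : set (set (R * R)) :=
  [set A `*` B | A in @ocitv R & B in @ocitv R].

Lemma oc_boxes_setI_closed : setI_closed oc_boxes.
Proof.
move=> _ _ [A oA [B oB <-]] [C oC [D oD <-]].
by exists (A `&` C); [exact: ocitvI|exists (B `&` D); [exact: ocitvI|rewrite setXI]].
Qed.


Lemma bigcup_ocitvT : \bigcup_n `](- n%:R : R), n%:R]%classic = setT.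
Proof.
apply/seteqP; split=> // x _; have [n xn] : exists n : nat, `|x| < n%:R.
  by exists (Num.bound `|x|); rewrite archi_boundP.
by exists n => //=; rewrite in_itv/=; move: xn; rewrite ltr_norml; lra.
Qed.

(** Good-sets principle in one factor: for fixed B the sets A with A x B in S form a sigma-algebra.
    Complements are taken relative to the strip over B, which lies in S as a countable union of
    half-open boxes. *)
Lemma sigma_ocitv_rect (S : set (set (R * R))) (B : set R) :
  sigma_algebra setT S -> (forall A, @ocitv R A -> S (A `*` B)) ->
  forall A : set (measurableTypeR R), measurable A -> S (A `*` B).
Proof.
move=> [S0 SC SU] h A mA.
have SD X Y : S X -> S Y -> S (X `\` Y).
  move=> SX SY; rewrite -[X `\` Y]setCK -setTD; apply: (SC).
  have -> : ~` (X `\` Y) = \bigcup_n (if n == 0%N then setT `\` X else Y).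
    rewrite setCD; apply/seteqP; split=> [x [nXx|Yx]|x [[|n] _ //=]].
    - by exists 0%N => //=.
    - by exists 1%N.
    - by case=> _ nX; left.
    - by right.
  by apply: (SU) => n; case: ifP => _ //; exact: (SC).
have STB : S (setT `*` B).
  by rewrite -bigcup_ocitvT setX_bigcupl; apply: (SU) => n; apply: h; exact: is_ocitv.
apply: (@smallest_sub _ (sigma_algebra setT) (@ocitv R) [set A | S (A `*` B)]) mA.
  split=> /=.
  - by rewrite set0X.
  - move=> X SX; rewrite setTD.
    rewrite (_ : _ `*` B = (setT `*` B) `\` (X `*` B)); first exact: SD.
    apply/seteqP; split=> [[x y] /= [nX By]|[x y] /= [[_ By] nXB]].
    + by split=> // -[].
    + by split=> // Xx; exact: nXB.
  - by move=> F SF; rewrite setX_bigcupl; exact: SU.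
by move=> X /h.
Qed.

Lemma oc_boxes_generate :
  @measurable _ (measurableTypeR R * measurableTypeR R)%type = <<s oc_boxes >>.
Proof.
have sS := smallest_sigma_algebra setT oc_boxes.
apply/seteqP; split.
  rewrite measurable_prod_measurableType; apply: smallest_sub => //.
  move=> _ [A mA [B mB <-]].
  apply: (sigma_ocitv_rect (S := <<s oc_boxes >>)) mA => // A' oA.
  (* The preceding lemma enlarges the first factor only; exchanging the coordinates makes it
     available for the second. *)
  pose swap_ S := [set X : set (R * R) | S ((fun p => (p.2, p.1)) @^-1` X)].
  have := @sigma_ocitv_rect (swap_ <<s oc_boxes >>) A'.
  have E (C D : set R) :
    (fun p : R * R => (p.2, p.1)) @^-1` (C `*` D) = D `*` C.
    by apply/seteqP; split=> -[x y] /= [].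
  rewrite /swap_/= => /(_ _ _ B); rewrite E; apply => //.
  - split=> /=.
    + by rewrite preimage_set0; case: sS.
    + by move=> X SX; case: sS => _ h _; exact: (h _ SX).
    + by move=> F SF; rewrite preimage_bigcup; case: sS => _ _; apply.
  - by move=> C oC; rewrite E; apply: sub_sigma_algebra; exists A' => //; exists C.
apply: smallest_sub; first exact: sigma_algebra_measurable.
by move=> _ [A [x _ <-] [B [y _ <-] <-]]; apply: measurableX; exact: measurable_itv.
Qed.

Lemma dynkin_oc_boxes (H : set (set (R * R))) :
  dynkin H -> oc_boxes `<=` H ->
  forall A : set (measurableTypeR R * measurableTypeR R), measurable A -> H A.
Proof.
move=> dH sub A; rewrite oc_boxes_generate.
rewrite -(setI_closed_g_dynkin_g_sigma_algebra oc_boxes_setI_closed).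
by apply: smallest_sub.
Qed.

Lemma negligible_countable_bigcup (I : countType) (P : set I) (F : I -> set (R * R)) :
  (forall q, P q -> mu2.-negligible (F q)) -> mu2.-negligible (\bigcup_(q in P) F q).
Proof.
move=> h; pose G n : set (R * R) :=
  if unpickle n is Some q then (if q \in P then F q else set0) else set0.
apply: (@negligibleS _ _ _ mu2 (\bigcup_n G n)).
  move=> x [q Pq qx]; exists (pickle q); first by [].
  by rewrite /G pickleK mem_set.
apply: negligible_bigcup => n; rewrite /G; case: unpickle => [q|]; last first.
  exact: negligible_set0.
by case: ifPn => [/set_mem/h//|_]; exact: negligible_set0.
Qed.

End PlaneMeasure.

(** * Smooth functions of one variable *)

Section SmoothLine.
Context {R : realType}.
Implicit Types (f g : R -> R) (n : nat).

Fixpoint Cn1 n f : Prop :=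
  if n is m.+1 then (forall x, derivable f x 1) /\ Cn1 m (derive1 f) else continuous f.

Definition smooth1 f := forall n, Cn1 n f.

Lemma derivable_continuous1 f : (forall x, derivable f x 1) -> continuous f.
Proof.
by move=> df x; apply: differentiable_continuous; exact/derivable1_diffP.
Qed.

Lemma Cn1W n f : Cn1 n.+1 f -> Cn1 n f.
Proof.
elim: n f => [|n IH] f [df Cf]; first exact: derivable_continuous1.
by split => //; exact: IH.
Qed.

Lemma Cn1_cst n (c : R) : Cn1 n (cst c).
Proof.
elim: n c => [|n IH] c /=; first exact: cst_continuous.
split=> [x|]; first exact: derivable_cst.
rewrite (_ : derive1 (cst c) = cst 0)//; apply/funext => x.
by rewrite derive1_cst.
Qed.

Lemma Cn1D n f g : Cn1 n f -> Cn1 n g -> Cn1 n (fun x => f x + g x).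
Proof.
elim: n f g => [|n IH] f g.
  by move=> cf cg x; apply: cvgD; [exact: cf|exact: cg].
move=> [df Cf] [dg Cg]; split=> [x|]; first exact: derivableD.
rewrite (_ : derive1 _ = fun x => derive1 f x + derive1 g x); first exact: IH.
by apply/funext => x; rewrite !derive1E deriveD.
Qed.

Lemma Cn1M n f g : Cn1 n f -> Cn1 n g -> Cn1 n (fun x => f x * g x).
Proof.
elim: n f g => [|n IH] f g.
  by move=> cf cg x; apply: cvgM; [exact: cf|exact: cg].
move=> Cf' Cg'; have [Cf1 Cg1] := (Cn1W Cf', Cn1W Cg').
move: Cf' Cg' => [df Cf] [dg Cg]; split=> [x|]; first exact: derivableM.
rewrite (_ : derive1 _ = fun x => f x * derive1 g x + g x * derive1 f x).
  by apply: Cn1D; exact: IH.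
by apply/funext => x; rewrite !derive1E deriveM.
Qed.

Lemma smooth1_cst c : smooth1 (cst c).
Proof. by move=> n; exact: Cn1_cst. Qed.

Lemma smooth1M f g : smooth1 f -> smooth1 g -> smooth1 (fun x => f x * g x).
Proof. by move=> sf sg n; exact: Cn1M. Qed.

Lemma smooth1_derivable f x : smooth1 f -> derivable f x 1.
Proof. by move=> /(_ 1%N)[]. Qed.

Lemma smooth1_continuous f : smooth1 f -> continuous f.
Proof. by move=> /(_ 0%N). Qed.

Lemma smooth1_derive f : smooth1 f -> smooth1 (derive1 f).
Proof. by move=> sf n; case: (sf n.+1). Qed.

Lemma smooth1_antiderivative f g :
  (forall x : R, is_derive x 1 g (f x)) -> smooth1 f -> smooth1 g.
Proof.
move=> dg sf [|n].
  apply: derivable_continuous1 => x; exact: (@ex_derive _ _ _ _ _ _ _ (dg x)).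
split=> [x|]; first exact: (@ex_derive _ _ _ _ _ _ _ (dg x)).
rewrite (_ : derive1 g = f)//; apply/funext => x.
by rewrite derive1E (@derive_val _ _ _ _ _ _ _ (dg x)).
Qed.

Lemma Cn1_affine n f (a b : R) : Cn1 n f -> Cn1 n (fun x => f (a * x + b)).
Proof.
have D (x : R) : is_derive x 1 (fun x : R => a * x + b) a.
  rewrite (_ : (fun x => _) = a *: (id : R -> R) + cst b)//.
  by apply: is_derive_eq; rewrite /GRing.scale/= mulr1 addr0.
elim: n f => [|n IH] f.
  move=> cf x; apply: (@continuous_comp _ _ _ (fun x => a * x + b) f); last exact: cf.
  apply: derivable_continuous1 => y; exact: (@ex_derive _ _ _ _ _ _ _ (D y)).
move=> [df Cf].
have H (x : R) : is_derive x 1 (fun x : R => f (a * x + b)) (a * derive1 f (a * x + b)).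
  have H0 : is_derive (a * x + b) 1 f (derive1 f (a * x + b)).
    by rewrite derive1E; exact: derivableP.
  have := @is_derive1_comp R f (fun x => a * x + b) x _ _ H0 (D x).
  by rewrite mulrC.
split=> [x|]; first exact: (@ex_derive _ _ _ _ _ _ _ (H x)).
rewrite (_ : derive1 _ = fun x => cst a x * derive1 f (a * x + b)).
  by apply: Cn1M; [exact: Cn1_cst|exact: IH].
by apply/funext => x; rewrite derive1E (@derive_val _ _ _ _ _ _ _ (H x)).
Qed.

Lemma smooth1_affine f (a b : R) : smooth1 f -> smooth1 (fun x => f (a * x + b)).
Proof. by move=> sf n; exact: Cn1_affine. Qed.

(* the family [x ^- k * exp (- 1 / x)] is closed under differentiation up to
   linear combinations *)
Definition flat k (x : R) : R := if 0 < x then x ^- k * expR (- x^-1) else 0.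

(** One term of the exponential series, of degree k + 2, dominates x^-k up to the factor x^2. A
    bound of second order makes the difference quotient of [flat k] at 0 tend to 0. *)
Lemma flat_bound k (x : R) : 0 < x -> x ^- k * expR (- x^-1) <= (k.+2)`!%:R * x ^+ 2.
Proof.
move=> x0; rewrite expRN ler_pdivrMr ?expR_gt0//.
have F0 : 0 < (k.+2)`!%:R :> R by rewrite ltr0n fact_gt0.
have h : x^-1 ^+ k.+2 / (k.+2)`!%:R <= expR x^-1.
  have := @expR_ge1Dxn R x^-1 k.+1 ltac:(by rewrite invr_ge0 ltW).
  by apply: le_trans; rewrite lerDr.
have -> : x ^- k = (k.+2)`!%:R * x ^+ 2 * (x^-1 ^+ k.+2 / (k.+2)`!%:R).
  by rewrite -addn2 exprD !exprVn; field; rewrite gt_eqF//= expf_neq0 ?gt_eqF.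
by rewrite ler_wpM2l// mulr_ge0// exprn_ge0// ltW.
Qed.

Lemma is_derive_flat k (x : R) :
  is_derive x 1 (flat k) (- k%:R * flat k.+1 x + flat k.+2 x).
Proof.
have [x0|x0|->] := ltgtP x 0.
- have E : \near x, cst 0 x = flat k x.
    near=> y; rewrite /flat ifF//; apply/negbTE; rewrite -leNgt.
    by apply/ltW; near: y; exact: lt_nbhsl.
  have h : - k%:R * flat k.+1 x + flat k.+2 x = 0.
    by rewrite /flat ltNge (ltW x0)/= mulr0 addr0.
  rewrite h; apply: DeriveDef.
    exact: (near_eq_derivable E (@derivable_cst _ _ _ _ _ _)).
  by rewrite -(near_eq_derive _ E) derive_cst.
(* For positive x the function is u^k exp (-u) composed with u = 1 / x, so the derivative comes from
   the chain rule. *)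
- pose G (y : R) := (id ^+ k * (expR \o -%R)) (y^-1).
  have E : \near x, G x = flat k x.
    near=> y; rewrite /flat ifT; last by near: y; exact: lt_nbhsr.
    by rewrite /G /= !fctE /= -exprVn.
  have DG : is_derive x 1 G (- k%:R * flat k.+1 x + flat k.+2 x).
    have V : is_derive x 1 (fun y : R => y^-1) (- x ^- 2 *: 1).
      by apply: (@is_deriveV _ id); rewrite ?gt_eqF//.
    have D1 (y : R) : is_derive y 1 ((id : R -> R) ^+ k) (k%:R * y ^+ k.-1).
      by apply: is_derive_eq; rewrite /GRing.scale/= mulr1.
    have D2 (y : R) : is_derive y 1 (expR \o -%R : R -> R) (expR (- y) * - 1).
      exact: is_derive1_comp.
    have H := is_deriveM (D1 x^-1) (D2 x^-1).
    apply: is_derive_eq (is_derive1_comp H V) _.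
    rewrite /flat x0 /GRing.scale/= !fctE !mulr1 mulrN1 -!exprVn.
    by case: k {H E G D1} => [|k] /=; rewrite ?mul0r ?exprS ?expr0; ring.
  apply: DeriveDef.
    exact: (near_eq_derivable E (@ex_derive _ _ _ _ _ _ _ DG)).
  by rewrite -(near_eq_derive _ E) (@derive_val _ _ _ _ _ _ _ DG).
- have h : - k%:R * flat k.+1 0 + flat k.+2 0 = 0 :> R.
    by rewrite /flat ltxx mulr0 addr0.
  rewrite h; set F := (k.+2)`!%:R : R.
  have F0 : 0 < F by rewrite ltr0n fact_gt0.
  have C : h^-1 *: ((flat k \o shift 0) (h *: 1) - flat k 0) @[h --> 0^'] --> (0 : R).
    apply/cvgr0Pnorm_le => e e0; near=> y.
    rewrite /= addr0 /GRing.scale/= mulr1 {2}/flat ltxx subr0 /flat.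
    case: ifP => [y0|_]; last by rewrite mulr0 normr0 ltW.
    have n0 : 0 <= y ^- k * expR (- y^-1).
      by rewrite mulr_ge0 ?expR_ge0// -exprVn exprn_ge0// invr_ge0 ltW.
    rewrite normrM normfV (gtr0_norm y0) (ger0_norm n0).
    rewrite ler_pdivrMl// (le_trans (flat_bound k y0))// -/F.
    rewrite expr2 mulrA [leRHS]mulrC ler_pM2r//.
    have : `|y| < e / F by near: y; apply: dnbhs0_lt; rewrite divr_gt0.
    by rewrite gtr0_norm// ltr_pdivlMr// mulrC => /ltW.
  apply: DeriveDef; first by apply/cvg_ex; exists 0.
  by apply/cvg_lim.
Unshelve. all: end_near. Qed.

Lemma smooth1_flat k : smooth1 (flat k).
Proof.
move=> n; elim: n k => [|n IH] k.
  by apply: derivable_continuous1 => x; exact: (@ex_derive _ _ _ _ _ _ _ (is_derive_flat k x)).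
split=> [x|]; first exact: (@ex_derive _ _ _ _ _ _ _ (is_derive_flat k x)).
rewrite (_ : derive1 _ = fun x => cst (- k%:R) x * flat k.+1 x + flat k.+2 x).
  by apply: Cn1D => //; apply: Cn1M => //; exact: Cn1_cst.
by apply/funext => x; rewrite derive1E (@derive_val _ _ _ _ _ _ _ (is_derive_flat k x)).
Qed.

Lemma antiderivative f (c : R) : continuous f -> (forall x, x <= c -> f x = 0) ->
  exists2 g : R -> R, forall x : R, is_derive x 1 g (f x) &
    forall x, x <= c -> g x = 0.
Proof.
move=> cf f0.
(* The base point is c - 1 rather than c, so that every x either lies strictly to the right of it,
   where the fundamental theorem applies, or has a neighbourhood on which F is 0. *)
pose F x := (\int[lebesgue_measure]_(t in `[(c - 1), x]) f t)%R.
have F0 x : x <= c -> F x = 0.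
  move=> xc; rewrite /F (@eq_Rintegral _ _ _ _ _ (cst 0)) ?Rintegral_cst ?mul0r//.
  by move=> y /[!inE]/=; rewrite in_itv/= => /andP[_ yx]; rewrite f0// (le_trans yx).
exists F => // x; have [cx|xc] := ltP (c - 1) x.
  have [] := @continuous_FTC1_closed R f (c - 1) x (x + 1) ltac:(lra) _ cx (cf x).
    apply: continuous_compact_integrable; first exact: segment_compact.
    exact: continuous_subspaceT.
  by rewrite derive1E => dF eF; exact: DeriveDef.
have E : \near x, cst 0 x = F x.
  near=> y; rewrite F0//; apply/ltW; near: y; apply: lt_nbhsl; lra.
rewrite f0; last by lra.
apply: DeriveDef.
  exact: (near_eq_derivable E (@derivable_cst _ _ _ _ _ _)).
by rewrite -(near_eq_derive _ E) derive_cst.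
Unshelve. all: end_near. Qed.

Lemma derive_eq_increment f g (a b : R) : (forall x : R, is_derive x 1 g (f x)) ->
  a < b -> exists2 c, a < c < b & g b - g a = f c * (b - a).
Proof.
move=> dg ab.
have [] := @MVT R g f a b ab (fun x _ => dg x).
  apply: continuous_subspaceT; apply: derivable_continuous1 => x.
  exact: (@ex_derive _ _ _ _ _ _ _ (dg x)).
by move=> c; rewrite in_itv/= => ?; exists c.
Qed.

Definition smooth_bump x : R := flat 0 x * flat 0 (1 - x).

Lemma bump_ge0 x : 0 <= smooth_bump x.
Proof.
by rewrite mulr_ge0// /flat; case: ifP => // _; rewrite mulr_ge0// ?expR_ge0// -exprVn.
Qed.

Lemma bump_gt0 x : 0 < x < 1 -> 0 < smooth_bump x.
Proof.
move=> /andP[x0 x1]; rewrite /smooth_bump /flat x0 subr_gt0 x1 !expr0 !invr1 !mul1r.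
by rewrite mulr_gt0 ?expR_gt0.
Qed.

Lemma bump0 x : ~~ (0 < x < 1) -> smooth_bump x = 0.
Proof.
rewrite negb_and /smooth_bump /flat subr_gt0 => /orP[] /negbTE ->; first by rewrite mul0r.
by rewrite mulr0.
Qed.

Lemma smooth1_bump : smooth1 smooth_bump.
Proof.
apply: smooth1M; first exact: smooth1_flat.
have := @smooth1_affine (flat 0) (-1) 1 (smooth1_flat 0).
by congr smooth1; apply/funext => x; congr flat; ring.
Qed.

Lemma smooth_step : exists S : R -> R, [/\ smooth1 S,
  forall x, x <= 0 -> S x = 0, forall x, 1 <= x -> S x = 1 &
  forall x, 0 <= S x <= 1].
Proof.
have b0 (x : R) : x <= 0 -> smooth_bump x = 0.
  by move=> x0; rewrite bump0// negb_and -leNgt x0.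
have [P dP P0] := antiderivative (smooth1_continuous smooth1_bump) b0.
have monP (x y : R) : x <= y -> P x <= P y.
  rewrite le_eqVlt => /orP[/eqP->//|xy].
  have [c _ e] := derive_eq_increment dP xy.
  by rewrite -subr_ge0 e mulr_ge0 ?bump_ge0// subr_ge0 ltW.
have P1 : 0 < P 1.
  have [c ci] := derive_eq_increment dP (@ltr01 R).
  rewrite (P0 0)// !subr0 mulr1 => ->; exact: bump_gt0.
have Pc (x : R) : 1 <= x -> P x = P 1.
  rewrite le_eqVlt => /orP[/eqP->//|xy].
  have [c /andP[c1 _]] := derive_eq_increment dP xy.
  rewrite bump0 ?mul0r; first by move/eqP; rewrite subr_eq0 => /eqP.
  by rewrite negb_and -!leNgt (ltW c1) orbT.
exists (fun x => cst (P 1)^-1 x * P x); split.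
- apply: smooth1M; first exact: smooth1_cst.
  exact: smooth1_antiderivative dP smooth1_bump.
- by move=> x x0; rewrite (P0 x x0) mulr0.
- by move=> x x1; rewrite (Pc x x1) mulVf// gt_eqF.
- move=> x; rewrite mulr_ge0 ?invr_ge0 ?(ltW P1)//=; last first.
    by have [x0|/P0->//] := ltP 0 x; rewrite -(P0 0 (lexx 0)) monP// ltW.
  rewrite mulrC ler_pdivrMr// mul1r; have [h|h] := leP 1 x; first by rewrite (Pc x h).
  exact: monP (ltW h).
Qed.

Lemma plateau (p r : R) : 0 < r -> exists S : R -> R, [/\ smooth1 S,
  forall x, `|x - p| <= r -> S x = 1 &
  forall x, 2 * r <= `|x - p| -> S x = 0].
Proof.
move=> r0; have [S [sS S0 S1 _]] := smooth_step.
(* With v = (x - p) / r the factors are S (v + 2) and S (2 - v): both arguments are at least 1 when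
   |v| <= 1, and one of them is at most 0 when |v| >= 2. *)
exists (fun x => S (r^-1 * x + (2 - r^-1 * p)) * S ((- r^-1) * x + (2 + r^-1 * p))).
split.
- by apply: smooth1M; exact: smooth1_affine.
- move=> x; rewrite ler_norml => /andP[h1 h2].
  have k1 : - 1 <= r^-1 * (x - p) by rewrite ler_pdivlMl// mulrN1.
  have k2 : r^-1 * (x - p) <= 1 by rewrite ler_pdivrMl// mulr1.
  by rewrite !S1 ?mulr1//; lra.
- move=> x; rewrite ler_normr => /orP[h|h].
  + have k : 2 <= r^-1 * (x - p) by rewrite ler_pdivlMl// mulrC.
    by rewrite [X in _ * X]S0 ?mulr0//; lra.
  + have k : 2 <= r^-1 * - (x - p) by rewrite ler_pdivlMl// mulrC.
    by rewrite S0 ?mul0r//; lra.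
Qed.

End SmoothLine.

(** * Smooth functions on the plane *)

Section SmoothPlane.
Context {R : realType}.
Implicit Types (f g : R * R -> R) (n : nat) (i : 'I_2) (x : R * R).

Definition coordinate i x := if i == 0 then x.1 else x.2.
(** The line through x parallel to an axis, parametrised by the coordinate itself and not by the
    displacement; composition with it turns partial derivatives into derivatives of one variable. *)
Definition slice i x (s : R) : R * R := if i == 0 then (s, x.2) else (x.1, s).

Lemma slice_coordinate i x : slice i x (coordinate i x) = x.
Proof. by rewrite /slice /coordinate; case: x => a b; case: (i == 0). Qed.

Lemma slice_difference_quotient i f x :
  (fun h => h^-1 *: ((f \o shift x) (h *: basis_vec i) - f x)) =
  (fun h => h^-1 *: (((f \o slice i x) \o shift (coordinate i x)) (h *: 1)
    - (f \o slice i x) (coordinate i x))).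
Proof.
apply/funext => h; rewrite /= slice_coordinate; congr (_ *: (f _ - _)).
rewrite /basis_vec /slice /coordinate; case: ifP => _; case: x => a b /=;
  rewrite [LHS]surjective_pairing; apply: congr2 => //=;
  by rewrite /GRing.scale/= mulr0 add0r.
Qed.

Lemma derivable_slice i f x :
  derivable f x (basis_vec i) <-> derivable (f \o slice i x) (coordinate i x) 1.
Proof. by rewrite /derivable slice_difference_quotient. Qed.

Lemma partial_slice i f x :
  partial i f x = 'D_1 (f \o slice i x) (coordinate i x).
Proof. by rewrite /partial /derive slice_difference_quotient. Qed.

Lemma is_derive_slice i f x (d : R) : is_derive (coordinate i x) 1 (f \o slice i x) d ->
  derivable f x (basis_vec i) /\ partial i f x = d.
Proof.
move=> D; split; first by apply/derivable_slice; exact: (@ex_derive _ _ _ _ _ _ _ D).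
by rewrite partial_slice (@derive_val _ _ _ _ _ _ _ D).
Qed.

Lemma Cn_continuous n f : Cn n f -> continuous f.
Proof. by case: n => [//|n []]. Qed.

Lemma Cn_derivable n f x i : Cn n.+1 f -> derivable f x (basis_vec i).
Proof. by move=> [_ /(_ i)[]]. Qed.

Lemma Cn_partial n f i : Cn n.+1 f -> Cn n (partial i f).
Proof. by move=> [_ /(_ i)[]]. Qed.

Lemma CnW n f : Cn n.+1 f -> Cn n f.
Proof.
elim: n f => [|n IH] f [cf Cf] //; split=> // i; have [df Cif] := Cf i.
by split=> //; exact: IH.
Qed.

Lemma continuous_local f :
  (forall x, exists2 g, continuous g & \near x, f x = g x) -> continuous f.
Proof.
move=> H x; have [g cg fg] := H x.
have gx : g @ x --> g x by exact: cg.
rewrite /continuous_at (nbhs_singleton fg); apply: cvg_trans gx.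
by apply: near_eq_cvg; apply: filterS fg => y ->.
Qed.

(** Used for the cut-off of a multivalued-looking primitive, for which a smooth formula is available
    near each point but not globally. Since the agreement with g holds at all points near x, it
    passes to the partial derivatives. *)
Lemma Cn_local n f :
  (forall x, exists2 g, Cn n g & \near x, f x = g x) -> Cn n f.
Proof.
elim: n f => [|n IH] f H; first exact: continuous_local.
split.
  apply: continuous_local => x; have [g cg fg] := H x.
  by exists g => //; exact: Cn_continuous cg.
move=> i; split=> [x|].
  have [g cg fg] := H x; apply: (@near_eq_derivable _ _ _ g); last exact: Cn_derivable cg.
  by apply: filterS fg => y ->.
apply: IH => x; have [g cg fg] := H x; exists (partial i g); first exact: Cn_partial.
have := near_join fg; apply: filterS => y; exact: near_eq_derive.
Qed.

Lemma Cn_cst n (c : R) : Cn n (cst c).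
Proof.
elim: n c => [|n IH] c /=; first exact: cst_continuous.
split=> [|i]; first exact: cst_continuous.
split=> [x|]; first exact: derivable_cst.
rewrite (_ : partial _ _ = cst 0)//; apply/funext => x.
by rewrite /partial derive_cst.
Qed.

Lemma CnD n f g : Cn n f -> Cn n g -> Cn n (fun x => f x + g x).
Proof.
elim: n f g => [|n IH] f g.
  by move=> cf cg x; apply: cvgD; [exact: cf|exact: cg].
move=> [cf Cf] [cg Cg]; split=> [x|i].
  by apply: cvgD; [exact: cf|exact: cg].
have [[df Cfi] [dg Cgi]] := (Cf i, Cg i).
split=> [x|]; first exact: derivableD.
rewrite (_ : partial _ _ = fun x => partial i f x + partial i g x); first exact: IH.
by apply/funext => x; rewrite /partial deriveD.
Qed.

Lemma partialD i f g x : derivable f x (basis_vec i) -> derivable g x (basis_vec i) ->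
  partial i (fun x => f x + g x) x = partial i f x + partial i g x.
Proof. by move=> df dg; rewrite /partial deriveD. Qed.

Lemma partialM i f g x : derivable f x (basis_vec i) -> derivable g x (basis_vec i) ->
  partial i (fun x => f x * g x) x = f x * partial i g x + g x * partial i f x.
Proof. by move=> df dg; exact: (deriveM df dg). Qed.

Lemma CnM n f g : Cn n f -> Cn n g -> Cn n (fun x => f x * g x).
Proof.
elim: n f g => [|n IH] f g.
  by move=> cf cg x; apply: cvgM; [exact: cf|exact: cg].
move=> Cf' Cg'; have [Cf1 Cg1] := (CnW Cf', CnW Cg').
move: (Cf') (Cg') => [cf Cf] [cg Cg]; split=> [x|i].
  by apply: cvgM; [exact: cf|exact: cg].
have [[df Cfi] [dg Cgi]] := (Cf i, Cg i).
split=> [x|]; first exact: derivableM.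
rewrite (_ : partial _ _ = fun x => f x * partial i g x + g x * partial i f x).
  by apply: CnD; exact: IH.
by apply/funext => x; exact: partialM.
Qed.

Lemma shift_difference_quotient i f x (h : R * R) :
  derivable (fun x => f (x + h)) x (basis_vec i) = derivable f (x + h) (basis_vec i) /\
  partial i (fun x => f (x + h)) x = partial i f (x + h).
Proof.
have e : (fun k => k^-1 *: (((fun x => f (x + h)) \o shift x) (k *: basis_vec i) - f (x + h)))
       = (fun k => k^-1 *: ((f \o shift (x + h)) (k *: basis_vec i) - f (x + h))).
  by apply/funext => k /=; rewrite addrA.
by split; rewrite /partial /derivable /derive e.
Qed.

Lemma Cn_shift n f (h : R * R) : Cn n f -> Cn n (fun x => f (x + h)).
Proof.
have C g : continuous g -> continuous (fun x => g (x + h)).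
  move=> cg x; apply: (@continuous_comp _ _ _ (fun x => x + h) g); last exact: cg.
  by apply: cvgD; [exact: cvg_id|exact: cvg_cst].
elim: n f => [|n IH] f; first exact: C.
move=> [cf Cf]; split=> [|i]; first exact: C.
have [df Cfi] := Cf i; split=> [x|].
  by have [-> _] := shift_difference_quotient i f x h.
rewrite (_ : partial _ _ = fun x => partial i f (x + h)); first exact: IH.
by apply/funext => x; have [_ ->] := shift_difference_quotient i f x h.
Qed.

Definition tensor (f g : R -> R) : R * R -> R := fun x => f x.1 * g x.2.

Lemma is_derive_tensor (f g : R -> R) i x : smooth1 f -> smooth1 g ->
  derivable (tensor f g) x (basis_vec i) /\
  partial i (tensor f g) x =
    if i == 0 then tensor (derive1 f) g x else tensor f (derive1 g) x.
Proof.
move=> sf sg.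
have -> : (derivable (tensor f g) x (basis_vec i)) =
  derivable (tensor f g \o slice i x) (coordinate i x) 1.
  by apply/propext; exact: derivable_slice.
rewrite partial_slice /slice /coordinate /tensor; case: ifP => _; case: x => a b /=.
- rewrite (_ : _ \o _ = (fun s => f s * cst (g b) s))//.
  have df := @smooth1_derivable R f a sf.
  have dc : derivable (cst (g b) : R -> R) a 1 by exact: derivable_cst.
  split; first exact: derivableM df dc.
  by rewrite (deriveM df dc) derive_cst scaler0 add0r derive1E mulrC.
- rewrite (_ : _ \o _ = (fun s => cst (f a) s * g s))//.
  have dg := @smooth1_derivable R g b sg.
  have dc : derivable (cst (f a) : R -> R) b 1 by exact: derivable_cst.
  split; first exact: derivableM dc dg.
  by rewrite (deriveM dc dg) derive_cst scaler0 addr0 derive1E.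
Qed.

Lemma Cn_tensor (f g : R -> R) : smooth1 f -> smooth1 g -> forall n, Cn n (tensor f g).
Proof.
have C (a b : R -> R) : smooth1 a -> smooth1 b -> continuous (tensor a b).
  move=> sa sb x; apply: cvgM.
  - by apply: (@continuous_comp _ _ _ fst a); [exact: cvg_fst|exact: smooth1_continuous].
  - by apply: (@continuous_comp _ _ _ snd b); [exact: cvg_snd|exact: smooth1_continuous].
move=> + + n; elim: n f g => [|n IH] f g sf sg; first exact: C.
split=> [|i]; first exact: C.
split=> [x|]; first by have [] := is_derive_tensor i x sf sg.
rewrite (_ : partial _ _ = if i == 0 then tensor (derive1 f) g else tensor f (derive1 g)).
  by case: ifP => _; apply: IH => //; exact: smooth1_derive.
by apply/funext => x; have [_ ->] := is_derive_tensor i x sf sg; case: ifP.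
Qed.

End SmoothPlane.

(** * Test functions *)

Section TestFunctions.
Context {R : realType}.
Implicit Types (f g phi : R * R -> R) (n : nat) (i : 'I_2) (x : R * R).

(** Compact support measured by a number. The boundary of the square belongs to the zero set, so a
    nonzero value gives the strict bounds |x.1| < A and |x.2| < A. *)
Definition vanishes_off (A : R) f := forall x, A <= `|x.1| \/ A <= `|x.2| -> f x = 0.

Lemma closed_square_compact (A : R) : compact (`[- A, A] `*` `[- A, A] : set (R * R)).
Proof. by apply: compact_setX; exact: segment_compact. Qed.

Lemma test_functionP f : test_function f <->
  (forall n, Cn n f) /\ exists2 A : R, 0 < A & vanishes_off A f.
Proof.
split=> -[Cf S]; split=> //.
  have [M [Mr MS]] := compact_bounded S.
  pose A := `|M| + 1; have A0 : 0 < A by rewrite ltr_wpDl.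
  have MA : M < A by rewrite ltr_pwDr// ler_norm.
  have AS := MS _ MA.
  exists (A + 1); first by rewrite addr_gt0.
  move=> x Ax; apply/eqP/negPn/negP => fx.
  have : `|x| <= A by apply: AS; exact: subset_closure.
  rewrite prod_normE ge_max => /andP[h1 h2].
  by case: Ax => h; [have := le_trans h h1|have := le_trans h h2];
    rewrite gerDl ler10.
have [A A0 fA] := S.
apply: (@subclosed_compact _ _ (`[- A, A] `*` `[- A, A])).
- exact: closed_closure.
- exact: closed_square_compact.
- have cS : closed (`[- A, A] `*` `[- A, A] : set (R * R)).
    apply: compact_closed; first exact: norm_hausdorff.
    exact: closed_square_compact.
  rewrite [X in _ `<=` X]((closure_id _).1 cS); apply: closureS.
  move=> x /= /eqP fx; rewrite !in_itv/= -!ler_norml; split.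
    by rewrite leNgt; apply/negP => /ltW h; apply: fx; apply: fA; left.
  by rewrite leNgt; apply/negP => /ltW h; apply: fx; apply: fA; right.
Qed.

Lemma test_Cn n f : test_function f -> Cn n f.
Proof. by case. Qed.

Lemma test_continuous f : test_function f -> continuous f.
Proof. by case=> /(_ 0%N). Qed.

Lemma test_derivable f x i : test_function f -> derivable f x (basis_vec i).
Proof. by case=> /(_ 1%N) + _; exact: Cn_derivable. Qed.

Lemma test_measurable f : test_function f -> measurable_fun setT f.
Proof. by move=> /test_continuous; exact: continuous_measurable2. Qed.

Lemma open_gt_norm1 (A : R) : open [set x : R * R | A < `|x.1|].
Proof.
have -> : [set x : R * R | A < `|x.1|] = (fun x => `|x.1|) @^-1` [set r | A < r] by [].
apply: open_comp; last exact: open_gt.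
move=> x _; apply: (@continuous_comp _ _ _ fst (fun r : R => `|r|)); first exact: cvg_fst.
exact: norm_continuous.
Qed.

Lemma open_gt_norm2 (A : R) : open [set x : R * R | A < `|x.2|].
Proof.
have -> : [set x : R * R | A < `|x.2|] = (fun x => `|x.2|) @^-1` [set r | A < r] by [].
apply: open_comp; last exact: open_gt.
move=> x _; apply: (@continuous_comp _ _ _ snd (fun r : R => `|r|)); first exact: cvg_snd.
exact: norm_continuous.
Qed.

Lemma partial_eq0 i f x : (\near x, f x = 0) -> partial i f x = 0.
Proof.
move=> f0; rewrite /partial (@near_eq_derive _ _ _ f (cst 0)) ?derive_cst//.
Qed.

Lemma vanishes_off_near f (A : R) x : vanishes_off A f ->
  A < `|x.1| \/ A < `|x.2| -> \near x, f x = 0.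
Proof.
move=> fA [h|h].
- have : nbhs x [set y : R * R | A < `|y.1|].
    by apply: open_nbhs_nbhs; split; [exact: open_gt_norm1|].
  by apply: filterS => y /ltW Ay; apply: fA; left.
- have : nbhs x [set y : R * R | A < `|y.2|].
    by apply: open_nbhs_nbhs; split; [exact: open_gt_norm2|].
  by apply: filterS => y /ltW Ay; apply: fA; right.
Qed.

Lemma vanishes_off_partial i f (A B : R) : A < B ->
  vanishes_off A f -> vanishes_off B (partial i f).
Proof.
move=> AB fA x [h|h]; apply: partial_eq0; apply: vanishes_off_near fA _.
- by left; exact: lt_le_trans h.
- by right; exact: lt_le_trans h.
Qed.

Lemma test_partial i f : test_function f -> test_function (partial i f).
Proof.
move=> /test_functionP[Cf [A A0 fA]]; apply/test_functionP; split.
  by move=> n; exact: Cn_partial.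
exists (A + 1); first by rewrite addr_gt0.
by apply: vanishes_off_partial fA; rewrite ltrDl.
Qed.

Lemma test_shift f (h : R * R) : test_function f -> test_function (fun x => f (x + h)).
Proof.
move=> /test_functionP[Cf [A A0 fA]]; apply/test_functionP; split.
  by move=> n; exact: Cn_shift.
exists (A + `|h.1| + `|h.2|); first by rewrite ltr_wpDr// ltr_wpDr.
move=> x [] k; apply: fA; [left|right]; rewrite /=.
- have := lerB_normD x.1 h.1 => ?.
  have := normr_ge0 h.2; lra.
- have := lerB_normD x.2 h.2 => ?.
  have := normr_ge0 h.1; lra.
Qed.

Lemma testMl f g : (forall n, Cn n f) -> test_function g ->
  test_function (fun x => f x * g x).
Proof.
move=> Cf /test_functionP[Cg [A A0 gA]]; apply/test_functionP; split.
  by move=> n; exact: CnM.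
by exists A => // x h; rewrite gA// mulr0.
Qed.

Lemma test_tensor (f g : R -> R) (A : R) : 0 < A -> smooth1 f -> smooth1 g ->
  (forall s, A <= `|s| -> f s = 0) -> (forall s, A <= `|s| -> g s = 0) ->
  test_function (tensor f g).
Proof.
move=> A0 sf sg fA gA; apply/test_functionP; split; first exact: Cn_tensor.
exists A => // x [h|h]; rewrite /tensor; first by rewrite fA// mul0r.
by rewrite gA// mulr0.
Qed.

Lemma test_bounded f : test_function f -> exists2 C : R, 0 <= C & forall x, `|f x| <= C.
Proof.
move=> tf; have [Cf [A A0 fA]] := (test_functionP f).1 tf.
have /compact_bounded[M [Mr MS]] : compact (f @` (`[- A, A] `*` `[- A, A])).
  apply: continuous_compact; last exact: closed_square_compact.
  by apply: continuous_subspaceT; exact: test_continuous.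
exists (`|M| + 1); first by rewrite addr_ge0.
move=> x; have [[h|h]|h] := pselect (A <= `|x.1| \/ A <= `|x.2|).
- by rewrite fA ?normr0 ?addr_ge0//; left.
- by rewrite fA ?normr0 ?addr_ge0//; right.
- apply: (MS (`|M| + 1)); first by rewrite ltr_pwDr// ler_norm.
  exists x => //=; rewrite !in_itv/= -!ler_norml; split.
    by rewrite leNgt; apply/negP => /ltW k; apply: h; left.
  by rewrite leNgt; apply/negP => /ltW k; apply: h; right.
Qed.

Lemma bounded_derive_lipschitz (h : R -> R) (C : R) :
  (forall s : R, derivable h s 1) -> (forall s, `|'D_1 h s| <= C) ->
  forall a b, `|h a - h b| <= C * `|a - b|.
Proof.
move=> dh hC.
have D (s : R) : is_derive s 1 h ('D_1 h s) by exact: derivableP.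
suff H a b : a < b -> `|h b - h a| <= C * `|b - a|.
  move=> a b; have [ab|ab|->] := ltgtP a b; last by rewrite !subrr !normr0 mulr0.
  - by rewrite distrC (distrC a); exact: H.
  - exact: H.
move=> ab; have [c _ ->] := derive_eq_increment D ab.
by rewrite normrM ler_wpM2r.
Qed.

Lemma test_lipschitz f : test_function f -> exists2 C : R, 0 <= C &
  forall x y, `|f x - f y| <= C * (`|x.1 - y.1| + `|x.2 - y.2|).
Proof.
move=> tf; have [C0 C00 h0] := test_bounded (test_partial 0 tf).
have [C1 C10 h1] := test_bounded (test_partial 1 tf).
exists (C0 + C1); first by rewrite addr_ge0.
move=> [a b] [c d] /=.
have L i x s t : `|f (slice i x s) - f (slice i x t)| <= (if i == 0 then C0 else C1) * `|s - t|.
  have E u : slice i (slice i x u) = slice i x by rewrite /slice; case: (i == 0).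
  have F u : coordinate i (slice i x u) = u by rewrite /coordinate /slice; case: (i == 0).
  have K u : derivable (f \o slice i x) u 1 /\ partial i f (slice i x u) = 'D_1 (f \o slice i x) u.
    rewrite partial_slice E F; split=> //.
    by have := (derivable_slice i f (slice i x u)).1; rewrite E F; apply; exact: test_derivable.
  apply: (@bounded_derive_lipschitz (f \o slice i x)) => u; first by have [] := K u.
  have [_ <-] := K u.
  by case: i {E F K} => -[|[|//]] lt /=;
    [rewrite (_ : Ordinal _ = 0)//|rewrite (_ : Ordinal _ = 1)//]; apply: val_inj.
rewrite (_ : _ - _ = (f (a, b) - f (c, b)) + (f (c, b) - f (c, d))); last by ring.
have := L 0 (a, b) a c; have := L 1 (c, b) b d; rewrite /slice/= => l1 l0.
rewrite (le_trans (ler_normD _ _))// (le_trans (lerD l0 l1))//.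
rewrite mulrDr; apply: lerD; apply: ler_wpM2r => //; rewrite ?lerDl ?lerDr//.
Qed.

End TestFunctions.

(** * Averages of translates *)

Section Average.
Context {R : realType} d (Y : measurableType d) (nu : {measure set Y -> \bar R}).

Lemma integrable_bounded_mul (g h : Y -> R) (C : R) :
  nu.-integrable setT (EFin \o g) -> measurable_fun setT h ->
  (forall y, `|h y| <= C) -> nu.-integrable setT (EFin \o (fun y => g y * h y)).
Proof.
move=> ig mh hC; apply: (@eq_integrable _ _ _ _ _ _ ((EFin \o g) \* (EFin \o h))%E) => //.
apply: integrableMl => //; exists C; split; first exact: num_real.
by move=> M CM y _ /=; rewrite (le_trans (hC y))// ltW.
Qed.

Variables (g : Y -> R) (tau : Y -> R * R).
Hypothesis ig : nu.-integrable setT (EFin \o g).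
Hypothesis mtau : measurable_fun setT tau.

(** A superposition of translates of phi, general enough for two uses: with the line as parameter
    space and translations along an axis it is a sliding integral; with the plane and the
    translations by -y it is a convolution. The smoothness comes from phi alone, and g is merely
    integrable. *)
Definition average (phi : R * R -> R) (x : R * R) :=
  (\int[nu]_y (g y * phi (x + tau y)))%R.

Lemma measurable_translate (phi : R * R -> R) x : measurable_fun setT phi ->
  measurable_fun setT (fun y => phi (x + tau y)).
Proof.
move=> mphi.
have m1 : measurable_fun setT (fun y => tau y + x : R * R).
  exact: (measurableT_comp (measurable_shift2 x) mtau).
rewrite (_ : (fun y => _) = phi \o (fun y => tau y + x : R * R)).
  exact: (measurableT_comp mphi m1).
by apply/funext => y; apply: (congr1 phi); exact: addrC.
Qed.

Lemma integrable_average phi x : test_function phi ->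
  nu.-integrable setT (EFin \o (fun y => g y * phi (x + tau y))).
Proof.
move=> tphi; have [C C0 hC] := test_bounded tphi.
apply: (@integrable_bounded_mul g (fun y => phi (x + tau y)) C) => //.
by apply: measurable_translate; exact: test_measurable.
Qed.

Lemma average_continuous phi : test_function phi -> continuous (average phi).
Proof.
move=> tphi x; have [C C0 hC] := test_lipschitz tphi.
set G := (\int[nu]_y `|g y|)%R.
have G0 : 0 <= G by apply: Rintegral_ge0.
have iG := integrable_norm ig.
have H z : `|average phi x - average phi z| <= G * (C * (`|x.1 - z.1| + `|x.2 - z.2|)).
  rewrite /average -RintegralB//; [|exact: integrable_average..].
  apply: le_trans (le_normr_Rintegral _ _) _ => //.
    have := integrableB measurableT (integrable_average x tphi) (integrable_average z tphi).
    by apply: eq_integrable => // y _; rewrite /= EFinB.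
  rewrite -RintegralZr//; apply: le_Rintegral => //.
  - apply: integrable_norm.
    have := integrableB measurableT (integrable_average x tphi) (integrable_average z tphi).
    by apply: eq_integrable => // y _; rewrite /= EFinB.
  - have := integrableZr measurableT (C * (`|x.1 - z.1| + `|x.2 - z.2|)) iG.
    by apply: eq_integrable => // y _; rewrite /= EFinM.
  - move=> y _; rewrite -mulrBr normrM ler_wpM2l//.
    have := hC (x + tau y) (z + tau y).
    rewrite (_ : (x + tau y).1 - _ = x.1 - z.1); last by rewrite /=; ring.
    by rewrite (_ : (x + tau y).2 - _ = x.2 - z.2)//= ; ring.
(* The factor 2 accounts for the two coordinates in the Lipschitz bound; the summand 1 keeps the
   denominator positive when G * C = 0. *)
have K0 : 0 < 2 * (G * C + 1) by rewrite mulr_gt0// ltr_wpDl// mulr_ge0.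
apply/cvgrPdist_le => e e0.
have p : 0 < e / (2 * (G * C + 1)) by exact: (divr_gt0 e0 K0).
have Nx : nbhs (x : R * R) [set z : R * R | `|x - z| < e / (2 * (G * C + 1))].
  by apply/nbhs_ballP; exists (e / (2 * (G * C + 1))) => //= y; rewrite prod_norm_ball.
near=> z; apply: le_trans (H z) _.
have hz : `|x - z| < e / (2 * (G * C + 1)) by near: z; exact: Nx.
move: hz; rewrite prod_normE gt_max => /andP[h1 h2].
apply: (@le_trans _ _ (G * (C * (e / (2 * (G * C + 1)) + e / (2 * (G * C + 1)))))).
  by rewrite ler_wpM2l// ler_wpM2l// lerD// ltW.
rewrite (_ : G * _ = (G * C) / (G * C + 1) * e); last first.
  by field; rewrite gt_eqF// ltr_wpDl// mulr_ge0.
rewrite ler_piMl ?(ltW e0)// ler_pdivrMr ?ltr_wpDl ?mulr_ge0//.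
by rewrite mul1r lerDl.
Unshelve. all: end_near. Qed.

Lemma is_derive_average phi i x : test_function phi ->
  derivable (average phi) x (basis_vec i) /\
  partial i (average phi) x = average (partial i phi) x.
Proof.
move=> tphi.
have tp := test_partial i tphi.
have [C C0 hC] := test_bounded tp.
pose f (s : R) (y : Y) := g y * phi (slice i x s + tau y).
pose c := coordinate i x.
have D s y : derivable (f ^~ y) s 1 /\
    partial1of2 f s y = g y * partial i phi (slice i x s + tau y).
  pose psi z := phi (z + tau y).
  have tpsi : test_function psi := test_shift (tau y) tphi.
  have E : slice i (slice i x s) = slice i x by rewrite /slice; case: (i == 0).
  have F : coordinate i (slice i x s) = s by rewrite /coordinate /slice; case: (i == 0).
  have dp : derivable (psi \o slice i x) s 1.
    have := (derivable_slice i psi (slice i x s)).1; rewrite E F; apply.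
    exact: test_derivable.
  have ep : 'D_1 (psi \o slice i x) s = partial i phi (slice i x s + tau y).
    have [_ <-] := shift_difference_quotient i phi (slice i x s) (tau y).
    by rewrite [RHS]partial_slice E F.
  rewrite (_ : f ^~ y = cst (g y) * (psi \o slice i x)) //.
  have dc : derivable (cst (g y) : R -> R) s 1 by exact: derivable_cst.
  split; first exact: derivableM dc dp.
  rewrite partial1of2E -ep (_ : f ^~ y = cst (g y) * (psi \o slice i x)) //.
  by rewrite (deriveM dc dp) derive_cst scaler0 addr0.
have Ic : `]c - 1, c + 1[%classic c by rewrite /= in_itv/=; lra.
have If s : `]c - 1, c + 1[%classic s -> nu.-integrable setT (EFin \o f s).
  by move=> _; exact: integrable_average.
have Df s y : `]c - 1, c + 1[%classic s -> [set: Y] y -> derivable (f ^~ y) s 1.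
  by move=> _ _; have [] := D s y.
have G0 y : 0 <= `|g y| * C by rewrite mulr_ge0.
have iG : nu.-integrable setT (EFin \o (fun y => `|g y| * C)).
  have := integrableZr measurableT C (integrable_norm ig).
  by apply: eq_integrable => // y _; rewrite /= EFinM.
have Gub s y : `]c - 1, c + 1[%classic s -> [set: Y] y -> `|partial1of2 f s y| <= `|g y| * C.
  by move=> _ _; have [_ ->] := D s y; rewrite normrM ler_wpM2l.
have E : average phi \o slice i x = (fun s => \int[nu]_(y in setT) f s y)%R by [].
apply: is_derive_slice; rewrite E; apply: DeriveDef.
  exact: (derivable_under_integral measurableT Ic If Df G0 iG Gub).
rewrite -derive1E (differentiation_under_integral measurableT Ic If Df G0 iG Gub).
apply: eq_Rintegral => y _; have [_ ->] := D c y.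
by rewrite slice_coordinate.
Qed.

Lemma partial_average phi i : test_function phi ->
  partial i (average phi) = average (partial i phi).
Proof. by move=> tphi; apply/funext => x; have [] := is_derive_average i x tphi. Qed.

Lemma Cn_average n phi : test_function phi -> Cn n (average phi).
Proof.
elim: n phi => [|n IH] phi tphi; first exact: average_continuous.
split=> [|i]; first exact: average_continuous.
split=> [x|]; first by have [] := is_derive_average i x tphi.
by rewrite partial_average//; apply: IH; exact: test_partial.
Qed.

Lemma test_average phi (B : R) : test_function phi -> 
  (forall y, g y != 0 -> `|(tau y).1| <= B /\ `|(tau y).2| <= B) ->
  test_function (average phi).
Proof.
move=> tphi hB; apply/test_functionP; split; first by move=> n; exact: Cn_average.
have [_ [A A0 phiA]] := (test_functionP phi).1 tphi.
exists (A + `|B|); first by rewrite ltr_wpDr.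
move=> x h; rewrite /average (@eq_Rintegral _ _ _ _ _ (cst 0)) ?Rintegral_cst ?mul0r//.
move=> y _ /=; have [->|gy] := eqVneq (g y) 0; first by rewrite mul0r.
have [b1 b2] := hB y gy; have := ler_norm B => b3.
rewrite phiA ?mulr0//; case: h => h; [left|right].
  by have := lerB_normD x.1 (tau y).1 => /=; lra.
by have := lerB_normD x.2 (tau y).2 => /=; lra.
Qed.

End Average.

(** * The du Bois-Reymond lemma on a box *)

Section DuBoisReymond.
Context {R : realType}.
Local Notation mu := (@lebesgue_measure R).
Local Notation mu2 := (@lebesgue2 R).

Lemma flat0_ge0_le1 (s : R) : 0 <= flat 0 s <= 1.
Proof.
rewrite /flat; case: ifP => [s0|_]; last by rewrite lexx ler01.
by rewrite expr0 invr1 mul1r expR_ge0 -expR0 ler_expR oppr_le0 invr_ge0 ltW.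
Qed.

Lemma flat0_near1 (s : R) : 0 < s -> `|flat 0 s - 1| <= s^-1.
Proof.
move=> s0; have /andP[_ h] := flat0_ge0_le1 s.
rewrite distrC ger0_norm ?subr_ge0// /flat s0 expr0 invr1 mul1r.
have := expR_ge1Dx (- s^-1); lra.
Qed.

(** [flat 0] is 0 on the nonpositive axis and tends to 1 at infinity, so dilations approach the
    indicator of the open ray s > a. For the closed ray s <= b the offset n + 1 produces the limit 1
    at s = b itself, while the faster slope (n + 1)^2 makes the argument eventually negative at each
    s > b. *)
Definition cutoff_ray (a : R) (n : nat) (s : R) := flat 0 (n.+1%:R * (s - a)).
Definition cutoff_ray_closed (b : R) (n : nat) (s : R) :=
  flat 0 (n.+1%:R ^+ 2 * (b - s) + n.+1%:R).

Lemma smooth1_cutoff_ray a n : smooth1 (cutoff_ray a n).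
Proof.
have := @smooth1_affine R (flat 0) n.+1%:R (- (n.+1%:R * a)) (smooth1_flat 0).
by congr smooth1; apply/funext => s; rewrite /cutoff_ray mulrBr.
Qed.

Lemma smooth1_cutoff_ray_closed b n : smooth1 (cutoff_ray_closed b n).
Proof.
have := @smooth1_affine R (flat 0) (- n.+1%:R ^+ 2) (n.+1%:R ^+ 2 * b + n.+1%:R)
  (smooth1_flat 0).
by congr smooth1; apply/funext => s; rewrite /cutoff_ray_closed; congr flat; ring.
Qed.

Lemma cvg_harmonic_scale (c : R) : c * n.+1%:R^-1 @[n --> \oo] --> 0.
Proof.
by rewrite -[X in _ --> X](mulr0 c); apply: cvgMr; exact: cvg_harmonic.
Qed.

Lemma cvg_to1 (u : nat -> R) (c : R) (f : nat -> R) :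
  0 < c -> (forall n, c * n.+1%:R <= u n) ->
  flat 0 (u n) @[n --> \oo] --> (1 : R).
Proof.
move=> c0 cu; apply/cvgrPdist_le => e e0.
have /cvgr0Pnorm_le/(_ _ e0) := cvg_harmonic_scale c^-1.
apply: filterS => n h; rewrite distrC.
have u0 : 0 < u n by apply: lt_le_trans (cu n); rewrite mulr_gt0.
apply: le_trans (flat0_near1 u0) _; apply: le_trans h.
by rewrite -invfM ger0_norm ?invr_ge0 ?mulr_ge0 ?(ltW c0)// lef_pV2 ?posrE ?mulr_gt0// mulrC.
Qed.

Lemma cvg_cutoff_ray a s : cutoff_ray a n s @[n --> \oo] --> ((a < s)%R%:R : R).
Proof.
have [as_|sa] := ltP a s.
  apply: (@cvg_to1 _ (s - a)); rewrite ?subr_gt0// => n.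
  by rewrite mulrC.
rewrite (_ : cutoff_ray a ^~ s = cst 0); first exact: cvg_cst.
apply/funext => n; rewrite /cutoff_ray /flat ifF//; apply/negbTE.
by rewrite -leNgt mulr_ge0_le0// subr_le0.
Qed.

Lemma cvg_cutoff_ray_closed b s :
  cutoff_ray_closed b n s @[n --> \oo] --> ((s <= b)%R%:R : R).
Proof.
have [sb|bs] := leP s b.
  apply: (@cvg_to1 _ 1) => // n; rewrite mul1r lerDr mulr_ge0 ?exprn_ge0// subr_ge0//.
apply: cvg_near_cst.
have sb0 : 0 < s - b by rewrite subr_gt0.
have /cvgr0Pnorm_lt/(_ _ sb0) := @cvg_harmonic R.
apply: filterS => n; rewrite ger0_norm ?invr_ge0// /= => h.
rewrite /cutoff_ray_closed /flat ifF//; apply/negbTE; rewrite -leNgt.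
have n0 : 0 < n.+1%:R :> R by rewrite ltr0n.
have : 1 < n.+1%:R * (s - b) by rewrite mulrC -ltr_pdivrMr// mul1r.
move=> /ltW/(ler_wpM2l (ltW n0)); rewrite mulr1 => k.
rewrite expr2 -mulrA; lra.
Qed.

Lemma mulr_01 (p q : R) : 0 <= p <= 1 -> 0 <= q <= 1 -> 0 <= p * q <= 1.
Proof. by move=> /andP[? ?] /andP[? ?]; rewrite mulr_ge0//= mulr_ile1. Qed.

Definition oc_cutoff (l r : R) n s := cutoff_ray l n s * cutoff_ray_closed r n s.

Lemma oc_cutoff_01 l r n s : 0 <= oc_cutoff l r n s <= 1.
Proof.
by apply: mulr_01; exact: flat0_ge0_le1.
Qed.

Lemma smooth1_oc_cutoff l r n : smooth1 (oc_cutoff l r n).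
Proof.
by apply: smooth1M; [exact: smooth1_cutoff_ray|exact: smooth1_cutoff_ray_closed].
Qed.

Lemma cvg_oc_cutoff l r s : oc_cutoff l r n s @[n --> \oo] --> ((s \in `]l, r])%:R : R).
Proof.
rewrite in_itv/= -mulnb natrM.
by apply: cvgM; [exact: cvg_cutoff_ray|exact: cvg_cutoff_ray_closed].
Qed.

(** The offset in the closed cut-off spreads the support up to r + 1 / (n + 1); hence the bound r +
    1, uniform in n. *)
Lemma oc_cutoff0 l r n s : ~~ (l < s < r + 1) -> oc_cutoff l r n s = 0.
Proof.
rewrite negb_and -!leNgt /oc_cutoff => /orP[sl|rs].
  rewrite /cutoff_ray /flat ifF ?mul0r//; apply/negbTE.
  by rewrite -leNgt mulr_ge0_le0// subr_le0.
rewrite /cutoff_ray_closed [X in _ * X]/flat ifF ?mulr0//; apply/negbTE.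
have n1 : 1 <= n.+1%:R :> R by rewrite ler1n.
have h : n.+1%:R ^+ 2 * 1 <= n.+1%:R ^+ 2 * (s - r) :> R.
  by rewrite ler_wpM2l ?exprn_ge0//; lra.
have h2 : n.+1%:R <= n.+1%:R ^+ 2 :> R by rewrite expr2 ler_peMl// ler0n.
rewrite -leNgt; lra.
Qed.

Section Box.
Variables (a b c d : R) (f : R * R -> R).
Let U : set (R * R) := `]a, b[ `*` `]c, d[.
Hypothesis fU : mu2.-integrable U (EFin \o f).
Hypothesis f0 : forall p q : R -> R, smooth1 p -> smooth1 q ->
  (forall s, s \notin `]a, b[ -> p s = 0) -> (forall s, s \notin `]c, d[ -> q s = 0) ->
  dist_of f (tensor p q) = 0.

Let mU : measurable U.
Proof. by apply: measurableX; exact: measurable_itv. Qed.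

Let g := f \_ U.

Let ig : mu2.-integrable setT (EFin \o g).
Proof.
by have := (@integrable_mkcond _ _ _ mu2 _ (EFin \o f) mU).1 fU; rewrite restrict_EFin.
Qed.

(** Dominated convergence with majorant |g| carries the orthogonality from smooth tests to the
    indicator of A. *)
Lemma dominated_integral0 (phi : nat -> R * R -> R) (A : set (R * R)) :
  measurable A ->
  (forall n, measurable_fun setT (phi n)) ->
  (forall n x, 0 <= phi n x <= 1) ->
  (forall x, U x -> phi n x @[n --> \oo] --> (\1_A x : R)) ->
  (forall n, dist_of f (phi n) = 0) -> (forall n x, ~ U x -> phi n x = 0) ->
  (\int[mu2]_(x in A) (g x)%:E = 0)%E.
Proof.
move=> mA mphi phi01 phiA phi0 phiU.
have ign n : mu2.-integrable setT (EFin \o (fun x => g x * phi n x)).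
  apply: (@integrable_bounded_mul _ _ _ mu2 g (phi n) 1 ig (mphi n)) => x.
  by have /andP[? ?] := phi01 n x; rewrite ger0_norm.
have Z n : (\int[mu2]_x (g x * phi n x)%:E = 0)%E.
  have := phi0 n; rewrite /dist_of /Rintegral => h.
  rewrite -[LHS]fineK; last exact: integrable_fin_num (ign n).
  congr EFin; apply: etrans h; congr fine; apply: eq_integral => x _; congr EFin.
  rewrite /g patchE; case: ifPn => // /negP xU.
  by rewrite phiU ?mulr0// => /mem_set.
have mgA : measurable_fun setT (fun x => (g x * \1_A x)%:E).
  apply/measurable_EFinP; apply: measurable_funM.
    by have /integrableP[/measurable_EFinP] := ig.
  exact: measurable_indic.
have H : (\int[mu2]_x (g x * phi n x)%:E @[n --> \oo] --> \int[mu2]_x (g x * \1_A x)%:E)%E.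
  apply: (@dominated_cvg _ _ _ mu2 setT measurableT
    (fun n x => (g x * phi n x)%:E) _ (EFin \o (fun x => `|g x|))).
  - by move=> n; have /integrableP[] := ign n.
  - move=> x _; apply: cvg_EFin; first exact: nearW.
    rewrite /comp /=.
    have [Ux|nUx] := pselect (U x); first by apply: cvgMr; exact: phiA.
    have -> : g x = 0 by rewrite /g patchE memNset.
    by under eq_fun do rewrite mul0r; rewrite mul0r; exact: cvg_cst.
  - by [].
  - exact: integrable_norm.
  - move=> n x _; rewrite lee_fin normrM ler_piMr//.
    by have /andP[? ?] := phi01 n x; rewrite ger0_norm.
move: H; under eq_fun do rewrite Z; move=> H.
have e := cvg_unique _ H (@cvg_cst _ _ _ _ _).
rewrite integral_mkcond -[RHS]e; last exact: ereal_hausdorff.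
apply: eq_integral => x _; rewrite patchE indicE; case: ifPn => _.
  by rewrite mulr1.
by rewrite mulr0.
Qed.

Let cut (l r : R) n s := cutoff_ray l n s * cutoff_ray (- r) n (- s).

Let smooth_cut l r n : smooth1 (cut l r n).
Proof.
apply: smooth1M; first exact: smooth1_cutoff_ray.
have := @smooth1_affine R _ (-1) 0 (smooth1_cutoff_ray (- r) n).
by congr smooth1; apply/funext => s; congr cutoff_ray; ring.
Qed.

Let cut01 l r n s : 0 <= cut l r n s <= 1.
Proof.
by apply: mulr_01; exact: flat0_ge0_le1.
Qed.

Let cut0 l r n s : s \notin `]l, r[ -> cut l r n s = 0.
Proof.
rewrite in_itv/= negb_and -!leNgt => /orP[h|h]; rewrite /cut /cutoff_ray.
  by rewrite {1}/flat ifF ?mul0r//; apply/negbTE; rewrite -leNgt mulr_ge0_le0// subr_le0.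
by rewrite {2}/flat ifF ?mulr0//; apply/negbTE; rewrite -leNgt mulr_ge0_le0//; lra.
Qed.

Let cvg_cut l r s : s \in `]l, r[ -> cut l r n s @[n --> \oo] --> (1 : R).
Proof.
rewrite in_itv/= => /andP[h1 h2].
have A1 : cutoff_ray l n s @[n --> \oo] --> (1 : R).
  by have := @cvg_cutoff_ray l s; rewrite h1.
have A2 : cutoff_ray (- r) n (- s) @[n --> \oo] --> (1 : R).
  by have := @cvg_cutoff_ray (- r) (- s); rewrite ltrN2 h2.
by rewrite -[X in _ --> X](mulr1 (1 : R)); exact: cvgM A1 A2.
Qed.

Let measurable_smooth (p q : R -> R) : smooth1 p -> smooth1 q ->
  measurable_fun setT (tensor p q).
Proof. by move=> sp sq; apply: continuous_measurable2; exact: (Cn_tensor sp sq 0). Qed.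

Lemma integral_measurable0 (A : set (R * R)) : measurable A ->
  (\int[mu2]_(x in A) (g x)%:E = 0)%E.
Proof.
have iA B : measurable B -> mu2.-integrable B (fun x => (g x)%:E).
  by move=> mB; apply: integrableS ig.
(* The integral over the whole plane must vanish first: it is what gives stability of the class
   under complements. *)
have IT : (\int[mu2]_x (g x)%:E = 0)%E.
  apply: (@dominated_integral0 (fun n => tensor (cut a b n) (cut c d n))) => //.
  - by move=> n; exact: measurable_smooth.
  - by move=> n x; exact: mulr_01.
  - move=> x [h1 h2]; rewrite indicE in_setT /tensor -[X in _ --> X](mulr1 1).
    by apply: cvgM; exact: cvg_cut.
  - by move=> n; apply: f0 => // s; exact: cut0.
  - move=> n x /not_andP[h|h]; rewrite /tensor.
      by rewrite cut0 ?mul0r//; exact/negP.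
    by rewrite [X in _ * X]cut0 ?mulr0//; exact/negP.
pose H := [set A : set (R * R) | measurable A /\ (\int[mu2]_(x in A) (g x)%:E = 0)%E].
suff : forall A : set (measurableTypeR R * measurableTypeR R), measurable A -> H A.
  by move=> + mA => /(_ A mA)[].
apply: dynkin_oc_boxes.
  split.
  - by split => //; exact: measurableT.
  - move=> B [mB B0]; split; first exact: measurableC.
    have := @integral_setU _ _ _ mu2 B (~` B) (fun x => (g x)%:E) mB (measurableC mB).
    rewrite setUv IT B0 add0e => <- //.
      by have /integrableP[] := ig.
    by rewrite /disj_set setICr eqxx.
  - move=> F tF HF; split; first by apply: bigcupT_measurable => k; have [] := HF k.
    have mF k : measurable (F k) by have [] := HF k.
    rewrite integral_bigcup//; last by apply: iA; exact: bigcupT_measurable.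
    by apply: eseries0 => k _ _; have [] := HF k.
move=> _ [_ [[l r] _ <-] [_ [[l' r'] _ <-] <-]].
have mB : measurable (`]l, r] `*` `]l', r'] : set (R * R)).
  by apply: measurableX; exact: measurable_itv.
split => //=.
(* The cut-off of a half-open box may leak out of the box U on which the hypothesis holds; the
   additional factors [cut] keep the test function inside U and tend to 1 there. *)
apply: (@dominated_integral0 (fun n => tensor
    (fun s => cut a b n s * oc_cutoff l r n s) (fun s => cut c d n s * oc_cutoff l' r' n s))) => //.
- by move=> n; apply: measurable_smooth; apply: smooth1M => //; exact: smooth1_oc_cutoff.
- by move=> n x; apply: mulr_01; apply: mulr_01 => //; exact: oc_cutoff_01.
- move=> x [h1 h2].
  have -> : (\1_(`]l, r] `*` `]l', r']) x : R) =
      (1 * (x.1 \in `]l, r])%:R) * (1 * (x.2 \in `]l', r'])%:R).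
    rewrite !mul1r -natrM mulnb indicE; congr ((nat_of_bool _)%:R).
    by apply/idP/andP => [/set_mem[]|[? ?]]; [|rewrite inE].
  by apply: cvgM; (apply: cvgM; [exact: cvg_cut|exact: cvg_oc_cutoff]).
- move=> n; apply: f0; [by apply: smooth1M => //; exact: smooth1_oc_cutoff..|idtac|idtac].
    by move=> s sn; rewrite cut0 ?mul0r.
  by move=> s sn; rewrite cut0 ?mul0r.
- move=> n x /not_andP[h|h]; rewrite /tensor.
    by rewrite cut0 ?mul0r//; exact/negP.
  by rewrite [X in _ * (X * _)]cut0 ?mul0r ?mulr0//; exact/negP.
Qed.

(** Tensor products suffice as tests because they approximate indicators of half-open boxes; by
    Dynkin's theorem f, restricted to U, then has integral 0 over every measurable set. *)
Lemma du_bois_reymond_box : {ae mu2, forall x, U x -> f x = 0}.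
Proof.
have := @integral_ae_eq _ _ _ mu2 setT measurableT (cst 0%E) (EFin \o g) ig
  (measurable_cst _).
have h E : E `<=` setT -> measurable E ->
    (\int[mu2]_(x in E) (EFin \o g) x = \int[mu2]_(x in E) cst 0 x)%E.
  by move=> _ mE; rewrite integral0; exact: integral_measurable0.
move=> /(_ h); apply: filterS => x /= /(_ I)[].
by move=> + Ux; rewrite /g patchE mem_set.
Qed.

End Box.
End DuBoisReymond.

(** * Monodromy: primitives on simply connected sets *)

Section Monodromy.
Context {R : realType}.
Local Notation T := (R * R)%type.
Variable (d : T -> T -> R).

(** [d x y] plays the part of the integral of a closed form from x to y. The cocycle identity on A
    expresses that the form is exact on A. *)
Definition additive_on (A : set T) :=
  forall x y z, A x -> A y -> A z -> d x y + d y z = d x z.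

Lemma additive_onS (A B : set T) : A `<=` B -> additive_on B -> additive_on A.
Proof. by move=> AB h x y z /AB ? /AB ? /AB ?; exact: h. Qed.

Lemma additive_on_refl A x : additive_on A -> A x -> d x x = 0.
Proof. by move=> h Ax; have := h x x x Ax Ax Ax; lra. Qed.

Lemma additive_on_sym A x y : additive_on A -> A x -> A y -> d y x = - d x y.
Proof.
by move=> h Ax Ay; have := h x y x Ax Ay Ax; rewrite (additive_on_refl h Ax); lra.
Qed.

Definition increments (v : nat -> T) N := \sum_(j < N) d (v j) (v j.+1).

(** A discrete Stokes formula: around each cell of the ladder the increments cancel, because its
    four corners lie in a set where d is additive, and the inner rungs telescope. *)
Lemma increments_ladder (v w : nat -> T) N :
  (forall j, (j < N)%N -> additive_on [set x | [\/ x = v j, x = v j.+1, x = w j | x = w j.+1]]) ->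
  increments v N + d (v N) (w N) = d (v 0%N) (w 0%N) + increments w N.
Proof.
elim: N => [|N IH] h; first by rewrite /increments !big_ord0 add0r addr0.
have {}IH := IH (fun j jN => h j (leqW jN)).
have hN := h N (ltnSn N).
rewrite /increments !big_ord_recr/= -/(increments v N) -/(increments w N) addrA -IH.
have e1 := hN (v N) (v N.+1) (w N.+1).
have e2 := hN (v N) (w N) (w N.+1).
have a0 : [\/ v N = v N, v N = v N.+1, v N = w N | v N = w N.+1] by constructor.
have a1 : [\/ v N.+1 = v N, v N.+1 = v N.+1, v N.+1 = w N | v N.+1 = w N.+1] by constructor.
have a2 : [\/ w N = v N, w N = v N.+1, w N = w N | w N = w N.+1] by constructor.
have a3 : [\/ w N.+1 = v N, w N.+1 = v N.+1, w N.+1 = w N | w N.+1 = w N.+1] by constructor.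
have := e1 a0 a1 a3; have := e2 a0 a2 a3; lra.
Qed.

Lemma increments_additive (v : nat -> T) N A : additive_on A -> (forall j, A (v j)) ->
  increments v N = d (v 0%N) (v N).
Proof.
move=> h Av; elim: N => [|N IH].
  by rewrite /increments big_ord0 (additive_on_refl h (Av 0%N)).
by rewrite /increments big_ord_recr/= -/(increments v N) IH; exact: h.
Qed.

Lemma increments_cat (v : nat -> T) N M :
  increments v (N + M) = increments v N + increments (fun j => v (N + j)%N) M.
Proof.
rewrite /increments big_split_ord/=; congr (_ + _).
by apply: eq_bigr => i _; rewrite addnS.
Qed.

Lemma increments_ext (v w : nat -> T) N : (forall j, (j <= N)%N -> v j = w j) ->
  increments v N = increments w N.
Proof.
by move=> h; apply: eq_bigr => i _; rewrite !h// ltnW.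
Qed.

Lemma increments_double (v : nat -> T) N :
  (forall j, (j < N)%N -> additive_on [set x | [\/ x = v j.*2, x = v j.*2.+1 | x = v j.*2.+2]]) ->
  increments v N.*2 = increments (fun j => v j.*2) N.
Proof.
elim: N => [|N IH] h; first by rewrite /increments !big_ord0.
rewrite /increments doubleS !big_ord_recr/= -!/(increments _ _) IH; last first.
  by move=> j jN; apply: h; exact: leqW.
rewrite -addrA; congr (_ + _).
by apply: (h N (ltnSn N)); constructor.
Qed.

Lemma increments_rev (v : nat -> T) N :
  (forall j, (j < N)%N -> additive_on [set x | x = v j \/ x = v j.+1]) ->
  increments (fun j => v (N - j)%N) N = - increments v N.
Proof.
move=> h; rewrite /increments -sumrN (reindex_inj rev_ord_inj)/=.
apply: eq_bigr => i _; have iN := ltn_ord i.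
rewrite subKn// -subSn// subSS subKn; last exact: ltnW.
by apply: (additive_on_sym (h i iN)); [left|right].
Qed.

Variable Omega : set T.
Hypothesis loc : forall p, Omega p -> exists2 r : R, 0 < r & ball p r `<=` Omega /\ additive_on (ball p r).

Local Notation I01 := (`[0, 1]%classic : set R).

(** Lebesgue's number lemma, by compactness of the square. The radius is twice the mesh width, so
    that the neighbours of a grid point lie inside the open ball around it. *)
Lemma square_mesh (H : T -> T) : {within I01 `*` I01, continuous H} ->
  H @` (I01 `*` I01) `<=` Omega ->
  exists N0 : nat, forall N, (N0 <= N)%N -> forall q, (I01 `*` I01) q ->
    additive_on (H @` ((I01 `*` I01) `&` ball q (2 / N.+1%:R))).
Proof.
move=> cH HO; set K := I01 `*` I01.
have cK : compact K by apply: compact_setX; exact: segment_compact.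
have P : forall x, K x -> \forall x' \near x & i \near \oo,
    additive_on (H @` (K `&` ball x' (2 / i.+1%:R))).
  move=> q Kq.
  have Oq : Omega (H q) by apply: HO; exists q.
  have [r r0 [_ hr]] := loc Oq.
  have /subspace_continuousP/(_ q Kq)/cvg_ballP/(_ r r0) := cH.
  rewrite near_withinE => /nbhs_ballP[e /= e0 he].
  exists (ball q (e / 2), [set N | 2 / N.+1%:R < e / 2]).
    split; first by apply: nbhsx_ballx; rewrite divr_gt0.
    have e4 : 0 < e / 4 by rewrite divr_gt0.
    have /cvgr0Pnorm_lt/(_ _ e4) := @cvg_harmonic R.
    apply: filterS => n /=; rewrite ger0_norm ?invr_ge0// => hn.
    by rewrite (_ : e / 2 = 2 * (e / 4)) ?ltr_pM2l//; lra.
  move=> [q' N] /= [qq' Ne]; apply: additive_onS hr.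
  move=> _ [z [Kz q'z] <-]; apply: he => //.
  have := ball_triangle qq' q'z; by apply: le_ball; rewrite [leRHS]splitr lerD2l ltW.
have [N0 _ h] := (compact_near_coveringP K).1 cK nat \oo
  (fun N q => additive_on (H @` (K `&` ball q (2 / N.+1%:R)))) _ P.
exists N0 => N NN0 q Kq; exact: (h N NN0).
Qed.

Definition sample (g : R -> T) N (j : nat) : T := g (j%:R / N%:R).

Lemma sample_itv N j : (j <= N)%N -> I01 (j%:R / N%:R).
Proof.
move=> jN; rewrite /= in_itv/= divr_ge0//=.
case: N jN => [|N] jN; first by rewrite invr0 mulr0.
by rewrite ler_pdivrMr// mul1r ler_nat.
Qed.

Lemma path_mesh (g : R -> T) : {within I01, continuous g} -> g @` I01 `<=` Omega ->
  exists N0 : nat, forall N, (N0 <= N)%N -> forall t, I01 t ->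
    additive_on (g @` (I01 `&` ball t (2 / N.+1%:R))).
Proof.
move=> cg gO.
(* A path is treated as a homotopy that does not depend on its first variable. *)
have [|_ [[s t] [_ /= It] <-]|N0 h] := @square_mesh (fun q => g q.2).
- apply/subspace_continuousP => q [Iq1 Iq2] U /= gU.
  have /subspace_continuousP/(_ q.2 Iq2 U gU) := cg.
  move=> hU; have {}hU : nbhs q.2 [set s | I01 s -> U (g s)] := hU.
  have snd_cvg : (fun z : T => z.2) z @[z --> q] --> q.2 by exact: cvg_snd.
  have : nbhs q [set z : T | (I01 `*` I01) z -> U (g z.2)].
    have hq : nbhs q ((fun z : T => z.2) @^-1` [set s | I01 s -> U (g s)]) := snd_cvg _ hU.
    by apply: filterS hq => z /= h [_ Iz]; exact: h.
  by [].
- by apply: gO; exists t.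
exists N0 => N NN0 t It; have I0 : I01 0 by rewrite /= in_itv/= lexx ler01.
apply: additive_onS (h N NN0 (0, t) (conj I0 It)).
move=> _ [s [Is ts] <-]; exists (0, s) => //; split=> //.
by split => //; apply: ballxx; rewrite divr_gt0.
Qed.

Lemma path_mesh_sample (g : R -> T) : {within I01, continuous g} -> g @` I01 `<=` Omega ->
  exists N0 : nat, forall N j, (N0 <= N)%N -> (j < N)%N ->
    additive_on [set x | exists2 t, I01 t /\ `|t - j%:R / N%:R| <= N%:R^-1 & x = g t].
Proof.
move=> cg gO; have [N0 h] := path_mesh cg gO; exists N0.+1 => -[//|N] j NN0 jN.
apply: additive_onS (h N NN0 _ (sample_itv (ltnW jN))).
move=> _ [t [It tj] ->]; exists t => //; split => //=.
rewrite -ball_normE /ball_/= distrC; apply: le_lt_trans tj _.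
by rewrite ltr_pMl ?ltr1n ?invr_gt0.
Qed.

(** Once the mesh is fine, inserting midpoints leaves the sum unchanged, so along dyadic
    subdivisions it is eventually constant. This eventual value serves as the integral along g,
    which is only continuous. *)
Lemma eventual_increments (g : R -> T) :
  {within I01, continuous g} -> g @` I01 `<=` Omega ->
  exists l, exists k0 : nat, forall k, (k0 <= k)%N -> increments (sample g (2 ^ k)) (2 ^ k) = l.
Proof.
move=> cg gO; have [N0 h] := path_mesh_sample cg gO.
exists (increments (sample g (2 ^ N0)) (2 ^ N0)), N0.
elim=> [|k IH]; first by rewrite leqn0 => /eqP ->.
rewrite leq_eqVlt => /orP[/eqP -> //|]; rewrite ltnS => k0k.
rewrite -(IH k0k) expnS mul2n increments_double.
  apply: increments_ext => j _; rewrite /sample -!muln2 !natrM; congr g.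
  have : (2 ^ k)%:R != 0 :> R by rewrite pnatr_eq0 expn_eq0.
  by move=> ?; field.
move=> j jk.
have Nk : (N0 <= 2 ^ k)%N by apply: leq_trans k0k (ltnW (ltn_expl _ _)).
apply: additive_onS (h (2 ^ k)%N j Nk jk).
have P0 : 0 < (2 ^ k)%:R :> R by rewrite ltr0n expn_gt0.
have jk2 : (j.*2.+2 <= (2 ^ k).*2)%N by rewrite -doubleS leq_double.
have D m : (m <= 2)%N -> exists2 t, I01 t /\ `|t - j%:R / (2 ^ k)%:R| <= (2 ^ k)%:R^-1 &
    sample g (2 ^ k).*2 (j.*2 + m)%N = g t.
  move=> m2; exists ((j.*2 + m)%:R / (2 ^ k).*2%:R) => //; split.
    by apply: sample_itv; apply: leq_trans jk2; rewrite -addn2 leq_add2l.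
  rewrite (_ : _ - _ = m%:R / 2 / (2 ^ k)%:R); last first.
    rewrite natrD -!muln2 !natrM; field; exact: lt0r_neq0.
  rewrite normrM [X in _ * X]ger0_norm ?invr_ge0 ?ler0n//.
  rewrite ler_piMl ?invr_ge0 ?ler0n// ger0_norm ?divr_ge0//.
  by rewrite ler_pdivrMr// mul1r ler_nat.
move=> x /= [] ->.
- by have [t Ht e] := D 0%N isT; exists t => //; rewrite -e addn0.
- by have [t Ht e] := D 1%N isT; exists t => //; rewrite -e addn1.
- by have [t Ht e] := D 2%N isT; exists t => //; rewrite -e addn2.
Qed.

(** Consecutive rows of the grid have equal sums: the ladder formula applies, and its two extreme
    rungs coincide because all rows begin and end at g 0. The last row is constant and contributes
    0. *)
Lemma null_homotopic_increments (g : R -> T) : null_homotopic_loop Omega g ->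
  exists N0 : nat, forall N, (N0 <= N)%N -> increments (sample g N) N = 0.
Proof.
move=> [H [cH HO H0 H1 Hs]].
have [N0 h] := square_mesh cH HO; exists N0.+1 => -[//|N] NN0.
pose v i j := H (i%:R / N.+1%:R, j%:R / N.+1%:R).
have N1 : (N.+1%:R / N.+1%:R : R) = 1 by rewrite divff.
have L i : (i < N.+1)%N -> increments (v i) N.+1 = increments (v i.+1) N.+1.
  move=> iN.
  have := @increments_ladder (v i) (v i.+1) N.+1.
  have mi m : (m <= N.+1)%N -> (m%:R / N.+1%:R : R) \in `[0, 1].
    by move=> mN; exact: (sample_itv mN).
  have e0 : v i 0%N = g 0.
    by rewrite /v mul0r; have [] := Hs _ (mi _ (ltnW iN)).
  have e1 : v i.+1 0%N = g 0 by rewrite /v mul0r; have [] := Hs _ (mi _ iN).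
  have e2 : v i N.+1 = g 0 by rewrite /v N1; have [] := Hs _ (mi _ (ltnW iN)).
  have e3 : v i.+1 N.+1 = g 0 by rewrite /v N1; have [] := Hs _ (mi _ iN).
  have C j : (j < N.+1)%N -> additive_on
      [set x | [\/ x = v i j, x = v i j.+1, x = v i.+1 j | x = v i.+1 j.+1]].
    move=> jN; have q : (I01 `*` I01) (i%:R / N.+1%:R, j%:R / N.+1%:R).
      by split; [exact: (mi _ (ltnW iN))|exact: (mi _ (ltnW jN))].
    apply: additive_onS (h N NN0 _ q).
    have B0 (m : nat) : ball (m%:R / N.+1%:R : R) (2 / N.+1%:R) (m%:R / N.+1%:R).
      by apply: ballxx; rewrite divr_gt0.
    have B1 (m : nat) : ball (m%:R / N.+1%:R : R) (2 / N.+1%:R) (m.+1%:R / N.+1%:R).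
      rewrite -ball_normE /ball_/= -mulrBl -natr1 opprD addNKr normrM normrN1 mul1r.
      by rewrite ger0_norm ?invr_ge0// ltr_pMl ?invr_gt0// ltr1n.
    move=> x /= [] ->.
    - by exists (i%:R / N.+1%:R, j%:R / N.+1%:R) => //; split=> //; split=> /=.
    - exists (i%:R / N.+1%:R, j.+1%:R / N.+1%:R) => //; split; last by split=> /=.
      by split; [exact: (mi _ (ltnW iN))|exact: (mi _ jN)].
    - exists (i.+1%:R / N.+1%:R, j%:R / N.+1%:R) => //; split; last by split=> /=.
      by split; [exact: (mi _ iN)|exact: (mi _ (ltnW jN))].
    - exists (i.+1%:R / N.+1%:R, j.+1%:R / N.+1%:R) => //; split; last by split=> /=.
      by split; [exact: (mi _ iN)|exact: (mi _ jN)].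
  move=> /(_ C); rewrite e0 e1 e2 e3.
  by rewrite [RHS]addrC => /addIr.
have E i : (i <= N.+1)%N -> increments (v 0%N) N.+1 = increments (v i) N.+1.
  by elim: i => [_|i IH iN]; [reflexivity|exact: etrans (IH (ltnW iN)) (L i iN)].
have -> : increments (sample g N.+1) N.+1 = increments (v 0%N) N.+1.
  apply: increments_ext => j jN; rewrite /v /sample mul0r H0//; exact: (sample_itv jN).
rewrite (E N.+1 (leqnn _)).
have g0 : Omega (g 0).
  apply: HO; exists (0, 0); last by rewrite H0// in_itv/= lexx ler01.
  by split; rewrite /= in_itv/= lexx ler01.
have [r r0 [_ hr]] := loc g0.
have -> : increments (v N.+1) N.+1 = increments (fun=> g 0) N.+1.
  apply: increments_ext => j jN; rewrite /v N1 H1//; exact: (sample_itv jN).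
have g0r := ballxx (g 0) r0.
by rewrite (increments_additive _ hr) ?(additive_on_refl hr g0r).
Qed.

(** The retraction of the line onto [0, 1], written with absolute values so that its continuity is
    immediate. It extends a path to the whole line. *)
Definition clamp (t : R) : R := (`|t| - `|t - 1| + 1) / 2.

Lemma clamp_continuous : continuous clamp.
Proof.
move=> t; apply: cvgMl; apply: cvgD; last exact: cvg_cst.
apply: cvgB; first exact: norm_continuous.
apply: (@continuous_comp _ _ _ (fun t : R => t - 1) (fun r : R => `|r|)).
  by apply: cvgB; [exact: cvg_id|exact: cvg_cst].
exact: norm_continuous.
Qed.

Lemma clamp_le0 t : t <= 0 -> clamp t = 0.
Proof. by move=> t0; rewrite /clamp !ler0_norm; lra. Qed.

Lemma clamp_ge1 t : 1 <= t -> clamp t = 1.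
Proof. by move=> t1; rewrite /clamp !ger0_norm; lra. Qed.

Lemma clamp_id t : I01 t -> clamp t = t.
Proof.
rewrite /= in_itv/= => /andP[t0 t1].
by rewrite /clamp ger0_norm// ler0_norm; lra.
Qed.

Lemma clamp_itv t : I01 (clamp t).
Proof.
have [t0|t0] := leP t 0; first by rewrite clamp_le0//= in_itv/= lexx ler01.
have [t1|t1] := leP 1 t; first by rewrite clamp_ge1//= in_itv/= lexx ler01.
have It : I01 t by rewrite /= in_itv/= !ltW.
by rewrite clamp_id.
Qed.

Lemma clamp_path_continuous (g : R -> T) : {within I01, continuous g} ->
  continuous (g \o clamp).
Proof.
move=> cg t U gU.
have /subspace_continuousP/(_ _ (clamp_itv t) U gU) := cg.
move=> hU; have {}hU : nbhs (clamp t) [set s | I01 s -> U (g s)] := hU.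
have ht : nbhs t (clamp @^-1` [set s | I01 s -> U (g s)]) := @clamp_continuous t _ hU.
by apply: filterS ht => s h; apply: h; exact: clamp_itv.
Qed.

Lemma ball_convex (p x y : T) (r s : R) : ball p r x -> ball p r y -> I01 s ->
  ball p r (x + s *: (y - x)).
Proof.
have C (a b c : R) : `|a - b| < r -> `|a - c| < r -> I01 s -> `|a - (b + s * (c - b))| < r.
  rewrite /= in_itv/= => h1 h2 /andP[s0 s1].
  rewrite (_ : a - _ = (1 - s) * (a - b) + s * (a - c)); last by ring.
  apply: le_lt_trans (ler_normD _ _) _; rewrite !normrM (ger0_norm s0) ger0_norm ?subr_ge0//.
  move: s0; rewrite le_eqVlt => /orP[/eqP <-|s0]; first by rewrite subr0 mul1r mul0r addr0.
  have : s * `|a - c| < s * r by rewrite ltr_pM2l.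
  have : (1 - s) * `|a - b| <= (1 - s) * r by rewrite ler_wpM2l ?subr_ge0// ltW.
  lra.
rewrite !ballE2 => -[h1 h2] [h3 h4] Is; split.
- by move: h1 h3; rewrite /= -!ball_normE /ball_/= => h1 h3; exact: C.
- by move: h2 h4; rewrite /= -!ball_normE /ball_/= => h2 h4; exact: C.
Qed.

(** F x is the integral along a chosen path from x0 to x. The loop that follows the path to x, the
    segment from x to y, and the path to y backwards is null-homotopic, whence F x + d x y - F y =
    0. *)
Theorem local_primitive : simply_connected Omega ->
  exists F : T -> R, forall p, Omega p -> exists2 r : R, 0 < r &
    forall x y, ball p r x -> ball p r y -> F y - F x = d x y.
Proof.
move=> [pc sc].
have [[x0 Ox0]|nO] := pselect (exists x, Omega x); last first.
  by exists (fun=> 0) => p Op; exfalso; apply: nO; exists p.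
have /choice[gam hgam] x : exists g : R -> T, Omega x ->
    [/\ {within I01, continuous g}, g @` I01 `<=` Omega, g 0 = x0 & g 1 = x].
  have [Ox|nOx] := pselect (Omega x); last by exists (fun=> x0).
  by have [g hg] := pc _ _ Ox0 Ox; exists g.
have /choice[F hF] x : exists l : R, Omega x ->
    exists k0 : nat, forall k, (k0 <= k)%N -> increments (sample (gam x) (2 ^ k)) (2 ^ k) = l.
  have [Ox|nOx] := pselect (Omega x); last by exists 0.
  have [cg gO _ _] := hgam x Ox.
  by have [l hl] := eventual_increments cg gO; exists l.
exists F => p Op; have [r r0 [bO hr]] := loc Op; exists r => // x y px py.
have [Ox Oy] := (bO _ px, bO _ py).
have [cx gxO gx0 gx1] := hgam x Ox; have [cy gyO gy0 gy1] := hgam y Oy.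
pose seg (s : R) := x + s *: (y - x).
(* The concatenation as a single sum: outside its own third of [0, 1] each summand is constant, and
   the constants cancel. Continuity is then that of a sum. *)
pose loop t := (gam x \o clamp) (3 * t) + (clamp (3 * t - 1) *: (y - x)
  + ((gam y \o clamp) (3 - 3 * t) - y)).
have loop1 t : t <= 1 / 3 -> loop t = gam x (clamp (3 * t)).
  move=> t3; rewrite /loop/= (@clamp_le0 (3 * t - 1)); last lra.
  by rewrite (@clamp_ge1 (3 - 3 * t)) ?gy1 ?subrr ?scale0r ?addr0//; lra.
have loop2 t : 1 / 3 <= t <= 2 / 3 -> loop t = seg (3 * t - 1).
  move=> /andP[t1 t2]; rewrite /loop/= (@clamp_ge1 (3 * t)); last lra.
  rewrite (@clamp_ge1 (3 - 3 * t)); last lra.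
  by rewrite gx1 gy1 subrr addr0 clamp_id//= in_itv/=; lra.
have loop3 t : 2 / 3 <= t -> loop t = gam y (clamp (3 - 3 * t)).
  move=> t2; rewrite /loop/= (@clamp_ge1 (3 * t)); last lra.
  rewrite (@clamp_ge1 (3 * t - 1)); last lra.
  by rewrite gx1 scale1r addrA (addrC x) subrK addrC subrK.
have cloop : continuous loop.
  have c3 (a b : R) (g : R -> T) : continuous g -> continuous (fun t : R => g (a * t + b)).
    move=> cg t; apply: (@continuous_comp _ _ _ (fun t : R => a * t + b) g); last exact: cg.
    by apply: cvgD; [apply: cvgMr; exact: cvg_id|exact: cvg_cst].
  move=> t; apply: cvgD.
    have := c3 3 0 _ (clamp_path_continuous cx) t.
    by rewrite /continuous_at addr0; under eq_fun do rewrite addr0.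
  apply: cvgD; last apply: cvgB; last exact: cvg_cst.
    apply: cvgZr_tmp.
    apply: (@continuous_comp _ _ _ (fun t : R => 3 * t - 1) clamp); last exact: clamp_continuous.
    by apply: cvgB; [apply: cvgMr; exact: cvg_id|exact: cvg_cst].
  have := c3 (-3) 3 _ (clamp_path_continuous cy) t.
  have E (u : R) : -3 * u + 3 = 3 - 3 * u by ring.
  by rewrite /continuous_at E; under eq_fun do rewrite E.
have loop0 : loop 0 = x0 by rewrite loop1 ?mulr0 ?clamp_le0//; lra.
have loop_1 : loop 1 = x0 by rewrite loop3 ?clamp_le0//; lra.
have loopO : loop @` I01 `<=` Omega.
  move=> _ [t It <-]; have [t1|t1] := leP t (1 / 3).
    by rewrite loop1//; apply: gxO; exists (clamp (3 * t)) => //; exact: clamp_itv.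
  have [t2|t2] := leP t (2 / 3).
    rewrite loop2; last by rewrite (ltW t1).
    by apply: bO; apply: ball_convex => //; rewrite /= in_itv/=; lra.
  rewrite loop3 ?(ltW t2)//.
  by apply: gyO; exists (clamp (3 - 3 * t)) => //; exact: clamp_itv.
have [N0 hN0] := null_homotopic_increments
  (sc loop (continuous_subspaceT cloop) loopO (etrans loop0 (esym loop_1))).
have [kx hkx] := hF x Ox; have [ky hky] := hF y Oy.
have [N1 hN1] := path_mesh_sample cy gyO.
(* N is a power of two because F is an eventual value along dyadic subdivisions; the loop is sampled
   at 3N steps, so that each of its legs receives exactly N. The thresholds N0 and N1 bear on N
   itself and are reached since k <= 2^k. *)
pose k := (maxn N0 (maxn N1 (maxn kx ky)))%N; pose N := (2 ^ k)%N.
have kN : (k <= N)%N by exact: ltnW (ltn_expl _ _).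
have N0N : (N0 <= N + (N + N))%N.
  by apply: leq_trans (leq_addr _ _); apply: leq_trans kN; exact: leq_maxl.
have N1N : (N1 <= N)%N by apply: leq_trans kN; rewrite /k !leq_max leqnn orbT.
have Ex := hkx k ltac:(by rewrite /k !leq_max leqnn !orbT).
have Ey := hky k ltac:(by rewrite /k !leq_max leqnn !orbT).
have P0 : 0 < N%:R :> R by rewrite ltr0n expn_gt0.
have E0 := hN0 _ N0N.
have S3 (j : nat) : 3 * (j%:R / (N + (N + N))%:R) = j%:R / N%:R :> R.
  by rewrite !natrD; field; rewrite lt0r_neq0//=; apply: lt0r_neq0; lra.
have jN1 (j : nat) : (j <= N)%N -> j%:R / N%:R <= 1 :> R.
  by move=> jN; rewrite ler_pdivrMr// mul1r ler_nat.
have jN0 (j : nat) : 0 <= j%:R / N%:R :> R by rewrite divr_ge0.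
have NN : N%:R / N%:R = 1 :> R by rewrite divff// lt0r_neq0.
move: E0; rewrite !increments_cat.
rewrite (@increments_ext _ (sample (gam x) N)); last first.
  move=> j jN; rewrite /sample loop1.
    by rewrite S3 clamp_id//= in_itv/= jN0 jN1.
  by rewrite -(ler_pM2l (ltr0n R 3)) S3; have := jN1 j jN; lra.
rewrite (@increments_ext (fun j => sample loop _ (N + j)%N) (sample seg N)); last first.
  move=> j jN; rewrite /sample; have J0 := jN0 j; have J1 := jN1 j jN.
  have e : 3 * ((N + j)%:R / (N + (N + N))%:R) = 1 + j%:R / N%:R :> R.
    by rewrite S3 natrD mulrDl NN.
  by rewrite loop2; [congr seg|]; lra.
rewrite [X in _ + (_ + X)](@increments_ext _ (fun j => sample (gam y) N (N - j)%N)); last first.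
  move=> j jN; rewrite /sample/=; have J0 := jN0 j; have J1 := jN1 j jN.
  have e : 3 * ((N + (N + j))%:R / (N + (N + N))%:R) = 1 + (1 + j%:R / N%:R) :> R.
    by rewrite S3 natrD mulrDl NN natrD mulrDl NN.
  rewrite loop3; last lra.
  rewrite natrB// mulrBl NN; congr (gam y _).
  by rewrite clamp_id//= ?in_itv/=; lra.
rewrite increments_rev; last first.
  move=> j jN; apply: additive_onS (hN1 N j N1N jN).
  have K (i : nat) : (i <= 1)%N -> exists2 t, I01 t /\ `|t - j%:R / N%:R| <= N%:R^-1 &
      sample (gam y) N (j + i)%N = gam y t.
    move=> i1; exists ((j + i)%:R / N%:R) => //; split.
      by apply: sample_itv; case: i i1 => [|[|//]] _; rewrite ?addn0 ?addn1// ltnW.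
    rewrite natrD mulrDl addrC addKr ger0_norm ?divr_ge0//.
    by rewrite ler_piMl ?invr_ge0 ?ler0n// lern1.
  move=> z [->|->].
    by have [t Ht e] := K 0%N isT; exists t => //; rewrite -e addn0.
  by have [t Ht e] := K 1%N isT; exists t => //; rewrite -e addn1.
(* With [clamp] every node lies in the ball, also those of index above N, as [increments_additive]
   asks. *)
rewrite (@increments_ext (sample seg N) (fun j => seg (clamp (j%:R / N%:R)))); last first.
  by move=> j jN; rewrite /sample clamp_id//= in_itv/= jN0 jN1.
rewrite (@increments_additive (fun j => seg (clamp (j%:R / N%:R))) N _ hr); last first.
  by move=> j; exact: (ball_convex px py (clamp_itv _)).
rewrite mul0r clamp_le0// NN clamp_ge1// /seg scale0r scale1r addr0 (addrC x) subrK.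
by rewrite Ex Ey; lra.
Qed.

End Monodromy.

(** * Smearing, the adjoint of averaging *)

Lemma integrable_ae_eq (R : realType) d (X : measurableType d)
    (m : {measure set X -> \bar R}) (f g : X -> \bar R) :
  m.-integrable setT f -> measurable_fun setT g -> {ae m, forall x, g x = f x} ->
  m.-integrable setT g.
Proof.
move=> /integrableP[mf foo] mg fg; apply/integrableP; split=> //.
rewrite (_ : (\int[m]_x `|g x|)%E = (\int[m]_x `|f x|)%E)//.
apply: ae_eq_integral => //; [exact: measurableT_comp|exact: measurableT_comp|].
by apply: filterS fg => x -> _.
Qed.

Section RFubini.
Context {R : realType} d1 d2 (X : measurableType d1) (Y : measurableType d2).
Variables (m1 : {sigma_finite_measure set X -> \bar R}).
Variables (m2 : {sigma_finite_measure set Y -> \bar R}).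
Variable f : X * Y -> R.
Hypothesis intf : (m1 \x m2)%E.-integrable setT (EFin \o f).

Let F x := (\int[m2]_y f (x, y))%R.
Let G y := (\int[m1]_x f (x, y))%R.

(** The real-valued integral is [fine] of the extended one and takes a default value on sections
    that are not integrable; the two agree almost everywhere only. *)
Let FE : {ae m1, forall x, (F x)%:E = fubini_F m2 (EFin \o f) x}.
Proof.
apply: filterS (ae_integrable1 intf) => x ix.
rewrite /F /Rintegral fineK//; exact: (integrable_fin_num measurableT ix).
Qed.

Let GE : {ae m2, forall y, (G y)%:E = fubini_G m1 (EFin \o f) y}.
Proof.
apply: filterS (ae_integrable2 intf) => x ix.
rewrite /G /Rintegral fineK//; exact: (integrable_fin_num measurableT ix).
Qed.

Lemma measurable_Rintegral1 : measurable_fun setT F.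
Proof.
by apply: measurableT_comp (measurable_fubini_F intf); exact: fine_measurable.
Qed.

Lemma measurable_Rintegral2 : measurable_fun setT G.
Proof.
by apply: measurableT_comp (measurable_fubini_G intf); exact: fine_measurable.
Qed.

Lemma integrable_Rintegral1 : m1.-integrable setT (EFin \o F).
Proof.
apply: (integrable_ae_eq (integrable_fubini_F intf)); last exact: FE.
by apply/measurable_EFinP; exact: measurable_Rintegral1.
Qed.

Lemma RFubini : (\int[m1]_x F x = \int[m2]_y G y)%R.
Proof.
rewrite /Rintegral; congr fine.
transitivity (\int[m1]_x fubini_F m2 (EFin \o f) x)%E.
  apply: ae_eq_integral => //.
  - by apply/measurable_EFinP; exact: measurable_Rintegral1.
  - exact: (measurable_fubini_F intf).
  - by apply: filterS FE => x h _; exact: h.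
transitivity (\int[m2]_x fubini_G m1 (EFin \o f) x)%E.
  exact: (Fubini intf).
apply: ae_eq_integral => //.
- exact: (measurable_fubini_G intf).
- by apply/measurable_EFinP; exact: measurable_Rintegral2.
- by apply: filterS GE => x h _; exact: esym h.
Qed.

End RFubini.

Section Adjoint.
Context {R : realType} d (Y : measurableType d).
Variable nu : {sigma_finite_measure set Y -> \bar R}.
Local Notation mu2 := (@lebesgue2 R).
Variables (k : Y -> R) (tau : Y -> R * R) (g : R * R -> R).
Hypothesis ik : nu.-integrable setT (EFin \o k).
Hypothesis mtau : measurable_fun setT tau.
Hypothesis ig : mu2.-integrable setT (EFin \o g).

Definition smear (x : R * R) := (\int[nu]_y (k y * g (x - tau y)))%R.

Let mg : measurable_fun setT g.
Proof. by have /integrableP[/measurable_EFinP] := ig. Qed.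

Let mk : measurable_fun setT k.
Proof. by have /integrableP[/measurable_EFinP] := ik. Qed.

Let h (z : (R * R) * Y) : R := k z.2 * g (z.1 - tau z.2).

Let mtranslate (s : R) (p : R * R -> R) : measurable_fun setT p ->
  measurable_fun setT (fun z : (R * R) * Y => p (z.1 + s *: tau z.2)).
Proof.
move=> mp.
have mt : measurable_fun setT (fun z : (R * R) * Y => z.1 + s *: tau z.2 : R * R).
  have m1 : measurable_fun setT (fun z : (R * R) * Y => (z.1).1 + s * (tau z.2).1).
    apply: measurable_funD.
      exact: measurableT_comp measurable_fst measurable_fst.
    apply: measurable_funM => //.
    exact: measurableT_comp measurable_fst (measurableT_comp mtau measurable_snd).
  have m2 : measurable_fun setT (fun z : (R * R) * Y => (z.1).2 + s * (tau z.2).2).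
    apply: measurable_funD.
      exact: measurableT_comp measurable_snd measurable_fst.
    apply: measurable_funM => //.
    exact: measurableT_comp measurable_snd (measurableT_comp mtau measurable_snd).
  exact: (measurable_fun_pair m1 m2).
exact: measurableT_comp mp mt.
Qed.

Let mh : measurable_fun setT h.
Proof.
apply: measurable_funM; first exact: measurableT_comp mk measurable_snd.
have := mtranslate (-1) mg; apply: eq_measurable_fun => z _.
by rewrite scaleN1r.
Qed.

Lemma ge0_integral_shiftN (y : Y) : (\int[mu2]_x `|(g ((x : R * R) - tau y))%:E| = \int[mu2]_x `|(g x)%:E|)%E.
Proof.
apply: (ge0_integral_shift2 (- tau y) (f := fun x => `|(g x)%:E|%E)) => //.
by apply: measurableT_comp => //; apply/measurable_EFinP.
Qed.

Let ih : (mu2 \x nu)%E.-integrable setT (EFin \o h).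
Proof.
apply/integrable21ltyP; first exact/measurable_EFinP.
rewrite (eq_integral (fun y => (`|k y|)%:E * \int[mu2]_x `|(g x)%:E|)%E); last first.
  move=> y _; rewrite -(ge0_integral_shiftN y) -ge0_integralZl//; last first.
    apply: measurableT_comp => //; apply/measurable_EFinP.
    exact: (measurableT_comp mg (measurable_shift2 (- tau y))).
  by apply: eq_integral => x _; rewrite /h/= normrM EFinM.
have /integrableP[_ goo] := ig; have /integrableP[_ koo] := ik.
rewrite ge0_integralZr//; first by apply: lte_mul_pinfty => //; [exact: integral_ge0|rewrite ge0_fin_numE//; exact: integral_ge0].
  by do 2 apply: measurableT_comp => //.
exact: integral_ge0.
Qed.

Lemma integrable_smear : mu2.-integrable setT (EFin \o smear).
Proof. exact: (integrable_Rintegral1 ih). Qed.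

(** After an exchange of the integrals, translation invariance in x moves the shift by - tau y from
    g to a shift by tau y of phi. *)
Lemma smear_adjoint (phi : R * R -> R) (C : R) :
  measurable_fun setT phi -> (forall x, `|phi x| <= C) ->
  dist_of smear phi = dist_of g (average nu k tau phi).
Proof.
move=> mphi phiC.
have mphi1 : measurable_fun setT (fun z : (R * R) * Y => phi z.1).
  exact: measurableT_comp mphi measurable_fst.
have ihphi : (mu2 \x nu)%E.-integrable setT (EFin \o (fun z => h z * phi z.1)).
  by apply: (integrable_bounded_mul ih mphi1 (C := C)) => z.
transitivity (\int[mu2]_x \int[nu]_y (h (x, y) * phi x))%R.
  rewrite /dist_of; congr fine; apply: ae_eq_integral => //.
  - apply/measurable_EFinP; apply: measurable_funM => //.
    exact: (measurable_Rintegral1 ih).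
  - apply/measurable_EFinP; exact: (measurable_Rintegral1 ihphi).
  - apply: filterS (ae_integrable1 ih) => x ihx _; congr EFin.
    by rewrite RintegralZr.
rewrite (RFubini ihphi).
pose h2 (z : (R * R) * Y) : R := g z.1 * (k z.2 * phi (z.1 + tau z.2)).
have mh2 : measurable_fun setT h2.
  apply: measurable_funM; first exact: measurableT_comp mg measurable_fst.
  apply: measurable_funM; first exact: measurableT_comp mk measurable_snd.
  have := mtranslate 1 mphi; apply: eq_measurable_fun => z _.
  by rewrite scale1r.
have S y : (\int[mu2]_x (h (x, y) * phi x) = \int[mu2]_x h2 (x, y))%R.
  rewrite /Rintegral; congr fine.
  pose q (x : R * R) := (g x * (k y * phi (x + tau y)))%:E.
  have mq : measurable_fun setT q.
    apply/measurable_EFinP; apply: measurable_funM => //; apply: measurable_funM => //.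
    exact: (measurableT_comp mphi (measurable_shift2 (tau y))).
  apply: etrans (integral_shift2 (- tau y) mq).
  apply: eq_integral => x _; rewrite /q /h/=; congr EFin.
  rewrite subrK; ring.
have C0 : 0 <= C by apply: le_trans (phiC (0, 0)).
(* The change of variable is made for each fixed y, so joint integrability is established anew after
   it: the product of g and k is integrable on the product space, and phi is bounded. *)
have ih2 : (mu2 \x nu)%E.-integrable setT (EFin \o h2).
  have gk : (mu2 \x nu)%E.-integrable setT (EFin \o (fun z : (R * R) * Y => g z.1 * k z.2)).
    apply/integrable21ltyP.
      apply/measurable_EFinP; apply: measurable_funM.
        exact: measurableT_comp mg measurable_fst.
      exact: measurableT_comp mk measurable_snd.
    rewrite (eq_integral (fun y => (`|k y|)%:E * \int[mu2]_x `|(g x)%:E|)%E); last first.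
      move=> y _; rewrite -ge0_integralZl//; last first.
        by apply: measurableT_comp => //; apply/measurable_EFinP.
      by apply: eq_integral => x _; rewrite /= normrM mulrC EFinM.
    have /integrableP[_ goo] := ig; have /integrableP[_ koo] := ik.
    rewrite ge0_integralZr//; first by apply: lte_mul_pinfty => //; [exact: integral_ge0|rewrite ge0_fin_numE//; exact: integral_ge0].
      by do 2 apply: measurableT_comp => //.
exact: integral_ge0.
  have mp2 : measurable_fun setT (fun z : (R * R) * Y => phi (z.1 + tau z.2)).
    have := mtranslate 1 mphi; apply: eq_measurable_fun => z _.
    by rewrite scale1r.
  have := integrable_bounded_mul gk mp2 (C := C) (fun z => phiC _).
  by apply: eq_integrable => // z _; rewrite /h2/= mulrA.
rewrite (eq_Rintegral _ (fun y _ => S y)) -(RFubini ih2).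
rewrite /dist_of /Rintegral; congr fine; apply: eq_integral => x _; congr EFin.
have mx := measurable_translate mtau x mphi.
rewrite /average -RintegralZl//.
exact: (integrable_bounded_mul ik mx (C := C) (fun z => phiC _)).
Qed.

End Adjoint.

(** * Density of test functions and continuity of translations *)

Section Density.
Context {R : realType}.
Local Notation mu := (@lebesgue_measure R).
Local Notation mu2 := (@lebesgue2 R).
Implicit Types f g h phi : R * R -> R.

Definition L1 f := mu2.-integrable setT (EFin \o f).

Lemma L1_measurable f : L1 f -> measurable_fun setT f.
Proof. by move=> /integrableP[/measurable_EFinP]. Qed.

Lemma L1D f g : L1 f -> L1 g -> L1 (fun x => f x + g x).
Proof.
move=> If Ig; have := integrableD measurableT If Ig.
by apply: eq_integrable => // x _; rewrite /= EFinD.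
Qed.

Lemma L1Z (c : R) f : L1 f -> L1 (fun x => c * f x).
Proof.
move=> If; have := integrableZl measurableT c If.
by apply: eq_integrable => // x _; rewrite /= EFinM.
Qed.

Lemma L1B f g : L1 f -> L1 g -> L1 (fun x => f x - g x).
Proof.
move=> If Ig; have := integrableB measurableT If Ig.
by apply: eq_integrable => // x _; rewrite /= EFinB.
Qed.

Lemma L1_indic (A : set (R * R)) : measurable A -> (mu2 A < +oo)%E -> L1 (\1_A).
Proof.
move=> mA Aoo; apply/integrableP; split.
  by apply/measurable_EFinP; exact: measurable_indic.
have -> : (\int[mu2]_x `|(EFin \o \1_A) x| = \int[mu2]_x (\1_A x)%:E)%E.
  by apply: eq_integral => x _; rewrite /= ger0_norm// indicE.
by rewrite (@integral_indic _ _ _ mu2 setT measurableT A mA) setIT.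
Qed.

Lemma lebesgue2_itv_lt_pinfty (i j : interval R) : (mu [set` i] < +oo)%E ->
  (mu [set` j] < +oo)%E -> (mu2 ([set` i] `*` [set` j]) < +oo)%E.
Proof.
move=> hi hj; rewrite /lebesgue2 product_measure1E; try exact: measurable_itv.
by apply: lte_mul_pinfty => //; rewrite ge0_fin_numE.
Qed.

Definition square (A : R) : set (R * R) := `[- A, A] `*` `[- A, A].

Lemma measurable_square A : measurable (square A).
Proof. by apply: measurableX; exact: measurable_itv. Qed.

Lemma squareP (A : R) x : square A x <-> `|x.1| <= A /\ `|x.2| <= A.
Proof. by rewrite /square /= !in_itv/= -!ler_norml. Qed.

Lemma lebesgue2_square_lt_pinfty (A : R) : (mu2 (square A) < +oo)%E.
Proof.
by apply: lebesgue2_itv_lt_pinfty; rewrite lebesgue_measure_itv/=; case: ifP => _; rewrite ltry.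
Qed.

Lemma L1_square A : L1 (\1_(square A)).
Proof.
by apply: L1_indic; [exact: measurable_square|exact: lebesgue2_square_lt_pinfty].
Qed.

Lemma L1_bounded_support f (A C : R) : measurable_fun setT f -> 
  (forall x, `|f x| <= C) -> vanishes_off A f -> L1 f.
Proof.
move=> mf fC fA.
have := integrable_bounded_mul (L1_square A) mf fC.
apply: eq_integrable => // x _; rewrite /= indicE; congr EFin.
case: (boolP (x \in square A)) => xA; first by rewrite mul1r.
have : ~ (`|x.1| <= A /\ `|x.2| <= A).
  by move=> /squareP/mem_set; apply/negP.
rewrite mul0r => /not_andP nA; rewrite fA//.
by case: nA => /negP; rewrite -ltNge => /ltW; [left|right].
Qed.

Lemma test_L1 phi : test_function phi -> L1 phi.
Proof.
move=> tphi; have [C _ hC] := test_bounded tphi.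
have [_ [A _ hA]] := (test_functionP phi).1 tphi.
by apply: L1_bounded_support hC hA; exact: test_measurable.
Qed.

Definition gap f g := (\int[mu2]_x `|f x - g x|%:E)%E.

Lemma measurable_gap f g : measurable_fun setT f -> measurable_fun setT g ->
  measurable_fun setT (fun x : R * R => `|f x - g x|%:E).
Proof.
move=> mf mg; apply/measurable_EFinP.
by apply: measurableT_comp => //; exact: measurable_funB.
Qed.

Lemma gap_sym f g : gap f g = gap g f.
Proof. by apply: eq_integral => x _; rewrite distrC. Qed.

Lemma gap_triangle g f h : measurable_fun setT f -> measurable_fun setT g ->
  measurable_fun setT h -> (gap f h <= gap f g + gap g h)%E.
Proof.
move=> mf mg mh; rewrite /gap -ge0_integralD//; [|exact: measurable_gap..].
apply: ge0_le_integral => //; [exact: measurable_gap| |].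
- by apply: emeasurable_funD; exact: measurable_gap.
- by move=> x _; rewrite -EFinD lee_fin ler_distD.
Qed.

(** The closure of the test functions in L1. It is enlarged by linear combinations and dominated
    limits, from half-open boxes to measurable sets, until it is all of L1. *)
Definition approximable f := L1 f /\
  forall e : R, 0 < e -> exists2 phi, test_function phi & (gap f phi <= e%:E)%E.

Lemma approximable_test phi : test_function phi -> approximable phi.
Proof.
move=> tphi; split; first exact: test_L1.
move=> e e0; exists phi => //; rewrite /gap integral0_eq ?lee_fin ?ltW// => x _.
by rewrite subrr normr0.
Qed.

Lemma test_functionD f g : test_function f -> test_function g ->
  test_function (fun x => f x + g x).
Proof.
move=> /test_functionP[Cf [A A0 fA]] /test_functionP[Cg [B B0 gB]].
apply/test_functionP; split; first by move=> n; exact: CnD.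
exists (Num.max A B); first by rewrite lt_max A0.
move=> x; rewrite !ge_max => h.
have [hA hB] : (A <= `|x.1| \/ A <= `|x.2|) /\ (B <= `|x.1| \/ B <= `|x.2|).
  by case: h => /andP[? ?]; split; [left|left|right|right].
by rewrite fA// gB// addr0.
Qed.

Lemma test_functionZ (c : R) f : test_function f -> test_function (fun x => c * f x).
Proof. by apply: testMl => n; exact: Cn_cst. Qed.

Lemma approximableD f g : approximable f -> approximable g ->
  approximable (fun x => f x + g x).
Proof.
move=> [If hf] [Ig hg]; split; first exact: L1D.
move=> e e0; have e2 : 0 < e / 2 by rewrite divr_gt0.
have [p tp fp] := hf _ e2; have [q tq gq] := hg _ e2.
exists (fun x => p x + q x); first exact: test_functionD.
have [mf mg] := (L1_measurable If, L1_measurable Ig).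
have [mp mq] := (test_measurable tp, test_measurable tq).
rewrite [e]splitr EFinD; apply: le_trans (leeD fp gq).
rewrite /gap -ge0_integralD//; [|exact: measurable_gap..].
apply: ge0_le_integral => //.
- by apply: measurable_gap; exact: measurable_funD.
- by apply: emeasurable_funD; exact: measurable_gap.
- move=> x _; rewrite -EFinD lee_fin.
  by rewrite (_ : _ - _ = (f x - p x) + (g x - q x)) ?ler_normD//; ring.
Qed.

Lemma approximableZ (c : R) f : approximable f -> approximable (fun x => c * f x).
Proof.
move=> [If hf]; split; first exact: L1Z.
move=> e e0; have K0 : 0 < `|c| + 1 by rewrite ltr_wpDl.
have [p tp fp] := hf _ (divr_gt0 e0 K0).
exists (fun x => c * p x); first exact: test_functionZ.
have [mf mp] := (L1_measurable If, test_measurable tp).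
have -> : gap (fun x => c * f x) (fun x => c * p x) =
    (\int[mu2]_x (`|c|%:E * `|f x - p x|%:E))%E.
  by apply: eq_integral => x _; rewrite -mulrBr normrM EFinM.
rewrite ge0_integralZl//; last exact: measurable_gap.
apply: (@le_trans _ _ (`|c|%:E * (e / (`|c| + 1))%:E)%E); first by rewrite lee_wpmul2l ?lee_fin.
rewrite -EFinM lee_fin mulrCA ler_piMr ?(ltW e0)// ler_pdivrMr// mul1r lerDl//.
Qed.

Lemma approximable_lim f : L1 f ->
  (forall e : R, 0 < e -> exists2 g, approximable g & (gap f g <= e%:E)%E) ->
  approximable f.
Proof.
move=> If H; split=> // e e0; have e2 : 0 < e / 2 by rewrite divr_gt0.
have [g [Ig hg] fg] := H _ e2; have [p tp gp] := hg _ e2.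
exists p => //; rewrite [e]splitr EFinD; apply: le_trans (leeD fg gp).
by apply: gap_triangle; [exact: L1_measurable|exact: L1_measurable|exact: test_measurable].
Qed.

Lemma approximable_dominated (f_ : nat -> R * R -> R) f (G : R * R -> R) :
  (forall n, approximable (f_ n)) -> L1 G -> (forall n x, `|f_ n x| <= G x) ->
  (forall x, f_ n x @[n --> \oo] --> f x) -> approximable f.
Proof.
move=> af IG fG ff.
have cE x : [set: R * R] x -> (f_ n x)%:E @[n --> \oo] --> (f x)%:E.
  by move=> _; apply: cvg_EFin; [exact: nearW|exact: ff].
have mf_ n : measurable_fun setT (fun x => (f_ n x)%:E).
  by have [/integrableP[]] := af n.
have mf : measurable_fun setT (fun x => (f x)%:E).
  apply/measurable_EFinP; apply: (measurable_fun_cvg (h := f_)).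
    by move=> n; apply: L1_measurable; have [] := af n.
  by move=> x _; exact: ff.
pose T := (measurableTypeR R * measurableTypeR R)%type.
have cE' : {ae mu2, forall x : T, [set: T] x -> (f_ n x)%:E @[n --> \oo] --> (f x)%:E}.
  by apply: aeW => x _; exact: cE.
have fG' : {ae mu2, forall (x : T) n, [set: T] x -> (`|(f_ n x)%:E| <= (EFin \o G) x)%E}.
  by apply: aeW => x n _; rewrite lee_fin.
have [If lim0 _] := @dominated_convergence _ T R mu2 setT measurableT
  (fun n x => (f_ n x)%:E) (fun x => (f x)%:E) (EFin \o G) mf_ mf cE' IG fG'.
apply: approximable_lim => // e e0.
have /fine_cvgP[fin /cvgrPdist_le/(_ _ e0) small] := lim0.
have [n [hn1 hn2]] : exists n, (\int[mu2]_x `|(f_ n x)%:E - (f x)%:E| \is a fin_num)%E /\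
    `|0 - fine (\int[mu2]_x `|(f_ n x)%:E - (f x)%:E|)%E| <= e.
  have [n _ hn] : \forall n \near \oo, (\int[mu2]_x `|(f_ n x)%:E - (f x)%:E| \is a fin_num)%E /\
    `|0 - fine (\int[mu2]_x `|(f_ n x)%:E - (f x)%:E|)%E| <= e.
    by near=> n; split; near: n.
  by exists n; apply: hn => /=.
exists (f_ n) => //; rewrite gap_sym.
have e1 : gap (f_ n) f = (\int[mu2]_x `|(f_ n x)%:E - (f x)%:E|)%E by [].
rewrite e1 -(fineK hn1) lee_fin; move: hn2; rewrite sub0r normrN.
by rewrite ger0_norm// fine_ge0// integral_ge0.
Unshelve. all: end_near. Qed.


Lemma approximable_oc_box (l r l' r' : R) :
  approximable (\1_(`]l, r] `*` `]l', r'] : set (R * R))).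
Proof.
(* The final summand 1 covers the leak of the cut-offs up to r + 1 and r' + 1. *)
pose A := `|l| + `|r| + `|l'| + `|r'| + 1.
have [l0 r0 l0' r0'] : [/\ 0 <= `|l|, 0 <= `|r|, 0 <= `|l'| & 0 <= `|r'|] by [].
have A0 : 0 < A by rewrite /A; lra.
have [/ler_normlP[? ?] /ler_normlP[? ?]] := (lexx `|l|, lexx `|r|).
have [/ler_normlP[? ?] /ler_normlP[? ?]] := (lexx `|l'|, lexx `|r'|).
have S1 n s : A <= `|s| -> oc_cutoff l r n s = 0.
  by rewrite /A => h; apply: oc_cutoff0; apply/negP => /andP[? ?]; move: h; rewrite ler_normr; lra.
have S2 n s : A <= `|s| -> oc_cutoff l' r' n s = 0.
  by rewrite /A => h; apply: oc_cutoff0; apply/negP => /andP[? ?]; move: h; rewrite ler_normr; lra.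
apply: (@approximable_dominated (fun n => tensor (oc_cutoff l r n) (oc_cutoff l' r' n))
  _ (\1_(square A))) => //.
- move=> n; apply: approximable_test; apply: test_tensor A0 _ _ (S1 n) (S2 n);
    exact: smooth1_oc_cutoff.
- exact: L1_square.
- move=> n x; rewrite indicE /tensor.
  have h1 := oc_cutoff_01 l r n x.1; have h2 := oc_cutoff_01 l' r' n x.2.
  have /andP[k1 k2] := mulr_01 h1 h2.
  rewrite ger0_norm//; case: (boolP (x \in square A)) => [_ //|].
  rewrite notin_setE => xA; have : ~ (`|x.1| <= A /\ `|x.2| <= A) by move=> /squareP.
  move=> /not_andP[] /negP; rewrite -ltNge => /ltW h; first by rewrite S1// mul0r.
  by rewrite S2// mulr0.
- move=> x; have -> : (\1_(`]l, r] `*` `]l', r']) x : R) =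
      (x.1 \in `]l, r])%:R * (x.2 \in `]l', r'])%:R.
    rewrite -natrM mulnb indicE; congr ((nat_of_bool _)%:R).
    by apply/idP/andP => [/set_mem[]|[? ?]]; [|rewrite inE].
  by apply: cvgM; exact: cvg_oc_cutoff.
Qed.

Let X n : set (R * R) := `](- n%:R), n%:R] `*` `](- n%:R), n%:R].

(** Intersecting with the boxes X n keeps measures finite: the plane itself then belongs to the
    class, and increasing unions are dominated by the integrable indicator of X n. *)
Lemma approximable_box_inter (A : set (R * R)) : measurable A ->
  forall n, approximable (\1_(A `&` X n)).
Proof.
pose H := [set A : set (R * R) | measurable A /\ forall n, approximable (\1_(A `&` X n))].
suff : forall A : set (measurableTypeR R * measurableTypeR R), measurable A -> H A.
  by move=> + mA => /(_ A mA)[].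
have box : @oc_boxes R `<=` H.
  move=> _ [_ [[l r] _ <-] [_ [[l' r'] _ <-] <-]].
  split; first by apply: measurableX; exact: measurable_itv.
  move=> n; rewrite -setXI.
  have [[a b] _ e1] := ocitvI (is_ocitv l r) (is_ocitv (- n%:R) n%:R).
  have [[c d] _ e2] := ocitvI (is_ocitv l' r') (is_ocitv (- n%:R) n%:R).
  by rewrite -e1 -e2; exact: approximable_oc_box.
have mX n : measurable (X n) by apply: measurableX; exact: measurable_itv.
suff lH : lambda_system setT H.
  rewrite oc_boxes_generate => A' GA.
  exact: (lambda_system_subset (@oc_boxes_setI_closed R) lH box (fun _ _ => @subsetT _ _) GA).
split.
- by [].
- split; first exact: measurableT.
  by move=> n; rewrite setTI; exact: approximable_oc_box.
- move=> A' B BA [mA hA] [mB hB]; split; first exact: measurableD.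
  move=> n; have := approximableD (hA n) (approximableZ (-1) (hB n)).
  congr approximable; apply/funext => x; rewrite !indicE setDE !in_setI in_setC.
  have [xB|xB] := boolP (x \in B).
    have -> : x \in A' by apply/mem_set; apply: BA; exact: set_mem xB.
    by rewrite andbF/= mulN1r subrr.
  by rewrite /= andbT mulr0 addr0.
- move=> F ndF HF; split; first by apply: bigcupT_measurable => k; have [] := HF k.
  move=> n; apply: (@approximable_dominated (fun k => \1_(F k `&` X n)) _ (\1_(X n))).
  + by move=> k; have [_] := HF k.
  + by have [] := approximable_oc_box (- n%:R) n%:R (- n%:R) n%:R.
  + move=> k x; rewrite !indicE in_setI ger0_norm//.
    by case: (x \in X n); rewrite ?andbF// andbT lern1 leq_b1.
  + move=> x; apply: cvg_near_cst.
    have [[k _ Fkx]|nF] := pselect ((\bigcup_i F i) x).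
      exists k => // j /= kj; rewrite !indicE !in_setI.
      have -> : x \in F j by apply/mem_set; have /subsetPset := ndF _ _ kj; exact.
      by have -> : x \in \bigcup_i F i by apply/mem_set; exists k.
    exists 0%N => // j _; rewrite !indicE !in_setI.
    have /negbTE -> : x \notin F j.
      by apply/negP => /set_mem Fj; apply: nF; exists j.
    by have /negbTE -> : x \notin \bigcup_i F i by apply/negP => /set_mem.
Qed.

Lemma approximable_indic (A : set (R * R)) : measurable A -> L1 (\1_A) ->
  approximable (\1_A).
Proof.
move=> mA IA; apply: (@approximable_dominated (fun k => \1_(A `&` X k)) _ (\1_A)) => //.
- by move=> n; exact: approximable_box_inter.
- move=> n x; rewrite !indicE in_setI ger0_norm//.
  by case: (x \in A) => //=; rewrite lern1 leq_b1.
- move=> x; apply: cvg_near_cst.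
  pose k := (Num.bound `|x.1| + Num.bound `|x.2|)%N.
  have k1 : `|x.1| < k%:R.
    by apply: lt_le_trans (archi_boundP (normr_ge0 _)) _; rewrite ler_nat leq_addr.
  have k2 : `|x.2| < k%:R.
    by apply: lt_le_trans (archi_boundP (normr_ge0 _)) _; rewrite ler_nat leq_addl.
  exists k => // j /= kj; rewrite !indicE in_setI.
  have kjR : k%:R <= j%:R :> R by rewrite ler_nat.
  have -> : x \in X j.
    apply/mem_set; split; rewrite /= in_itv/=.
      by move: k1; rewrite ltr_norml; lra.
    by move: k2; rewrite ltr_norml; lra.
  by rewrite andbT.
Qed.

Import HBSimple.

Lemma approximable_L1 g : L1 g -> approximable g.
Proof.
move=> Ig; apply: approximable_lim => // e e0.
have [g_ [Ig_ _ lim0]] := approximation_sfun_integrable measurableT Ig.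
have ag_ n : approximable (g_ n).
  have E : (g_ n : R * R -> R) =
      (fun x => \sum_(y <- finmap.enum_fset (fset_set (range (g_ n)))) y * \1_(g_ n @^-1` [set y]) x).
    by apply/funext => x; rewrite fimfunE fsbig_finite.
  rewrite E; move: (finmap.enum_fset _) => r; elim: r => [|y s IH].
    have := approximableZ 0 (@approximable_oc_box 0 0 0 0).
    by congr approximable; apply/funext => x; rewrite big_nil mul0r.
  rewrite (_ : (fun x => _) = (fun x => y * \1_(g_ n @^-1` [set y]) x +
      \sum_(y <- s) y * \1_(g_ n @^-1` [set y]) x)); last first.
    by apply/funext => x; rewrite big_cons.
  apply: approximableD => //.
  (* The level set of the value 0 may have infinite measure, so its indicator is not known to be
     integrable; the corresponding term is 0 anyway. *)
  have [->|y0] := eqVneq y 0.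
    have := approximableZ 0 (@approximable_oc_box 0 0 0 0).
    by congr approximable; apply/funext => x; rewrite !mul0r.
  have mA : measurable (g_ n @^-1` [set y]) by exact: measurable_funPTI.
  apply: approximableZ; apply: approximable_indic => //.
  have := L1Z (y^-1) (Ig_ n).
  apply: le_integrable => //.
    by apply/measurable_EFinP; exact: measurable_indic.
  move=> x _; rewrite lee_fin indicE.
  case: (boolP (x \in _)) => [/set_mem /= ->|_]; last by rewrite normr0.
  by rewrite mulVf.
have [n hn] : exists n, (gap g (g_ n) <= e%:E)%E.
  have /fine_cvgP[fin /cvgrPdist_le/(_ _ e0) small] := lim0.
  have [n _ hn] : \forall n \near \oo, (\int[mu2]_x `|(g x)%:E - (g_ n x)%:E| \is a fin_num)%E /\
    `|0 - fine (\int[mu2]_x `|(g x)%:E - (g_ n x)%:E|)%E| <= e.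
    by near=> n; split; near: n.
  exists n; have [h1 h2] := hn n (leqnn n).
  have e1 : gap g (g_ n) = (\int[mu2]_x `|(g x)%:E - (g_ n x)%:E|)%E by [].
  rewrite e1 -(fineK h1) lee_fin; move: h2; rewrite sub0r normrN.
  by rewrite ger0_norm// fine_ge0// integral_ge0.
by exists (g_ n).
Unshelve. all: end_near. Qed.

Lemma gap_shift f g (h : R * R) : measurable_fun setT f -> measurable_fun setT g ->
  gap (fun x => f (x + h)) (fun x => g (x + h)) = gap f g.
Proof. by move=> mf mg; exact: (ge0_integral_shift2 h (measurable_gap mf mg)). Qed.

Lemma translation_continuous g : L1 g -> forall e : R, 0 < e ->
  exists2 dl : R, 0 < dl & forall h : R * R, `|h.1| < dl -> `|h.2| < dl ->
    (gap (fun x => g (x + h)%R) g <= e%:E)%E.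
Proof.
move=> Ig e e0; have e3 : 0 < e / 3 by rewrite divr_gt0.
have [_ /(_ _ e3)[p tp gp]] := approximable_L1 Ig.
have [C C0 pC] := test_lipschitz tp.
have [_ [A A0 pA]] := (test_functionP p).1 tp.
set m := fine (mu2 (square (A + 1))).
have m0 : 0 <= m by exact: fine_ge0.
have K0 : 0 < 6 * (C * m + 1) by rewrite mulr_gt0// ltr_wpDl// mulr_ge0.
(* The bound 1 confines the translated support to the square of half-side A + 1, whose measure is m.
   The 6 is 3 pieces of the estimate times 2 coordinates. *)
exists (Num.min 1 (e / (6 * (C * m + 1)))); first by rewrite lt_min ltr01 divr_gt0.
move=> h; rewrite !lt_min => /andP[h1 h1'] /andP[h2 h2'].
have [mg mp] := (L1_measurable Ig, test_measurable tp).
have ms q : measurable_fun setT q -> measurable_fun setT (fun x : R * R => q (x + h) : R).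
  by move=> mq; exact: (measurableT_comp mq (measurable_shift2 h)).
have G1 : (gap (fun x => g (x + h)%R) (fun x => p (x + h)%R) <= (e / 3)%:E)%E.
  by rewrite gap_shift.
have G2 : (gap (fun x => p (x + h)%R) p <= (e / 3)%:E)%E.
  pose c := C * (`|h.1| + `|h.2|).
  have c0 : 0 <= c by rewrite mulr_ge0// addr_ge0.
  apply: (@le_trans _ _ (\int[mu2]_x (c%:E * (\1_(square (A + 1)) x)%:E))%E).
    apply: ge0_le_integral => //.
    - by apply: measurable_gap => //; exact: ms.
    - apply/measurable_EFinP; apply: measurable_funM => //; apply: measurable_indic.
      exact: measurable_square.
    - move=> x _; rewrite -EFinM lee_fin indicE.
      case: (boolP (x \in square (A + 1))) => [_|].
        rewrite mulr1; apply: le_trans (pC _ _) _.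
        by rewrite /c /= !(addrC _ h.1) !(addrC _ h.2) !addrK.
      rewrite notin_setE => xA; have : ~ (`|x.1| <= A + 1 /\ `|x.2| <= A + 1) by move=> /squareP.
      rewrite mulr0 normr_le0 subr_eq0 => /not_andP[] /negP; rewrite -ltNge => hx.
      + have k1 : A <= `|x.1 + h.1| by have := lerB_normD x.1 h.1; lra.
        have k2 : A <= `|x.1| by lra.
        by rewrite (pA x) ?(pA (x + h))//; left.
      + have k1 : A <= `|x.2 + h.2| by have := lerB_normD x.2 h.2; lra.
        have k2 : A <= `|x.2| by lra.
        by rewrite (pA x) ?(pA (x + h))//; right.
  rewrite ge0_integralZl//; last first.
    by apply/measurable_EFinP; apply: measurable_indic; exact: measurable_square.
  rewrite (@integral_indic _ _ _ mu2 setT measurableT _ (measurable_square (A + 1))) setIT.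
  have fm : mu2 (square (A + 1)) = m%:E.
    rewrite /m fineK// ge0_fin_numE//; exact: lebesgue2_square_lt_pinfty.
  rewrite [X in (_ * X <= _)%E]fm.
  rewrite -EFinM lee_fin /c.
  have hh : `|h.1| + `|h.2| <= e / (3 * (C * m + 1)).
    have -> : e / (3 * (C * m + 1)) = e / (6 * (C * m + 1)) + e / (6 * (C * m + 1)).
      by field; rewrite gt_eqF// ltr_wpDl// mulr_ge0.
    by rewrite lerD// ltW.
  rewrite mulrAC; apply: (@le_trans _ _ (C * m * (e / (3 * (C * m + 1))))).
    by rewrite ler_wpM2l// mulr_ge0.
  rewrite (_ : C * m * _ = (C * m) / (C * m + 1) * (e / 3)); last first.
    by field; rewrite gt_eqF// ltr_wpDl// mulr_ge0.
  by rewrite ler_piMl ?(ltW e3)// ler_pdivrMr ?ltr_wpDl ?mulr_ge0// mul1r lerDl.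
have -> : e%:E = ((e / 3)%:E + ((e / 3)%:E + (e / 3)%:E))%E.
  by rewrite -!EFinD; congr EFin; field.
apply: le_trans (@gap_triangle (fun x => p (x + h)) _ _ _ _ _) _ => //; try exact: ms.
apply: leeD => //; apply: le_trans (@gap_triangle p _ _ _ _ _) _ => //; try exact: ms.
by apply: leeD => //; rewrite gap_sym.
Qed.

End Density.

(** * Mollification *)

Section Mollify.
Context {R : realType}.
Local Notation mu := (@lebesgue_measure R).
Local Notation mu2 := (@lebesgue2 R).
Implicit Types (f g phi : R * R -> R) (i : 'I_2) (x y : R * R).

Lemma is_derive_reflect phi i x y : test_function phi ->
  derivable (fun z => phi (x - z)) y (basis_vec i) /\
  partial i (fun z => phi (x - z)) y = -1 * partial i phi (x - y).
Proof.
move=> tphi; apply: is_derive_slice.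
set c := coordinate i y; set c' := coordinate i (x - y).
have E : (fun z => phi (x - z)) \o slice i y =
    (phi \o slice i (x - y)) \o (fun s => -1 * s + (c + c')).
  apply/funext => s; rewrite /= /slice /c /c' /coordinate; congr phi.
  by case: (i == 0); case: (x) => a1 a2; case: (y) => b1 b2;
    rewrite [LHS]surjective_pairing; apply: congr2 => //=; ring.
rewrite E.
have D1 : is_derive c 1 (fun s : R => -1 * s + (c + c')) (-1).
  rewrite (_ : (fun s => _) = (-1) *: (id : R -> R) + cst (c + c'))//.
  by apply: is_derive_eq; rewrite /GRing.scale/= mulr1 addr0.
have e : -1 * c + (c + c') = c' by ring.
have D2 : is_derive (-1 * c + (c + c')) 1 (phi \o slice i (x - y)) (partial i phi (x - y)).
  rewrite e partial_slice; apply: derivableP; apply/derivable_slice.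
  exact: test_derivable.
have := @is_derive1_comp R (phi \o slice i (x - y)) (fun s : R => -1 * s + (c + c')) c _ _ D2 D1.
by rewrite mulrC.
Qed.

Lemma Cn_reflect n phi x : test_function phi -> Cn n (fun z => phi (x - z)).
Proof.
have C (p : R * R -> R) : test_function p -> continuous (fun z : R * R => p (x - z)).
  move=> tp z; apply: (@continuous_comp _ _ _ (fun z : R * R => x - z) p); last exact: test_continuous.
  by apply: cvgB; [exact: cvg_cst|exact: cvg_id].
elim: n phi => [|n IH] phi tphi; first exact: C.
split=> [|i]; first exact: C.
split=> [z|]; first by have [] := is_derive_reflect i x z tphi.
rewrite (_ : partial _ _ = fun z => cst (-1) z * partial i phi (x - z)).
  by apply: CnM; [exact: Cn_cst|apply: IH; exact: test_partial].
by apply/funext => z; have [_ ->] := is_derive_reflect i x z tphi.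
Qed.

Lemma test_reflect phi x : test_function phi -> test_function (fun z => phi (x - z)).
Proof.
move=> tphi; apply/test_functionP; split; first by move=> n; exact: Cn_reflect.
have [_ [A A0 phiA]] := (test_functionP phi).1 tphi.
exists (A + `|x.1| + `|x.2|); first by rewrite ltr_wpDr// ltr_wpDr.
have := normr_ge0 x.1; have := normr_ge0 x.2 => n2 n1.
move=> z [h|h]; apply: phiA; [left|right].
- have := lerB_dist z.1 x.1; rewrite distrC => k.
  by change (A <= `|x.1 - z.1|); lra.
- have := lerB_dist z.2 x.2; rewrite distrC => k.
  by change (A <= `|x.2 - z.2|); lra.
Qed.

Lemma Rintegral_tensor (p q : R -> R) (A : R) : smooth1 p -> smooth1 q -> 0 < A ->
  (forall s, A <= `|s| -> p s = 0) -> (forall s, A <= `|s| -> q s = 0) ->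
  (\int[mu2]_z tensor p q z = (\int[mu]_s p s) * (\int[mu]_s q s))%R.
Proof.
move=> sp sq A0 pA qA.
have tT := test_tensor A0 sp sq pA qA.
have IT : (mu \x mu)%E.-integrable setT (EFin \o tensor p q) := test_L1 tT.
have Iq : mu.-integrable setT (EFin \o q).
  have Iqc : mu.-integrable `[- A, A] (EFin \o q).
    apply: continuous_compact_integrable; first exact: segment_compact.
    by apply: continuous_subspaceT; exact: smooth1_continuous.
  have := (@integrable_mkcond _ _ _ mu _ (EFin \o q) (measurable_itv _)).1 Iqc.
  apply: eq_integrable => // s _; rewrite patchE; case: ifPn => //= sA.
  rewrite qA//; move: sA; rewrite notin_setE /= in_itv/= -ler_norml => /negP.
  by rewrite -ltNge => /ltW.
transitivity (\int[mu]_s \int[mu]_t tensor p q (s, t))%R.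
  rewrite {1}/Rintegral -(integral12_prod_meas1 IT) /Rintegral; congr fine.
  apply: ae_eq_integral => //.
  - exact: (measurable_fubini_F IT).
  - by apply/measurable_EFinP; exact: (measurable_Rintegral1 IT).
  - apply: filterS (ae_integrable1 IT) => s Is _.
    by rewrite /Rintegral fineK//; exact: (integrable_fin_num measurableT Is).
rewrite -RintegralZr//; last first.
  have Ipc : mu.-integrable `[- A, A] (EFin \o p).
    apply: continuous_compact_integrable; first exact: segment_compact.
    by apply: continuous_subspaceT; exact: smooth1_continuous.
  have := (@integrable_mkcond _ _ _ mu _ (EFin \o p) (measurable_itv _)).1 Ipc.
  apply: eq_integrable => // s _; rewrite patchE; case: ifPn => //= sA.
  rewrite pA//; move: sA; rewrite notin_setE /= in_itv/= -ler_norml => /negP.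
  by rewrite -ltNge => /ltW.
by apply: eq_Rintegral => s _; rewrite /tensor/= RintegralZl.
Qed.

Lemma mollifier1 (dl : R) : 0 < dl -> exists b : R -> R, [/\ smooth1 b,
  forall s, 0 <= b s, forall s, dl <= `|s| -> b s = 0 & (\int[mu]_s b s)%R = 1].
Proof.
move=> dl0.
(* The affine change of variable carries (-dl, dl) onto (0, 1), where the bump is positive. *)
pose B s : R := smooth_bump ((2 * dl)^-1 * s + 2^-1).
have sB : smooth1 B by exact: smooth1_affine smooth1_bump.
have B0 s : dl <= `|s| -> B s = 0.
  move=> h; apply: bump0; apply/negP => /andP[h1 h2].
  set v := (2 * dl)^-1 * s in h1 h2.
  have e : s = 2 * dl * v by rewrite /v; field; rewrite gt_eqF.
  have v2 : `|v| < 2^-1 by rewrite ltr_norml; lra.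
  have : 2 * dl * `|v| < 2 * dl * 2^-1 by rewrite ltr_pM2l// mulr_gt0.
  by move: h; rewrite e normrM gtr0_norm ?mulr_gt0//; lra.
have Bneg s : s <= - dl -> B s = 0.
  by move=> h; apply: B0; rewrite ler_normr; apply/orP; right; lra.
have [P dP P0] := antiderivative (smooth1_continuous sB) Bneg.
have dl2 : - dl < dl by lra.
have IB : (\int[mu]_s B s)%R = P dl - P (- dl).
  have e : (\int[mu]_(s in `[(- dl)%R, dl]) (B s)%:E = (P dl)%:E - (P (- dl)%R)%:E)%E.
    apply: continuous_FTC2 => //.
    - by apply: continuous_subspaceT; exact: smooth1_continuous.
    - have cP : continuous P.
        by apply: derivable_continuous1 => s; exact: (@ex_derive _ _ _ _ _ _ _ (dP s)).
      split.
      + by move=> s _; exact: (@ex_derive _ _ _ _ _ _ _ (dP s)).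
      + exact: cvg_at_right_filter (cP _).
      + exact: cvg_at_left_filter (cP _).
    - by move=> s _; rewrite derive1E (@derive_val _ _ _ _ _ _ _ (dP s)).
  have -> : (\int[mu]_s B s)%R = (\int[mu]_(s in `[(- dl)%R, dl]) B s)%R.
    rewrite [RHS]Rintegral_mkcond; apply: eq_Rintegral => s _.
    rewrite patchE; case: ifPn => // sA; rewrite B0//.
    move: sA; rewrite notin_setE /= in_itv/= -ler_norml => /negP.
    by rewrite -ltNge => /ltW.
  by rewrite /Rintegral e.
(* The mean value theorem gives a positive total mass, by which B is divided. *)
have [c /andP[c1 c2] ec] := derive_eq_increment dP dl2.
have Bc : 0 < B c.
  apply: bump_gt0; apply/andP; split.
    have : (2 * dl)^-1 * - dl < (2 * dl)^-1 * c by rewrite ltr_pM2l// invr_gt0 mulr_gt0.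
    have -> : (2 * dl)^-1 * - dl = - 2^-1 by field; rewrite gt_eqF.
    lra.
  have : (2 * dl)^-1 * c < (2 * dl)^-1 * dl by rewrite ltr_pM2l// invr_gt0 mulr_gt0.
  have -> : (2 * dl)^-1 * dl = 2^-1 by field; rewrite gt_eqF.
  lra.
have Ppos : 0 < P dl - P (- dl) by rewrite ec mulr_gt0//; lra.
exists (fun s => cst (P dl - P (- dl))^-1 s * B s); split.
- by apply: smooth1M => //; exact: smooth1_cst.
- by move=> s; rewrite mulr_ge0 ?invr_ge0 ?(ltW Ppos)//; exact: bump_ge0.
- by move=> s h; rewrite B0// mulr0.
- rewrite RintegralZl//; first by rewrite IB mulVf// gt_eqF.
  have Ic : mu.-integrable `[- dl, dl] (EFin \o B).
    apply: continuous_compact_integrable; first exact: segment_compact.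
    by apply: continuous_subspaceT; exact: smooth1_continuous.
  have := (@integrable_mkcond _ _ _ mu _ (EFin \o B) (measurable_itv _)).1 Ic.
  apply: eq_integrable => // s _; rewrite patchE; case: ifPn => //= sA.
  rewrite B0//; move: sA; rewrite notin_setE /= in_itv/= -ler_norml => /negP.
  by rewrite -ltNge => /ltW.
Qed.

Lemma mollifier (dl : R) : 0 < dl -> exists rho, [/\ test_function rho,
  forall x, 0 <= rho x, vanishes_off dl rho & (\int[mu2]_x rho x)%R = 1].
Proof.
move=> dl0; have [b [sb b0 bd b1]] := mollifier1 dl0.
exists (tensor b b); split.
- exact: (test_tensor dl0 sb sb bd bd).
- by move=> x; rewrite mulr_ge0.
- by move=> x [h|h]; rewrite /tensor; [rewrite (bd x.1)// mul0r|rewrite (bd x.2)// mulr0].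
- by rewrite (Rintegral_tensor sb sb dl0 bd bd) b1 mulr1.
Qed.

(* Reduces L2 convergence of the mollified [g] to L1 continuity of the translations
   of [g * `|g|]. *)
Lemma sqrB_le_normM (p q : R) : (p - q) ^+ 2 <= 2 * `|p * `|p| - q * `|q| |.
Proof.
wlog qp : p q / q <= p.
  move=> H; have [|/ltW] := leP q p; first exact: H.
  by move=> /H; rewrite -opprB sqrrN distrC.
apply: (@le_trans _ _ (2 * (p * `|p| - q * `|q|))); last by rewrite ler_wpM2l// ler_norm.
have [p0|p0] := leP 0 p; have [q0|q0] := leP 0 q;
  rewrite ?(ger0_norm p0) ?(ger0_norm q0) ?(ltr0_norm p0) ?(ltr0_norm q0).
- have -> : 2 * (p * p - q * q) = (p - q) ^+ 2 + (p - q) * (p + 3 * q) by ring.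
  by rewrite lerDl mulr_ge0//; lra.
- have -> : 2 * (p * p - q * - q) = (p - q) ^+ 2 + (p + q) ^+ 2 by ring.
  by rewrite lerDl sqr_ge0.
- lra.
- have -> : 2 * (p * - p - q * - q) = (p - q) ^+ 2 + (p - q) * (- q - 3 * p) by ring.
  by rewrite lerDl mulr_ge0//; lra.
Qed.

Section Estimates.
Variables (rho : R * R -> R) (dl : R).
Hypothesis trho : test_function rho.
Hypothesis rho0 : forall x, 0 <= rho x.
Hypothesis rhod : vanishes_off dl rho.
Hypothesis rho1 : (\int[mu2]_x rho x)%R = 1.

Let Irho : mu2.-integrable setT (EFin \o rho) := test_L1 trho.

Let rho1E : (\int[mu2]_x (rho x)%:E = 1)%E.
Proof.
by rewrite -[LHS]fineK; [rewrite -/(Rintegral _ _ _) rho1|exact: (integrable_fin_num measurableT Irho)].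
Qed.

Lemma measurable_increment g : measurable_fun setT g ->
  measurable_fun setT (fun z : (R * R) * (R * R) => g (z.1 + z.2) - g z.1).
Proof.
move=> mg; apply: measurable_funB; last exact: measurableT_comp mg measurable_fst.
have m1 : measurable_fun setT (fun z : (R * R) * (R * R) => z.1.1 + z.2.1).
  apply: measurable_funD.
    exact: measurableT_comp measurable_fst measurable_fst.
  exact: measurableT_comp measurable_fst measurable_snd.
have m2 : measurable_fun setT (fun z : (R * R) * (R * R) => z.1.2 + z.2.2).
  apply: measurable_funD.
    exact: measurableT_comp measurable_snd measurable_fst.
  exact: measurableT_comp measurable_snd measurable_snd.
exact: measurableT_comp mg (measurable_fun_pair m1 m2).
Qed.

(** By Tonelli this is an average, with respect to the probability density rho, of the distances
    between g and its translates, and only translations shorter than dl carry weight. *)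
Lemma averaged_gap g (e : R) : 0 <= e -> L1 g ->
  (forall h : R * R, `|h.1| < dl -> `|h.2| < dl -> (gap (fun x => g (x + h)%R) g <= e%:E)%E) ->
  (\int[mu2]_x \int[mu2]_y (rho y * `|g ((x : R * R) + y)%R - g x|)%:E <= e%:E)%E.
Proof.
move=> e0 Ig hg; have mg := L1_measurable Ig; have mrho := test_measurable trho.
pose F (z : (R * R) * (R * R)) := (rho z.2 * `|g (z.1 + z.2) - g z.1|)%:E.
have mF : measurable_fun setT F.
  apply/measurable_EFinP; apply: measurable_funM.
    exact: measurableT_comp mrho measurable_snd.
  by apply: measurableT_comp => //; exact: measurable_increment.
have F0 z : (0 <= F z)%E by rewrite lee_fin mulr_ge0.
rewrite [leLHS](@fubini_tonelli _ _ _ _ _ mu2 mu2 F mF F0).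
apply: (@le_trans _ _ (\int[mu2]_y ((rho y)%:E * e%:E))%E).
  apply: ge0_le_integral => //.
  - by move=> y _; apply: integral_ge0 => x _; rewrite lee_fin mulr_ge0.
  - exact: (@measurable_fun_fubini_tonelli_G _ _ _ _ _ mu2 F mF F0).
  - by apply: emeasurable_funM => //; exact/measurable_EFinP.
  move=> y _.
  have -> : (\int[mu2]_x (rho y * `|g ((x : R * R) + y)%R - g x|)%:E =
      (rho y)%:E * gap (fun x => g (x + y)%R) g)%E.
    transitivity (\int[mu2]_x ((rho y)%:E * `|g ((x : R * R) + y)%R - g x|%:E))%E.
      by apply: eq_integral => x _; rewrite -EFinM.
    rewrite ge0_integralZl// ?lee_fin//.
    apply: measurable_gap => //; exact: (measurableT_comp mg (measurable_shift2 y)).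
  have [yd|yd] := pselect (dl <= `|y.1| \/ dl <= `|y.2|).
    by rewrite rhod// !mul0e.
  apply: lee_wpmul2l; first by rewrite lee_fin.
  apply: hg; rewrite ltNge; apply/negP => h; apply: yd; [by left|by right].
rewrite ge0_integralZr ?lee_fin//; [by rewrite rho1E mul1e|exact/measurable_EFinP|].
by move=> y _; rewrite lee_fin.
Qed.

(** The value at x is the integral of rho y * g (x + y). It is encoded as an average of the
    reflected kernel with weight g, so that smoothness and differentiation are inherited from
    averages of test functions. *)
Definition mollify g : R * R -> R := average mu2 g -%R (fun z => rho (0 - z)).

Lemma mollifyE g x : measurable_fun setT g ->
  mollify g x = (\int[mu2]_y (rho y * g ((x : R * R) + y)%R))%R.
Proof.
move=> mg; have mrho := test_measurable trho.
rewrite /mollify /average /Rintegral; congr fine.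
have mF : measurable_fun setT (fun y : R * R => (g y * rho (0 - (x - y)))%:E).
  apply/measurable_EFinP; apply: measurable_funM => //.
  have := test_measurable (test_shift (- x) trho); apply: eq_measurable_fun => y _.
  by congr rho; rewrite opprB addrA add0r addrC.
rewrite -[LHS](integral_shift2 x mF); apply: eq_integral => y _; congr EFin.
rewrite mulrC; congr (rho _ * g _); last exact: addrC.
by rewrite sub0r opprD opprK addrC addrK.
Qed.

Let Irho_mul g x : L1 g -> L1 (fun y => rho y * g (x + y)).
Proof.
move=> Ig; have [C _ hC] := test_bounded trho.
have Igx : L1 (fun y => g (y + x)) := integrable_shift2 x Ig.
have := integrable_bounded_mul Igx (test_measurable trho) hC.
by apply: eq_integrable => // y _; rewrite /= mulrC [y + x]addrC.
Qed.

Let mollify_increment g x : L1 g ->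
  mollify g x - g x = (\int[mu2]_y (rho y * (g ((x : R * R) + y)%R - g x)))%R.
Proof.
move=> Ig; rewrite mollifyE; last exact: L1_measurable.
have e : g x = (\int[mu2]_y (rho y * g x))%R by rewrite RintegralZr// rho1 mul1r.
rewrite [X in _ - X = _]e.
have I2 : L1 (fun y => rho y * g x).
  have := integrableZr measurableT (g x) Irho.
  by apply: eq_integrable => // y _; rewrite /= EFinM.
transitivity (\int[mu2]_y (rho y * g ((x : R * R) + y)%R - rho y * g x))%R.
  by rewrite (RintegralB measurableT (Irho_mul x Ig) I2).
by apply: eq_Rintegral => y _; rewrite mulrBr.
Qed.

Lemma mollify_gap g (e : R) : 0 <= e -> L1 g -> measurable_fun setT (mollify g) ->
  (forall h : R * R, `|h.1| < dl -> `|h.2| < dl -> (gap (fun x => g (x + h)%R) g <= e%:E)%E) ->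
  (gap (mollify g) g <= e%:E)%E.
Proof.
move=> e0 Ig mM hg; have mg := L1_measurable Ig; have mrho := test_measurable trho.
apply: le_trans (averaged_gap e0 Ig hg).
have mF : measurable_fun setT (fun z : (R * R) * (R * R) => (rho z.2 * `|g (z.1 + z.2) - g z.1|)%:E).
  apply/measurable_EFinP; apply: measurable_funM.
    exact: measurableT_comp mrho measurable_snd.
  by apply: measurableT_comp => //; exact: measurable_increment.
have F0 z : (0 <= (rho z.2 * `|g (z.1 + z.2) - g z.1|)%:E)%E by rewrite lee_fin mulr_ge0.
apply: ge0_le_integral => //.
- exact: measurable_gap.
- exact: (@measurable_fun_fubini_tonelli_F _ _ _ _ _ mu2 _ mF F0).
move=> x _; rewrite mollify_increment//.
have Ix : L1 (fun y => rho y * (g (x + y) - g x)).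
  have := L1B (Irho_mul x Ig) (L1Z (g x) Irho).
  by apply: eq_integrable => // y _; congr EFin; ring.
have mx := L1_measurable Ix.
rewrite (EFin_normr_Rintegral measurableT Ix).
apply: le_trans (le_abse_integral mu2 measurableT _) _; first exact/measurable_EFinP.
apply: ge0_le_integral => //.
- by apply: measurableT_comp => //; exact/measurable_EFinP.
- apply/measurable_EFinP; have := measurableT_comp (@normr_measurable R setT) mx.
  by apply: eq_measurable_fun => y _; rewrite /= normrM ger0_norm.
- by move=> y _; rewrite lee_fin normrM ger0_norm.
Qed.

(** Jensen's inequality for the density rho bounds the square of the mean increment by the mean of
    its square; the latter is at most twice the increment of g * |g|, a function in L1. *)
Lemma mollify_gap_square g (e : R) : 0 <= e -> L1 g -> L1 (fun x => g x ^+ 2) ->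
  measurable_fun setT (mollify g) ->
  (forall h : R * R, `|h.1| < dl -> `|h.2| < dl ->
    (gap (fun x => (g (x + h)%R * `|g (x + h)%R|)%R) (fun x => g x * `|g x|)%R <= e%:E)%E) ->
  (\int[mu2]_x ((mollify g x - g x) ^+ 2)%:E <= (2 * e)%:E)%E.
Proof.
move=> e0 Ig Ig2 mM hg; have mg := L1_measurable Ig; have mrho := test_measurable trho.
pose G x := g x * `|g x|.
have IG : L1 G.
  apply: (le_integrable measurableT _ _ Ig2).
    by apply/measurable_EFinP; apply: measurable_funM => //; exact: measurableT_comp.
  by move=> x _; rewrite lee_fin /= /G expr2 !normrM normr_id.
have mG := L1_measurable IG.
have mF : measurable_fun setT (fun z : (R * R) * (R * R) => (rho z.2 * `|G (z.1 + z.2) - G z.1|)%:E).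
  apply/measurable_EFinP; apply: measurable_funM.
    exact: measurableT_comp mrho measurable_snd.
  by apply: measurableT_comp => //; exact: measurable_increment.
have F0 z : (0 <= (rho z.2 * `|G (z.1 + z.2) - G z.1|)%:E)%E by rewrite lee_fin mulr_ge0.
have mFF := @measurable_fun_fubini_tonelli_F _ _ _ _ _ mu2 _ mF F0.
apply: (@le_trans _ _ (2%:E * \int[mu2]_x \int[mu2]_y (rho y * `|G ((x : R * R) + y)%R - G x|)%:E)%E).
  rewrite -ge0_integralZl//; last by move=> x _; apply: integral_ge0 => y _; rewrite lee_fin mulr_ge0.
  apply: ge0_le_integral => //.
  - by move=> x _; rewrite lee_fin sqr_ge0.
  - apply/measurable_EFinP; apply: measurable_funX; exact: measurable_funB.
  - exact: measurable_funeM.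
  move=> x _; rewrite mollify_increment//.
  set a := fun y : R * R => g (x + y) - g x.
  have ma : measurable_fun setT a.
    apply: measurable_funB => //.
    have := measurableT_comp mg (measurable_shift2 x); apply: eq_measurable_fun => y _.
    by rewrite /= addrC.
  have sq y : a y ^+ 2 <= 2 * `|G (x + y) - G x| by exact: sqrB_le_normM.
  have mra2 : measurable_fun setT (fun y : R * R => rho y * a y ^+ 2).
    by apply: measurable_funM => //; exact: measurable_funX.
  apply: (@le_trans _ _ (\int[mu2]_y (rho y * a y ^+ 2)%:E)%E); last first.
    rewrite -ge0_integralZl//; last 2 first.
    - exact: (measurable_fun_pair2 x mF).
    - by move=> y _; rewrite lee_fin mulr_ge0.
    apply: ge0_le_integral => //.
    - by move=> y _; rewrite lee_fin mulr_ge0 ?sqr_ge0.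
    - exact/measurable_EFinP.
    - by apply: measurable_funeM; exact: (measurable_fun_pair2 x mF).
    - move=> y _; rewrite -EFinM lee_fin [leRHS]mulrCA; exact: ler_wpM2l.
  (* An infinite second moment leaves nothing to prove; a finite one makes the variance below
     integrable. *)
  have [oo|noo] := eqVneq (\int[mu2]_y (rho y * a y ^+ 2)%:E)%E +oo%E; first by rewrite oo leey.
  have I2 : L1 (fun y => rho y * a y ^+ 2).
    apply/integrableP; split; first exact/measurable_EFinP.
    have -> : (\int[mu2]_y `|(EFin \o (fun y : R * R => (rho y * a y ^+ 2)%R)) y| =
        \int[mu2]_y (rho y * a y ^+ 2)%:E)%E.
      by apply: eq_integral => y _; rewrite /= ger0_norm// mulr_ge0// sqr_ge0.
    by rewrite ltey.
  have I1 : L1 (fun y => rho y * a y).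
    have := L1B (Irho_mul x Ig) (L1Z (g x) Irho).
    by apply: eq_integrable => // y _; rewrite /a /=; congr EFin; ring.
  set m := (\int[mu2]_y (rho y * a y))%R.
  rewrite -[leRHS]fineK; last exact: (integrable_fin_num measurableT I2).
  rewrite lee_fin -/(Rintegral mu2 setT (fun y => rho y * a y ^+ 2)).
  rewrite -subr_ge0.
  (* Jensen's inequality in the form that a variance is nonnegative; the expansion uses that rho has
     mass 1. *)
  have -> : (\int[mu2]_y (rho y * a y ^+ 2))%R - m ^+ 2 =
      (\int[mu2]_y (rho y * (a y - m) ^+ 2))%R.
    have e1 : (\int[mu2]_y (rho y * (a y - m) ^+ 2))%R =
        (\int[mu2]_y ((rho y * a y ^+ 2 - (2 * m) * (rho y * a y)) + m ^+ 2 * rho y))%R.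
      by apply: eq_Rintegral => y _; ring.
    rewrite e1 RintegralD//; [|exact: L1B I2 (L1Z _ I1)|exact: L1Z].
    rewrite RintegralB//; last exact: L1Z.
    by rewrite !RintegralZl// rho1 -/m; ring.
  by apply: Rintegral_ge0 => y _; rewrite mulr_ge0// sqr_ge0.
rewrite EFinM; apply: lee_wpmul2l; first by rewrite lee_fin.
exact: averaged_gap.
Qed.

End Estimates.

End Mollify.

(** * Supports and sliding integrals *)

(* [compact_cover] requires a pointed topological space. *)
Definition pointed_plane (R : realType) := (R * R)%type.
HB.instance Definition _ (R : realType) := Topological.copy (pointed_plane R) (R * R)%type.
HB.instance Definition _ (R : realType) := Pointed.copy (pointed_plane R) (R * R)%type.

#[global] Instance lebesgue2_ae_filter (R : realType) :
  Filter (almost_everywhere (@lebesgue2 R)).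
Proof. exact: (ae_filter_ringOfSetsType (@lebesgue2 R)). Qed.

Section EssSupport.
Context {R : realType}.
Local Notation mu2 := (@lebesgue2 R).
Implicit Types (f g phi : R * R -> R) (i : 'I_2).

Lemma ess_support_closed (V : nmodType) (f : R * R -> V) : closed (ess_support f).
Proof.
rewrite -[ess_support f]setCK; apply: open_closedC.
rewrite openE => x /= /existsNP[U] /not_implyP[oU] /not_implyP[Ux] /contrapT hU.
apply: filterS (open_nbhs_nbhs (conj oU Ux)) => y Uy /(_ U oU Uy); exact.
Qed.

(** A Lindelof argument: the complement of the support is covered by those rational balls on which f
    vanishes almost everywhere, and they are countably many. *)
Lemma ess_support_ae (V : nmodType) (f : R * R -> V) :
  {ae mu2, forall x, ~ ess_support f x -> f x = 0}.
Proof.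
pose P := [set q : rat * rat * rat | mu2.-negligible (rational_ball q `&` [set x | f x <> 0])].
have := @negligible_countable_bigcup R _ P (fun q => rational_ball q `&` [set x | f x <> 0])
  (fun q h => h).
apply: negligibleS => x /= /not_implyP[/existsNP[U] /not_implyP[oU] /not_implyP[Ux] /contrapT hU] fx.
have [q qx qU] := rational_ball_basis oU Ux.
exists q => //; rewrite /P/=; apply: negligibleS hU => y [qy fy] /= h.
by apply: fy; apply: h; exact: qU.
Qed.

Lemma ess_support_ae_eq (V W : nmodType) (f : R * R -> V) (g : R * R -> W) :
  {ae mu2, forall x, f x = 0 -> g x = 0} -> ess_support g `<=` ess_support f.
Proof.
move=> fg x gx U oU Ux hU; apply: (gx U oU Ux).
by move: fg hU; apply: filterS2 => y h1 h2 Uy; apply: h1; exact: h2.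
Qed.

Lemma dist_of_ae f g phi : measurable_fun setT f -> measurable_fun setT g ->
  measurable_fun setT phi -> {ae mu2, forall x, f x = g x} -> dist_of f phi = dist_of g phi.
Proof.
move=> mf mg mphi fg; rewrite /dist_of /Rintegral; congr fine.
apply: ae_eq_integral => //.
- by apply/measurable_EFinP; exact: measurable_funM.
- by apply/measurable_EFinP; exact: measurable_funM.
- by apply: filterS fg => x -> _.
Qed.

Lemma dist_of_eq_on f phi psi : measurable_fun setT f -> measurable_fun setT phi ->
  measurable_fun setT psi -> (forall x, ess_support f x -> phi x = psi x) ->
  dist_of f phi = dist_of f psi.
Proof.
move=> mf mp mq pq; rewrite /dist_of /Rintegral; congr fine.
apply: ae_eq_integral => //.
- by apply/measurable_EFinP; exact: measurable_funM.
- by apply/measurable_EFinP; exact: measurable_funM.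
- apply: filterS (ess_support_ae f) => x h _.
  have [sx|nsx] := pselect (ess_support f x); first by rewrite pq.
  by rewrite h// !mul0r.
Qed.

Lemma dist_of_ext f phi psi : (forall x, f x != 0 -> phi x = psi x) ->
  dist_of f phi = dist_of f psi.
Proof.
move=> h; apply: eq_Rintegral => x _; have [->|fx] := eqVneq (f x) 0.
  by rewrite !mul0r.
by rewrite h.
Qed.

Lemma dist_of0 f phi : (forall x, f x != 0 -> phi x = 0) -> dist_of f phi = 0.
Proof.
move=> h; rewrite (@dist_of_ext f phi (fun=> 0))//.
rewrite /dist_of (@eq_Rintegral _ _ _ _ _ (cst 0)) ?Rintegral_cst ?mul0r//.
by move=> x _; rewrite mulr0.
Qed.

Lemma L1_mul_test f phi : L1 f -> test_function phi -> L1 (fun x => f x * phi x).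
Proof.
move=> If tp; have [C _ hC] := test_bounded tp.
exact: integrable_bounded_mul If (test_measurable tp) hC.
Qed.

Lemma dist_ofB f phi psi : L1 f -> test_function phi -> test_function psi ->
  dist_of f (fun x => phi x - psi x) = dist_of f phi - dist_of f psi.
Proof.
move=> If tp tq; rewrite /dist_of -RintegralB//; [|exact: L1_mul_test..].
by apply: eq_Rintegral => x _; rewrite mulrBr.
Qed.

Lemma dist_ofZ f (c : R) phi : L1 f -> test_function phi ->
  dist_of f (fun x => c * phi x) = c * dist_of f phi.
Proof.
move=> If tp; rewrite /dist_of -RintegralZl//; last exact: L1_mul_test.
by apply: eq_Rintegral => x _; rewrite mulrCA.
Qed.

(** A finite subcover by balls reduces the construction to finitely many plateau functions, which
    are combined one at a time. *)
Lemma cutoff_near_compact (K Omega : set (R * R)) : compact K -> open Omega -> K `<=` Omega ->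
  exists chi : R * R -> R, [/\ forall n, Cn n chi,
    forall p, K p -> \near p, chi p = 1 & forall p, ~ Omega p -> \near p, chi p = 0].
Proof.
move=> cK oO KO.
(* Each plateau is 1 up to distance r and 0 from 2 r on. The remaining margin r, within the ball of
   radius 3 r contained in [Omega], makes it vanish near every point outside [Omega] and not just at
   it. *)
have /choice[r hr] p : exists r : R, Omega p -> 0 < r /\ ball p (3 * r) `<=` Omega.
  have [Op|nOp] := pselect (Omega p); last by exists 0.
  have /nbhs_ballP[r /= r0 rO] : nbhs p Omega by exact: open_nbhs_nbhs.
  by exists (r / 3); split; [rewrite divr_gt0|rewrite mulrC divfK].
have cvK : cover_compact K by rewrite -(@compact_cover (pointed_plane R)).
have := cvK _ Omega (fun p => ball p (r p)).
have h1 p : Omega p -> open (ball p (r p)) by move=> _; exact: ball_open.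
have h2 : K `<=` cover Omega (fun p => ball p (r p)).
  by move=> p Kp; exists p; [exact: KO|apply: ballxx; have [] := hr p (KO _ Kp)].
move=> /(_ h1 h2)[D DO KD].
suff [chi [cchi one zero]] : exists chi : R * R -> R, [/\ forall n, Cn n chi,
    forall p q, p \in finmap.enum_fset D -> ball p (r p) q -> \near q, chi q = 1 &
    forall p, ~ Omega p -> \near p, chi p = 0].
  by exists chi; split=> // p /KD[q /= qD qp]; exact: one qD qp.
have DO' p : p \in finmap.enum_fset D -> Omega p by move=> /DO; rewrite inE.
elim: (finmap.enum_fset D) DO' => [|p s IH] sO.
  exists (cst 0); split=> [n||p _]; [exact: Cn_cst|by move=> ? ?; rewrite in_nil|]. by apply: (filterS _ (@filterT _ (nbhs p) _)).
have [q qs|chi [cchi one zero]] := IH; first by apply: sO; rewrite inE qs orbT.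
have Op : Omega p by apply: sO; rewrite inE eqxx.
have [rp0 rpO] := hr p Op.
have [S1 [sS1 S11 S10]] := plateau p.1 rp0.
have [S2 [sS2 S21 S20]] := plateau p.2 rp0.
have cb := Cn_tensor sS1 sS2.
(* The value 1 - (1 - chi) (1 - b) for the new plateau b: it is 1 wherever one of the two is 1, and
   0 where both are 0. *)
exists (fun x => chi x + (tensor S1 S2 x + cst (-1) x * (chi x * tensor S1 S2 x))); split.
- by move=> n; do 2 (apply: CnD => //); apply: CnM; [exact: Cn_cst|exact: CnM].
- move=> p' q; rewrite inE => /orP[/eqP ->|p's] pq.
    have : nbhs q (ball p (r p)) by apply: open_nbhs_nbhs; split => //; exact: ball_open.
    apply: filterS => y; rewrite ballE2 => -[]; rewrite -!ball_normE /ball_/= => y1 y2.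
    by rewrite /tensor S11 ?S21 1?distrC ?ltW//= ; ring.
  by apply: filterS (one _ _ p's pq) => y ->; rewrite /=; ring.
- move=> q nOq; have zq := zero _ nOq.
  have : nbhs q (ball q (r p)) by exact: nbhsx_ballx.
  apply: filterS2 zq => y -> qy.
  have [h|h] : 2 * r p <= `|y.1 - p.1| \/ 2 * r p <= `|y.2 - p.2|.
    apply/or_asboolP; rewrite -[_ || _]negbK negb_or; apply/negP => /andP[/asboolPn h3 /asboolPn h4].
    apply: nOq; apply: rpO; move: qy; rewrite !ballE2 => -[].
    rewrite -!ball_normE /ball_/= => q1 q2; split=> /=.
      move: h3 => /negP; rewrite -ltNge => h3.
      rewrite (_ : p.1 - q.1 = - (y.1 - p.1) - (q.1 - y.1)); last by ring.
      by rewrite (le_lt_trans (ler_normB _ _))// normrN; lra.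
    move: h4 => /negP; rewrite -ltNge => h4.
    rewrite (_ : p.2 - q.2 = - (y.2 - p.2) - (q.2 - y.2)); last by ring.
    by rewrite (le_lt_trans (ler_normB _ _))// normrN; lra.
  by rewrite /tensor S10//= ; ring.
  by rewrite /tensor S20//= ; ring.
Qed.

End EssSupport.

Section SlidingIntegral.
Context {R : realType}.
Local Notation mu := (@lebesgue_measure R).
Implicit Types (phi : R * R -> R) (i j : 'I_2) (L : R).

Definition sliding_weight L : R -> R := \1_`[0, L].
Definition direction i (t : R) : R * R := t *: (basis_vec i : R * R).
Definition sliding i L phi := average mu (sliding_weight L) (direction i) phi.

Lemma integrable_sliding_weight L : mu.-integrable setT (EFin \o sliding_weight L).
Proof. exact: integrable_indic_itv. Qed.

Lemma directionE i t : direction i t = if i == 0 then (t, 0) else (0, t).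
Proof.
rewrite /direction /basis_vec; case: ifP => _;
  by rewrite [LHS]surjective_pairing; congr pair; rewrite /= /GRing.scale/= ?mulr1 ?mulr0.
Qed.

Lemma measurable_direction i : measurable_fun setT (direction i).
Proof.
rewrite (_ : direction i = fun t => if i == 0 then (t, 0) else (0, t)).
  case: (i == 0) => /=.
    exact: (@measurable_fun_pair _ _ _ R R R id (cst 0) (@measurable_id _ R setT) (measurable_cst _)).
  exact: (@measurable_fun_pair _ _ _ R R R (cst 0) id (measurable_cst _) (@measurable_id _ R setT)).
by apply/funext => t; rewrite directionE.
Qed.

Lemma sliding_weight_neq0 L t : sliding_weight L t != 0 -> 0 <= t <= L.
Proof.
rewrite /sliding_weight indicE; case: (boolP (t \in _)) => [|_]; last by rewrite eqxx.
by rewrite inE/= in_itv/=.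
Qed.

Lemma test_sliding i L phi : test_function phi -> test_function (sliding i L phi).
Proof.
move=> tphi; apply: (test_average (B := L) (integrable_sliding_weight L) (measurable_direction i) tphi).
move=> t /sliding_weight_neq0 /andP[t0 tL]; rewrite directionE.
by case: ifP => _; rewrite /= ?normr0 ger0_norm// (le_trans t0).
Qed.

Lemma partial_sliding i j L phi : test_function phi ->
  partial j (sliding i L phi) = sliding i L (partial j phi).
Proof.
exact: (partial_average (integrable_sliding_weight L) (measurable_direction i)).
Qed.

Lemma sliding_eq0 i L phi x : (forall t, 0 <= t <= L -> phi (x + direction i t) = 0) ->
  sliding i L phi x = 0.
Proof.
move=> h; rewrite /sliding /average (@eq_Rintegral _ _ _ _ _ (cst 0)) ?Rintegral_cst ?mul0r//.
move=> t _ /=; have [->|/sliding_weight_neq0 tL] := eqVneq (sliding_weight L t) 0.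
  by rewrite mul0r.
by rewrite h// mulr0.
Qed.

Lemma slice_direction i x t : slice i x (coordinate i x + t) = x + direction i t.
Proof.
rewrite directionE /slice /coordinate; case: x => a b; case: (i == 0) => /=.
  by rewrite (_ : (a, b) + (t, 0) = (a + t, b + 0))// addr0.
by rewrite (_ : (a, b) + (0, t) = (a + 0, b + t))// addr0.
Qed.

Lemma derive_along phi i x (t : R) : test_function phi ->
  is_derive t 1 (fun t => phi (x + direction i t)) (partial i phi (x + direction i t)).
Proof.
move=> tphi; set c := coordinate i x.
have -> : (fun t => phi (x + direction i t)) = (phi \o slice i x) \o (fun s => 1 * s + c).
  by apply/funext => s; rewrite /= mul1r -slice_direction (addrC s).
have D1 : is_derive t 1 (fun s : R => 1 * s + c) 1.
  rewrite (_ : (fun s => _) = 1 *: (id : R -> R) + cst c)//.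
  by apply: is_derive_eq; rewrite /GRing.scale/= mulr1 addr0.
have D2 : is_derive (1 * t + c) 1 (phi \o slice i x) (partial i phi (x + direction i t)).
  have e : 1 * t + c = coordinate i (x + direction i t).
    by rewrite -slice_direction /c /coordinate /slice mul1r (addrC t); case: (i == 0).
  rewrite e -[slice i x](_ : slice i (x + direction i t) = _).
    rewrite partial_slice; apply: derivableP; apply/derivable_slice; exact: test_derivable.
  by rewrite -slice_direction /slice; case: (i == 0).
have := @is_derive1_comp R (phi \o slice i x) (fun s : R => 1 * s + c) t _ _ D2 D1.
by rewrite mulr1.
Qed.

Lemma partial_sliding_same i L phi x : test_function phi -> 0 < L ->
  partial i (sliding i L phi) x = phi (x + direction i L) - phi x.
Proof.
move=> tphi L0; rewrite partial_sliding// /sliding /average.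
have D t := @derive_along phi i x t tphi.
have e : (\int[mu]_(t in `[0%R, L]) (partial i phi (x + direction i t))%:E =
    (phi (x + direction i L))%:E - (phi (x + direction i 0))%:E)%E.
  have cphi : continuous (fun t => phi (x + direction i t)).
    by apply: derivable_continuous1 => s; exact: (@ex_derive _ _ _ _ _ _ _ (D s)).
  apply: (@continuous_FTC2 _ _ (fun t => phi (x + direction i t))) => //.
  - apply: continuous_subspaceT; apply: derivable_continuous1 => s.
    exact: (@ex_derive _ _ _ _ _ _ _ (derive_along i x s (test_partial i tphi))).
  - split.
    + by move=> s _; exact: (@ex_derive _ _ _ _ _ _ _ (D s)).
    + exact: cvg_at_right_filter (cphi _).
    + exact: cvg_at_left_filter (cphi _).
  - by move=> s _; rewrite derive1E (@derive_val _ _ _ _ _ _ _ (D s)).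
have -> : (\int[mu]_t (sliding_weight L t * partial i phi (x + direction i t)))%R =
    (\int[mu]_(t in `[0%R, L]) partial i phi (x + direction i t))%R.
  rewrite [RHS]Rintegral_mkcond; apply: eq_Rintegral => t _.
  by rewrite /sliding_weight indicE patchE; case: ifP => _; rewrite ?mul1r ?mul0r.
rewrite /Rintegral e /= (_ : direction i 0 = 0) ?addr0//.
by rewrite directionE; case: ifP.
Qed.

End SlidingIntegral.

(** * The potential of a divergence-free pair *)

Section Potential.
Context {R : realType}.
Local Notation mu := (@lebesgue_measure R).
Local Notation mu2 := (@lebesgue2 R).
Implicit Types (phi T : R * R -> R) (L B t : R).

Lemma test_vanishes_off phi : test_function phi -> exists2 B : R, 0 < B & vanishes_off B phi.
Proof. by move=> /test_functionP[]. Qed.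

Lemma translate0 (x : R * R) t : x + direction 0 t = (x.1 + t, x.2).
Proof. by rewrite directionE/= (_ : x + (t, 0) = (x.1 + t, x.2 + 0))// addr0. Qed.

Lemma translate0N (x : R * R) t : x - direction 0 t = (x.1 - t, x.2).
Proof. by rewrite directionE/= (_ : x - (t, 0) = (x.1 - t, x.2 - 0))// subr0. Qed.

Lemma translate1 (x : R * R) t : x + direction 1 t = (x.1, x.2 + t).
Proof. by rewrite directionE/= (_ : x + (0, t) = (x.1 + 0, x.2 + t))// addr0. Qed.

Lemma vanishes_off_neq0 B phi x : vanishes_off B phi -> phi x != 0 ->
  `|x.1| < B /\ `|x.2| < B.
Proof.
by move=> h fx; split; rewrite ltNge; apply: contra fx => ?; apply/eqP/h; [left|right].
Qed.

Variables (f g : R * R -> R) (A : R).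
Hypotheses (If : L1 f) (Ig : L1 g).
Hypotheses (A0 : 0 < A) (fA : vanishes_off A f) (gA : vanishes_off A g).
Hypothesis divfree : forall phi, test_function phi ->
  dist_of f (partial 0 phi) + dist_of g (partial 1 phi) = 0.

(** The integral of g (x.1 - t, x.2) over 0 <= t <= L. A window of finite length, unlike the
    half-line, keeps the result integrable on the plane. *)
Definition horizontal_primitive L := smear mu (sliding_weight L) (direction 0) g.

Lemma L1_horizontal_primitive L : L1 (horizontal_primitive L).
Proof. exact: integrable_smear (integrable_sliding_weight L) (measurable_direction 0) Ig. Qed.

Lemma horizontal_primitive_adjoint L phi : test_function phi ->
  dist_of (horizontal_primitive L) phi = dist_of g (sliding 0 L phi).
Proof.
move=> tphi; have [C _ hC] := test_bounded tphi.
exact: (smear_adjoint (integrable_sliding_weight L) (measurable_direction 0) Ig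
  (test_measurable tphi) hC).
Qed.

(* On the supports of [f] and [g], the gradient of the test function
   [sliding 1 L' (sliding 0 L T)] is [(0, - sliding 0 L T)]. *)
Lemma divfree_sliding_far L T : test_function T -> 0 < L ->
  (forall x, x.1 <= A \/ L - A <= x.1 \/ A + 1 <= `|x.2| -> T x = 0) ->
  dist_of g (sliding 0 L T) = 0.
Proof.
have Apos := A0.
(* A vertical shift by 2 A + 1 lifts the strip |x.2| < A above the height A + 1, where T
   vanishes. *)
move=> tT L0 T0; set Phi := sliding 0 L T; set L' := 2 * A + 1.
have L'0 : 0 < L' by rewrite /L' addr_gt0 ?mulr_gt0.
have tPhi : test_function Phi by exact: test_sliding.
have := divfree (test_sliding 1 L' tPhi).
rewrite [X in X + _]dist_of0; last first.
  move=> x /(vanishes_off_neq0 fA)[x1 x2]; rewrite partial_sliding//.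
  apply: sliding_eq0 => t t0; rewrite translate1 /Phi partial_sliding_same// translate0.
  move: x1; rewrite ltr_norml => /andP[x11 x12]; rewrite !T0 ?subrr//=; [left|right; left]; lra.
rewrite add0r (@dist_of_ext _ g _ (fun x => (-1) * Phi x)); last first.
  move=> x /(vanishes_off_neq0 gA)[x1 x2]; rewrite partial_sliding_same// translate1.
  rewrite [X in X - _](_ : _ = 0) ?sub0r ?mulN1r//.
  rewrite /Phi; apply: sliding_eq0 => t t0; rewrite translate0 T0//=; right; right.
  move: x2; rewrite ltr_norml => /andP[x21 x22].
  by rewrite /L' ger0_norm; lra.
by rewrite dist_ofZ// => /eqP; rewrite mulf_eq0 oppr_eq0 oner_eq0/= => /eqP.
Qed.

(** For A < x.1 < L - A the window contains the whole horizontal section of the support of g. The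
    value is then a full line integral of g, which the divergence equation forces to vanish. *)
Lemma horizontal_primitive_ae0 L : {ae mu2, forall x : R * R,
  (`]A, L - A[ `*` `](- (A + 1)), A + 1[) x -> horizontal_primitive L x = 0}.
Proof.
have Apos := A0.
have [L0|L0] := leP L 0.
  apply: aeW => x [] /=; rewrite !in_itv/= => /andP[h1 h2]; lra.
apply: du_bois_reymond_box.
  apply: (@integrableS _ _ _ mu2 setT) => //; last exact: L1_horizontal_primitive.
  by apply: measurableX; exact: measurable_itv.
move=> p q sp sq p0 q0.
have tT : test_function (tensor p q).
  apply: (@test_tensor _ _ _ (L + A + 1)) => //; first lra.
    move=> s hs; apply: p0; apply/negP; rewrite in_itv/= => /andP[h1 h2].
    by move: hs; rewrite leNgt ltr_norml => /negP; apply; apply/andP; split; lra.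
  move=> s hs; apply: q0; apply/negP; rewrite in_itv/= => /andP[h1 h2].
  by move: hs; rewrite leNgt ltr_norml => /negP; apply; apply/andP; split; lra.
rewrite horizontal_primitive_adjoint// divfree_sliding_far//.
move=> x [h|[h|h]]; rewrite /tensor.
- by rewrite p0 ?mul0r// in_itv/= negb_and -!leNgt h.
- by rewrite p0 ?mul0r// in_itv/= negb_and -!leNgt h orbT.
- by rewrite q0 ?mulr0// in_itv/= -ltr_norml -leNgt.
Qed.

(** For x.1 <= A a window of length 2 A reaches beyond the left edge of the support, so the value is
    the integral over the entire half-line. The indicator discards the region where the window of
    length 2 A would lose part of the support. *)
Definition potential (x : R * R) :=
  horizontal_primitive (2 * A) x * \1_[set y : R * R | y.1 <= A] x.

Lemma measurable_half_plane : measurable [set y : R * R | y.1 <= A].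
Proof.
rewrite (_ : [set _ | _] = setT `&` fst @^-1` [set s | s <= A]); last by rewrite setTI.
have : measurable_fun setT (@fst R R) by exact: measurable_fst.
apply => //; rewrite (_ : [set s | s <= A] = `]-oo, A]%classic); last by rewrite set_itvNyc.
exact: measurable_itv.
Qed.

Lemma L1_potential : L1 potential.
Proof.
apply: (integrable_bounded_mul (C := 1)); first exact: L1_horizontal_primitive.
  by apply: measurable_indic; exact: measurable_half_plane.
by move=> x; rewrite indicE; case: (_ \in _); rewrite ?normr1 ?normr0.
Qed.

Lemma horizontal_primitive_eq0 L x : (forall t, 0 <= t <= L -> g (x.1 - t, x.2) = 0) ->
  horizontal_primitive L x = 0.
Proof.
move=> h; rewrite /horizontal_primitive /smear (@eq_Rintegral _ _ _ _ _ (cst 0)) ?Rintegral_cst ?mul0r//.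
move=> t _ /=; have [->|/sliding_weight_neq0 tL] := eqVneq (sliding_weight L t) 0.
  by rewrite mul0r.
by rewrite translate0N h ?mulr0.
Qed.

Lemma vanishes_off_potential : vanishes_off (A + 1) potential.
Proof.
have Apos := A0.
move=> x hx; rewrite /potential indicE.
have [x1|x1] := leP x.1 A; last first.
  by rewrite memNset ?mulr0//=; apply/negP; rewrite -ltNge.
rewrite horizontal_primitive_eq0 ?mul0r// => t /andP[t0 tL]; apply: gA => /=.
case: hx => hx; [left|right]; last by lra.
move: hx; rewrite !ler_normr => /orP[h|h]; [lra|apply/orP; right; lra].
Qed.

(** Where phi is nonzero, x.1 < B <= L - 2 A. If x.1 <= A, the longer window adds only points where
    g is 0; if x.1 > A, the primitive with window L vanishes almost everywhere and so does the
    truncated one. The potential thus agrees with that primitive on the support of phi. *)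
Lemma dist_of_potential phi : test_function phi -> exists L0, forall L, L0 <= L ->
  dist_of potential phi = dist_of g (sliding 0 L phi).
Proof.
have Apos := A0.
move=> tphi; have [B B0 phiB] := test_vanishes_off tphi.
exists (2 * A + B) => L hL; rewrite -horizontal_primitive_adjoint// /dist_of /Rintegral.
have mphi := test_measurable tphi.
congr fine; apply: ae_eq_integral => //.
- by apply/measurable_EFinP; apply: measurable_funM => //; exact: L1_measurable L1_potential.
- by apply/measurable_EFinP; apply: measurable_funM => //; exact: L1_measurable (L1_horizontal_primitive L).
apply: filterS (horizontal_primitive_ae0 L) => x h _; congr EFin.
have [->|/(vanishes_off_neq0 phiB)[x1 x2]] := eqVneq (phi x) 0; first by rewrite !mulr0.
congr (_ * _); rewrite /potential indicE; have [xA|xA] := leP x.1 A.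
  rewrite mem_set// mulr1; apply: eq_Rintegral => t _.
  rewrite /sliding_weight !indicE; case: (boolP (t \in `[0, 2 * A]%classic)) => [t1|t1].
    have -> // : t \in `[0, L]%classic.
    by move: t1; rewrite !inE/= !in_itv/= => /andP[t0 tA]; rewrite t0/=; lra.

  case: (boolP (t \in `[0, L]%classic)) => // t2.
  rewrite translate0N gA ?mulr0//=; left; rewrite ler_normr; apply/orP; right.
  move/set_mem: t2; rewrite /= in_itv/= => /andP[t0 tL].
  rewrite leNgt; apply/negP => hh; apply: (negP t1); rewrite inE/= in_itv/= t0/=; lra.
rewrite memNset ?mulr0/=; last by apply/negP; rewrite -ltNge.
have [x2A|x2A] := leP (A + 1) `|x.2|.
  by rewrite horizontal_primitive_eq0// => t _; apply: gA; right => /=; lra.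
rewrite h//; split; rewrite /= in_itv/= -?ltr_norml// xA/=.
by move: x1; rewrite ltr_norml => /andP[_]; lra.
Qed.

(** In the sense of distributions the first derivative of the potential is g: the derivative of the
    sliding integral is a difference, and its translated term misses the support of g. *)
Lemma dist_of_potential_partial0 phi : test_function phi ->
  dist_of potential (partial 0 phi) = - dist_of g phi.
Proof.
have Apos := A0.
move=> tphi; have [B B0 phiB] := test_vanishes_off tphi.
have [L0 hL] := dist_of_potential (test_partial 0 tphi).
pose L := Num.max L0 (A + B).
have [LL0 LAB] : L0 <= L /\ A + B <= L by rewrite /L !le_max !lexx orbT.
rewrite (hL L)// -partial_sliding//.
rewrite (@dist_of_ext _ g _ (fun x => (-1) * phi x)) ?dist_ofZ ?mulN1r//.
move=> x /(vanishes_off_neq0 gA)[x1 x2]; rewrite partial_sliding_same//; last lra.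
rewrite translate0 phiB ?sub0r ?mulN1r//=; left.
by move: x1; rewrite ltr_norml ler_normr => /andP[? ?]; apply/orP; left; lra.
Qed.

(** The divergence equation, tested with the sliding integral, exchanges g for f. The second
    derivative of the potential is - f, so (f, g) is the perpendicular gradient of the potential. *)
Lemma dist_of_potential_partial1 phi : test_function phi ->
  dist_of potential (partial 1 phi) = dist_of f phi.
Proof.
have Apos := A0.
move=> tphi; have [B B0 phiB] := test_vanishes_off tphi.
have [L0 hL] := dist_of_potential (test_partial 1 tphi).
pose L := Num.max L0 (A + B).
have [LL0 LAB] : L0 <= L /\ A + B <= L by rewrite /L !le_max !lexx orbT.
rewrite (hL L)// -partial_sliding//.
have := divfree (test_sliding 0 L tphi); rewrite addrC => /eqP; rewrite addr_eq0 => /eqP ->.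
rewrite (@dist_of_ext _ f _ (fun x => (-1) * phi x)) ?dist_ofZ ?mulN1r ?opprK//.
move=> x /(vanishes_off_neq0 fA)[x1 x2]; rewrite partial_sliding_same//; last lra.
rewrite translate0 phiB ?sub0r ?mulN1r//=; left.
by move: x1; rewrite ltr_norml ler_normr => /andP[? ?]; apply/orP; left; lra.
Qed.

End Potential.

Lemma partial_near_eq (R : realType) i (f g : R * R -> R) x :
  (\near x, f x = g x) -> partial i f x = partial i g x.
Proof.
by move=> fg; apply: near_eq_derive.
Qed.

Lemma zero_derive_constant (R : realType) (h h' : R -> R) (p r : R) :
  (forall x : R, is_derive x 1 h (h' x)) -> (forall s, ball p r s -> h' s = 0) ->
  forall a b, ball p r a -> ball p r b -> h a = h b.
Proof.
move=> D h0.
suff H a b : ball p r a -> ball p r b -> a < b -> h a = h b.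
  by move=> a b pa pb; have [/H->//|/H->//|->//] := ltgtP a b.
move=> pa pb ab; have [c /andP[ac cb]] := derive_eq_increment D ab.
rewrite h0 ?mul0r; first by move/eqP; rewrite subr_eq0 => /eqP.
move: pa pb; rewrite -!ball_normE /ball_/= !ltr_norml => /andP[? ?] /andP[? ?].
by apply/andP; split; lra.
Qed.

(** * Orthogonality to test functions vanishing on the domain *)

Section SlidingOrthogonal.
Context {R : realType}.
Local Notation mu2 := (@lebesgue2 R).
Implicit Types (phi T : R * R -> R) (L B t : R).

Lemma derive_vertical phi (a s : R) : test_function phi ->
  is_derive s 1 (fun s => phi (a, s)) (partial 1 phi (a, s)).
Proof.
move=> tphi; have := derive_along 1 (a, 0) s tphi; rewrite translate1/= add0r.
by congr is_derive; apply/funext => t; rewrite translate1/= add0r.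
Qed.

Lemma derive_horizontal phi (a s : R) : test_function phi ->
  is_derive s 1 (fun s => phi (s, a)) (partial 0 phi (s, a)).
Proof.
move=> tphi; have := derive_along 0 (0, a) s tphi; rewrite translate0/= add0r.
by congr is_derive; apply/funext => t; rewrite translate0/= add0r.
Qed.

Lemma derive1_vertical phi (a : R) : test_function phi ->
  derive1 (fun s => phi (a, s)) = fun s => partial 1 phi (a, s).
Proof.
move=> tphi; apply/funext => s; rewrite derive1E.
exact: (@derive_val _ _ _ _ _ _ _ (derive_vertical a s tphi)).
Qed.

Lemma smooth1_vertical phi (a : R) : test_function phi -> smooth1 (fun s => phi (a, s)).
Proof.
move=> + n; elim: n phi => [|n IH] phi tphi /=.
  apply: derivable_continuous1 => s.
  exact: (@ex_derive _ _ _ _ _ _ _ (derive_vertical a s tphi)).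
split=> [s|]; first exact: (@ex_derive _ _ _ _ _ _ _ (derive_vertical a s tphi)).
by rewrite derive1_vertical//; apply: IH; exact: test_partial.
Qed.

Variables (f g : R * R -> R) (A : R) (Omega : set (R * R)).
Hypotheses (If : L1 f) (Ig : L1 g).
Hypothesis divfree : forall phi, test_function phi ->
  dist_of f (partial 0 phi) + dist_of g (partial 1 phi) = 0.
Hypotheses (A0 : 0 < A) (OA : forall x, Omega x -> `|x.1| < A /\ `|x.2| < A).
Hypotheses (oO : open Omega) (scO : simply_connected Omega).
Hypotheses (fO : ess_support f `<=` Omega) (gO : ess_support g `<=` Omega).

Let K := ess_support f `|` ess_support g.

Let cK : compact K.
Proof.
apply: (subclosed_compact _ (@closed_square_compact R A)).
  by apply: closedU; exact: ess_support_closed.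
have h x : Omega x -> (`[- A, A] `*` `[- A, A])%classic x.
  by move=> /OA[x1 x2]; split; rewrite /= in_itv/= -ler_norml ltW.
by move=> x [/fO|/gO]; exact: h.
Qed.

(* On [Omega] the function [Phi := sliding 0 L T] does not depend on [x.1], so the
   form [Phi dx_2] is closed there and has a primitive [F]; the cut-off [Psi] of [F]
   is then a test function with gradient [(0, Phi)] on the supports of [f] and [g]. *)
Lemma sliding_orthogonal T L B : test_function T -> 0 < B -> vanishes_off B T -> A + B <= L ->
  (forall x, Omega x -> T x = 0) -> dist_of g (sliding 0 L T) = 0.
Proof.
move=> tT B0 TB AL TO; have Apos := A0.
have L0 : 0 < L by lra.
set Phi := sliding 0 L T; have tPhi : test_function Phi by exact: test_sliding.
(* The derivative is T (x + L e_1) - T x: the first term vanishes because L is large, the second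
   because T is 0 on [Omega]. *)
have d0Phi x : Omega x -> partial 0 Phi x = 0.
  move=> Ox; rewrite partial_sliding_same// (TO x)// subr0 translate0 TB//=; left.
  by have [x1 _] := OA Ox; move: x1; rewrite ltr_norml ler_normr => /andP[? ?]; apply/orP; left; lra.
pose L' := A + B; have L'0 : 0 < L' by rewrite /L'; lra.
(* A vertical primitive of Phi at the points of [Omega]. The sign appears because the sliding
   integral runs upwards from x, towards the region where Phi vanishes. *)
pose Xi x := (-1) * sliding 1 L' Phi x.
have tXi : test_function Xi by apply: test_functionZ; exact: test_sliding.
have d1Xi x : Omega x -> partial 1 Xi x = Phi x.
  move=> Ox; rewrite (_ : Xi = fun x => cst (-1) x * sliding 1 L' Phi x)//.
  rewrite partialM; [|exact: derivable_cst|exact: test_derivable (test_sliding _ _ tPhi)].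
  rewrite partial_sliding_same// translate1 [X in X - _](_ : _ = 0).
    by rewrite (_ : partial 1 (cst (-1)) x = 0) ?mulr0 ?addr0 ?sub0r ?mulN1r ?opprK// /partial derive_cst.
  rewrite /Phi; apply: sliding_eq0 => t _; rewrite translate0 TB//=; right.
  have [_ x2] := OA Ox; move: x2; rewrite ltr_norml ler_normr /L' => /andP[? ?].
  by apply/orP; left; lra.
clearbody Xi Phi.
(* The integral of Phi dx_2 from x to y along a vertical and then a horizontal segment; the
   horizontal one contributes nothing. *)
pose d (x y : R * R) := Xi (x.1, y.2) - Xi x.
have loc p : Omega p -> exists2 r : R, 0 < r & ball p r `<=` Omega /\ additive_on d (ball p r).
  move=> Op; have /nbhs_ballP[r /= r0 rO] : nbhs p Omega by exact: open_nbhs_nbhs.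
  exists r => //; split=> // x y z px py pz; rewrite /d.
  move: px py pz; rewrite !ballE2 => -[px1 px2] [py1 py2] [pz1 pz2].
  have inO a s : ball p.1 r a -> ball p.2 r s -> Omega (a, s).
    by move=> pa ps; apply: rO; rewrite ballE2.
  have hPhi s : ball p.2 r s -> Phi (x.1, s) = Phi (y.1, s).
    move=> ps; apply: (@zero_derive_constant R (fun a => Phi (a, s))
      (fun a => partial 0 Phi (a, s)) p.1 r) => // [a|a pa]; first exact: derive_horizontal.
    by apply: d0Phi; exact: inO.
  (* Balls are squares here, so the points with mixed coordinates remain in the ball. There Phi does
     not depend on the first coordinate, and the difference of Xi on two vertical lines is
     constant. *)
  have hXi : Xi (x.1, y.2) - Xi (y.1, y.2) = Xi (x.1, z.2) - Xi (y.1, z.2).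
    apply: (@zero_derive_constant R (fun s => Xi (x.1, s) - Xi (y.1, s))
      (fun s => partial 1 Xi (x.1, s) - partial 1 Xi (y.1, s)) p.2 r) => // [s|s ps].
      exact: (is_deriveB (derive_vertical _ _ tXi) (derive_vertical _ _ tXi)).
    by rewrite !d1Xi ?hPhi ?subrr//; exact: inO.
  have -> : Xi y = Xi (y.1, y.2) by case: (y).
  lra.
have [F hF] := local_primitive loc scO.
have KO : K `<=` Omega by move=> x [/fO|/gO].
have [chi [cchi chi1 chi0]] := cutoff_near_compact cK oO KO.
pose Psi x := chi x * F x.
(* A smooth formula for F near p, depending on the second coordinate only; it yields both the
   smoothness of Psi and its gradient on K. *)
pose Floc p : R * R -> R := fun y => tensor (cst 1) (fun s => Xi (p.1, s)) y + cst (F p - Xi p) y.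
have CF p n : Cn n (Floc p).
  apply: CnD; last exact: Cn_cst.
  by apply: Cn_tensor; [exact: smooth1_cst|exact: smooth1_vertical].
have FE p : Omega p -> \forall y \near p, F y = Floc p y.
  move=> Op; have [r r0 hr] := hF p Op.
  apply: filterS (nbhsx_ballx p r r0) => y py; rewrite /Floc /tensor /=.
  by have := hr p y (ballxx _ r0) py; rewrite /d; lra.
have tPsi : test_function Psi.
  apply/test_functionP; split; last first.
    exists A => // x hx; rewrite /Psi (nbhs_singleton (chi0 x _)) ?mul0r//.
    by move=> /OA[x1 x2]; case: hx => hx; lra.
  move=> n; apply: Cn_local => p; have [Op|nOp] := pselect (Omega p); last first.
    exists (cst 0); first exact: Cn_cst.
    by apply: filterS (chi0 p nOp) => y yE; rewrite /Psi yE mul0r.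
  exists (fun y => chi y * Floc p y); first exact: CnM.
  by apply: filterS (FE p Op) => y yE; rewrite /Psi yE.
have dPsi i x : K x -> partial i Psi x = if i == 0 then 0 else Phi x.
  move=> Kx; have Ox := KO x Kx.
  rewrite (@partial_near_eq _ i Psi (Floc x)); last first.
    by apply: filterS2 (chi1 x Kx) (FE x Ox) => y y1 y2; rewrite /Psi y1 y2 mul1r.
  have [D1 D2] := is_derive_tensor i x (smooth1_cst 1) (smooth1_vertical x.1 tXi).
  rewrite /Floc (partialD (f := tensor (cst 1) (fun s => Xi (x.1, s))) (g := cst (F x - Xi x)) D1 (derivable_cst _ _ _)).
  rewrite D2 [X in _ + X](_ : _ = 0) ?addr0; last by rewrite /partial derive_cst.
  case: ifP => _; rewrite /tensor; first by rewrite derive1_cst mul0r.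
  by rewrite derive1_vertical// mul1r -d1Xi//; case: (x).
have := divfree tPsi.
have mPsi i : measurable_fun setT (partial i Psi) by exact: test_measurable (test_partial i tPsi).
rewrite (@dist_of_eq_on _ f (partial 0 Psi) (cst 0))//; [|exact: L1_measurable|by move=> x fx; rewrite dPsi//; left].
rewrite (@dist_of_eq_on _ g (partial 1 Psi) Phi)//; [|exact: L1_measurable|exact: test_measurable|by move=> x gx; rewrite dPsi//; right].
by rewrite dist_of0// add0r.
Qed.

End SlidingOrthogonal.

(** * Support of the potential *)

Section Exterior.
Context {R : realType}.
Implicit Types (Omega : set (R * R)) (z : R * R).

Lemma lipschitz_constant (g : R -> R) : lipschitz g ->
  exists2 k : R, 0 <= k & forall a b, `|g a - g b| <= k * `|a - b|.
Proof.
move=> [M [_ hM]]; exists (`|M| + 1); first by rewrite addr_ge0.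
move=> a b; have /(hM _) : M < `|M| + 1 by rewrite ltr_pwDr// ler_norm.
by move=> /(_ (a, b)) /=; apply.
Qed.

(** A boundary point outside the open set lies on or below the graph in its chart. Moving down along
    the second axis of the frame by m, one finds a ball that stays below the graph, since the graph
    cannot drop faster than its Lipschitz constant allows. *)
Lemma lipschitz_exterior Omega z (r0 : R) : open Omega -> lipschitz_boundary Omega ->
  ~ Omega z -> 0 < r0 -> exists z' : R * R, exists2 dl : R, 0 < dl &
    forall y, ball z' dl y -> ball z r0 y /\ ~ Omega y.
Proof.
move=> oO lip nOz r00; have [cz|ncz] := pselect (closure Omega z); last first.
  have oC : open (~` closure Omega) by apply: closed_openC; exact: closed_closure.
  have /nbhs_ballP[r /= r1 rO] := open_nbhs_nbhs (conj oC ncz).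
  exists z, (Num.min r r0); first by rewrite lt_min r1.
  move=> y zy; split; first by apply: le_ball zy; rewrite ge_min lexx orbT.
  have : ball z r y by apply: le_ball zy; rewrite ge_min lexx.
  by move=> /rO h Oy; apply: h; exact: subset_closure.
have [|c [s [r [h [g [cs r1 h0 /lipschitz_constant[k k0 kg] hO]]]]]] := lip z.
  by split=> //; rewrite ((interior_id Omega).1 oO).
have g0 : 0 <= g 0.
  rewrite leNgt; apply/negP => g0; apply: nOz.
  have := (hO 0 0); rewrite normr0 => /(_ r1 h0)[_ /(_ g0)].
  by rewrite !mul0r !addr0 subr0; case: (z).
(* The depth of the descent: a quarter of the available room, both in the ball of radius r0 and in
   the height h of the chart. *)
pose m : R := Num.min r0 h / 4.
have [m0 mr0 mh] : [/\ 0 < m, 4 * m <= r0 & 4 * m <= h].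
  have e : 4 * m = Num.min r0 h by rewrite /m mulrC divfK.
  rewrite e; split; [|by rewrite ge_min lexx|by rewrite ge_min lexx orbT].
  by rewrite /m divr_gt0// lt_min r00.
(* A displacement below dl in each coordinate changes each frame coordinate by less than 2 dl, and
   over that range the graph stays above -2 k dl. The denominator 4 (k + 1) makes these losses
   together smaller than m and keeps the chart width r. *)
pose dl : R := Num.min m r / (4 * (k + 1)).
have [d0 dm dr] : [/\ 0 < dl, 4 * (k * dl) + 4 * dl <= m & 4 * (k * dl) + 4 * dl <= r].
  have e : 4 * (k * dl) + 4 * dl = Num.min m r.
    have e0 (x : R) : 4 * (k * x) + 4 * x = x * (4 * (k + 1)) by ring.
    by rewrite e0 /dl divfK//; apply: lt0r_neq0; lra.
  rewrite e; split; [|by rewrite ge_min lexx|by rewrite ge_min lexx orbT].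
  by rewrite /dl divr_gt0 ?lt_min ?m0//; lra.
have kd0 : 0 <= k * dl by rewrite mulr_ge0// ltW.
(* The centre is z - m (-s, c), with (-s, c) the upward axis of the frame. *)
clearbody m dl; exists (z.1 + m * s, z.2 - m * c), dl => // y.
rewrite !ballE2 -!ball_normE /ball_/= => -[y1 y2].
have c1 : `|c| <= 1 by rewrite ler_norml; apply/andP; split; nra.
have s1 : `|s| <= 1 by rewrite ler_norml; apply/andP; split; nra.
set v1 := y.1 - (z.1 + m * s); set v2 := y.2 - (z.2 - m * c).
have vv1 : `|v1| < dl by rewrite distrC.
have vv2 : `|v2| < dl by rewrite distrC.
have ml (a b : R) : `|a| < dl -> `|b| <= 1 -> `|a * b| < dl.
  by move=> ha hb; rewrite normrM (le_lt_trans _ ha)// ler_piMr.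
have mm (b : R) : `|b| <= 1 -> `|m * b| <= m.
  by move=> hb; rewrite normrM ger0_norm ?ler_piMr// ltW.
split.
  split.
    rewrite (_ : z.1 - y.1 = - (m * s) - v1); last by rewrite /v1; ring.
    by rewrite (le_lt_trans (ler_normB _ _))// normrN; have := mm s s1; lra.
  rewrite (_ : z.2 - y.2 = m * c - v2); last by rewrite /v2; ring.
  by rewrite (le_lt_trans (ler_normB _ _))//; have := mm c c1; lra.
(* The coordinates of y - z in the frame; the inversion of the rotation below uses c^2 + s^2 = 1. *)
pose a := v1 * c + v2 * s; pose b := - m + (v2 * c - v1 * s).
have ha : `|a| < 2 * dl.
  by rewrite (le_lt_trans (ler_normD _ _))//; have := ml _ _ vv1 c1; have := ml _ _ vv2 s1; lra.
have hb : `|v2 * c - v1 * s| < 2 * dl.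
  by rewrite (le_lt_trans (ler_normB _ _))//; have := ml _ _ vv2 c1; have := ml _ _ vv1 s1; lra.
have hb' : `|b| < h.
  by rewrite (le_lt_trans (ler_normD _ _))// normrN gtr0_norm//; lra.
have har : `|a| < r by lra.
have := hO a b har hb'.
have -> : (z.1 + a * c - b * s, z.2 + a * s + b * c) = y.
  rewrite [RHS]surjective_pairing; congr pair.
    rewrite (_ : _ - _ = z.1 + v1 * (c ^+ 2 + s ^+ 2) + m * s); last by rewrite /a /b; ring.
    by rewrite cs /v1; ring.
  rewrite (_ : _ + _ = z.2 + v2 * (c ^+ 2 + s ^+ 2) - m * c); last by rewrite /a /b; ring.
  by rewrite cs /v2; ring.
move=> -> gab.
have hg : - (k * (2 * dl)) <= g a.
  have := kg a 0; rewrite subr0 ler_norml => /andP[h1 _].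
  have : k * `|a| <= k * (2 * dl) by rewrite ler_wpM2l// ltW.
  lra.
move: hb; rewrite ltr_norml => /andP[_]; rewrite -(ltrD2l (- m)) -/b => hb; lra.
Qed.

End Exterior.

Section PotentialSupport.
Context {R : realType}.
Local Notation mu2 := (@lebesgue2 R).
Implicit Types (phi T : R * R -> R) (L B t : R) (i : 'I_2).

Lemma directionD i (s t : R) : direction i (s + t) = direction i s + direction i t.
Proof. exact: scalerDl. Qed.

Lemma direction_0 i : direction i 0 = 0 :> R * R.
Proof. exact: scale0r. Qed.

(** The difference of phi and its translate is the i-th derivative of a sliding integral of phi, and
    this integral vanishes on K as long as the translates in between avoid K. *)
Lemma translation_invariant (u : R * R -> R) i (K : set (R * R)) phi t : L1 u ->
  (forall Phi, test_function Phi -> (forall x, K x -> Phi x = 0) ->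
    dist_of u (partial i Phi) = 0) ->
  test_function phi ->
  (forall x s, K x -> `|s| <= `|t| -> phi (x + direction i s) = 0) ->
  dist_of u (fun x => phi (x + direction i t)) = dist_of u phi.
Proof.
move=> Iu du tphi phi0.
have pos psi r : 0 < r -> test_function psi ->
    (forall x s, K x -> 0 <= s <= r -> psi (x + direction i s) = 0) ->
    dist_of u (fun x => psi (x + direction i r)) = dist_of u psi.
  move=> r0 tpsi psi0; apply/eqP; rewrite -subr_eq0 -dist_ofB//; last exact: test_shift.
  have <- : partial i (sliding i r psi) = fun x => psi (x + direction i r) - psi x.
    by apply/funext => x; rewrite partial_sliding_same.
  rewrite du//; first exact: test_sliding.
  by move=> x Kx; apply: sliding_eq0 => s; exact: psi0.
have [t0|t0|->] := ltgtP t 0; last first.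
- by congr dist_of; apply/funext => x; rewrite direction_0 addr0.
- apply: pos => // x s Kx /andP[s0 st]; apply: phi0 => //.
  by rewrite !ger0_norm// ltW.
(* A negative shift is undone by the positive shift - t of the translated function. *)
rewrite -(pos (fun x => phi (x + direction i t)) (- t)).
- by congr dist_of; apply/funext => x; rewrite -addrA -directionD addNr direction_0 addr0.
- by rewrite oppr_gt0.
- exact: test_shift.
- move=> x s Kx /andP[s0 st]; rewrite -addrA -directionD; apply: phi0 => //.
  by rewrite ler0_norm ?ler0_norm; lra.
Qed.

Variables (f g : R * R -> R) (A : R) (Omega : set (R * R)).
Hypotheses (If : L1 f) (Ig : L1 g).
Hypotheses (A0 : 0 < A) (fA : vanishes_off A f) (gA : vanishes_off A g).
Hypothesis divfree : forall phi, test_function phi ->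
  dist_of f (partial 0 phi) + dist_of g (partial 1 phi) = 0.
Hypothesis OA : forall x, Omega x -> `|x.1| < A /\ `|x.2| < A.
Hypotheses (oO : open Omega) (scO : simply_connected Omega) (lipO : lipschitz_boundary Omega).
Hypotheses (fO : ess_support f `<=` Omega) (gO : ess_support g `<=` Omega).

(* Outside the supports of [f] and [g] the potential is locally constant, so its
   vanishing near a boundary point follows by translating test functions to a nearby
   point of the exterior, which exists because the boundary is Lipschitz. *)
Theorem divfree_potential : exists u : R * R -> R,
  [/\ L1 u, vanishes_off (A + 1) u,
    forall phi, test_function phi -> dist_of u (partial 0 phi) = - dist_of g phi,
    forall phi, test_function phi -> dist_of u (partial 1 phi) = dist_of f phi &
    ess_support u `<=` Omega].
Proof.
pose u := potential g A; have Iu : L1 u by exact: L1_potential.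
have D0 phi : test_function phi -> dist_of u (partial 0 phi) = - dist_of g phi.
  exact: (dist_of_potential_partial0 Ig A0 fA gA divfree).
have D1 phi : test_function phi -> dist_of u (partial 1 phi) = dist_of f phi.
  exact: (dist_of_potential_partial1 If Ig A0 fA gA divfree).
exists u; split=> //; first exact: vanishes_off_potential.
have u0 T : test_function T -> (forall x, Omega x -> T x = 0) -> dist_of u T = 0.
  move=> tT TO; have [B B0 TB] := test_vanishes_off tT.
  have [L0 hL] := dist_of_potential Ig A0 fA gA divfree tT.
  rewrite (hL (Num.max L0 (A + B))) ?le_max ?lexx//.
  by apply: (sliding_orthogonal If Ig divfree A0 OA oO scO fO gO tT B0 TB) => //; rewrite le_max lexx orbT.
clearbody u; move=> z uz; apply: contrapT => nOz.
pose K := ess_support f `|` ess_support g.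
have nKz : ~ K z by move=> [/fO|/gO].
have oK : open (~` K) by apply: closed_openC; apply: closedU; exact: ess_support_closed.
have /nbhs_ballP[r0 /= r00 r0K] := open_nbhs_nbhs (conj oK nKz).
(* Half of r0 is reserved for the translation from z to z' and half for the size of the box, so the
   moving box stays in the ball of radius r0 around z and never meets K. *)
have [|z' [dl dl0 hz']] := @lipschitz_exterior R Omega z (r0 / 2) oO lipO nOz.
  by rewrite divr_gt0.
pose r : R := Num.min dl (r0 / 2).
have [rr rdl rr0] : [/\ 0 < r, r <= dl & r <= r0 / 2].
  by rewrite /r lt_min dl0 divr_gt0// !ge_min !lexx orbT.
clearbody r.
apply: (uz (ball z r)); [exact: ball_open|exact: ballxx|].
have bz : {ae mu2, forall y : R * R,
    (`]z.1 - r, z.1 + r[ `*` `]z.2 - r, z.2 + r[) y -> u y = 0}.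
  apply: du_bois_reymond_box.
    apply: (@integrableS _ _ _ mu2 setT) => //.
    by apply: measurableX; exact: measurable_itv.
  move=> p q sp sq p0 q0.
  have p0' s : r <= `|s - z.1| -> p s = 0.
    move=> h; apply: p0; apply/negP; rewrite in_itv/= => /andP[h1 h2].
    by move: h; rewrite leNgt ltr_norml => /negP; apply; apply/andP; split; lra.
  have q0' s : r <= `|s - z.2| -> q s = 0.
    move=> h; apply: q0; apply/negP; rewrite in_itv/= => /andP[h1 h2].
    by move: h; rewrite leNgt ltr_norml => /negP; apply; apply/andP; split; lra.
  have tT : test_function (tensor p q).
    apply: (@test_tensor _ _ _ (`|z.1| + `|z.2| + r)) => //.
    - by rewrite ltr_wpDl// addr_ge0.
    - move=> s hs; apply: p0'; have := lerB_normD s (- z.1); rewrite normrN.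
      by have := normr_ge0 z.2; lra.
    - move=> s hs; apply: q0'; have := lerB_normD s (- z.2); rewrite normrN.
      by have := normr_ge0 z.1; lra.
  (* Composed with x + h, a test function centred at z becomes centred at z'. The translation is
     performed one coordinate at a time, through an L-shaped path inside the square. *)
  pose h := z - z'.
  have [h1 h2] : `|h.1| < r0 / 2 /\ `|h.2| < r0 / 2.
    have [+ _] := hz' z' (ballxx _ dl0).
    by rewrite ballE2 -!ball_normE /ball_.
  have inK x a b : K x -> `|a| < r0 / 2 -> `|b| < r0 / 2 -> tensor p q (x.1 + a, x.2 + b) = 0.
    move=> Kx ha hb; rewrite /tensor /=.
    have [pa|pa] := leP r `|x.1 + a - z.1|; first by rewrite p0' ?mul0r.
    have [qb|qb] := leP r `|x.2 + b - z.2|; first by rewrite q0' ?mulr0.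
    exfalso; apply: (r0K x _ Kx); rewrite ballE2 -!ball_normE /ball_/=; split.
      rewrite (_ : z.1 - x.1 = a - (x.1 + a - z.1)); last by ring.
      by rewrite (le_lt_trans (ler_normB _ _))//; lra.
    rewrite (_ : z.2 - x.2 = b - (x.2 + b - z.2)); last by ring.
    by rewrite (le_lt_trans (ler_normB _ _))//; lra.
  have d0 Phi : test_function Phi -> (forall x, K x -> Phi x = 0) ->
      dist_of u (partial 0 Phi) = 0.
    move=> tPhi PhiK; rewrite D0// (@dist_of_eq_on _ g Phi (cst 0)) ?dist_of0 ?oppr0//.
    - exact: L1_measurable.
    - exact: test_measurable.
    - by move=> x gx; apply: PhiK; right.
  have d1 Phi : test_function Phi -> (forall x, K x -> Phi x = 0) ->
      dist_of u (partial 1 Phi) = 0.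
    move=> tPhi PhiK; rewrite D1// (@dist_of_eq_on _ f Phi (cst 0)) ?dist_of0//.
    - exact: L1_measurable.
    - exact: test_measurable.
    - by move=> x fx; apply: PhiK; left.
  have r02 : 0 < r0 / 2 by rewrite divr_gt0.
  rewrite -(translation_invariant (K := K) (t := h.1) Iu d0)//; last first.
    move=> x s Kx hs; rewrite translate0 -[x.2]addr0; apply: inK => //; last by rewrite normr0.
    exact: le_lt_trans h1.
  rewrite -(translation_invariant (K := K) (t := h.2) Iu d1)//; last first.
  - move=> x s Kx hs; rewrite translate1 translate0 /=; apply: inK => //.
    exact: le_lt_trans h2.
  - exact: test_shift.
  apply: u0; first exact: (test_shift (direction 1 h.2) (test_shift (direction 0 h.1) tT)).
  move=> x Ox; rewrite translate1 translate0 /tensor /=.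
  have [pa|pa] := leP r `|x.1 + h.1 - z.1|; first by rewrite p0' ?mul0r.
  have [qb|qb] := leP r `|x.2 + h.2 - z.2|; first by rewrite q0' ?mulr0.
  exfalso; have [] // := hz' x.
  rewrite ballE2 -!ball_normE /ball_/=; split.
    apply: (lt_le_trans _ rdl); rewrite distrC (_ : _ - _ = x.1 + h.1 - z.1)//.
    by rewrite /h /=; ring.
  apply: (lt_le_trans _ rdl); rewrite distrC (_ : _ - _ = x.2 + h.2 - z.2)//.
  by rewrite /h /=; ring.
apply: filterS bz => y hy; rewrite ballE2 -!ball_normE /ball_/= => -[y1 y2]; apply: hy.
split; rewrite /= in_itv/=; apply/andP.
  by move: y1; rewrite ltr_norml => /andP[? ?]; split; lra.
by move: y2; rewrite ltr_norml => /andP[? ?]; split; lra.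
Qed.

End PotentialSupport.

(** * Approximation in the homogeneous norm *)

Section L2Norm.
Context {R : realType}.
Local Notation mu2 := (@lebesgue2 R).
Implicit Types f g : R * R -> R.

Lemma L2_normE f : L2_norm f = ((\int[mu2]_x (f x ^+ 2)%:E) `^ 2^-1)%E.
Proof.
rewrite /L2_norm unlock; congr poweR; apply: eq_integral => x _.
by rewrite /= -[2]/(2%:R) powR_mulrn// -normrX ger0_norm// sqr_ge0.
Qed.

Lemma L2_norm_ge0 f : (0 <= L2_norm f)%E.
Proof. exact: Lnorm_ge0. Qed.

Lemma measurable_sqr_EFin f : measurable_fun setT f ->
  measurable_fun setT (fun x : R * R => (f x ^+ 2)%:E).
Proof. by move=> mf; apply/measurable_EFinP; exact: measurable_funX. Qed.

Lemma L2_norm_ae f g : measurable_fun setT f -> measurable_fun setT g ->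
  {ae mu2, forall x, f x = g x} -> L2_norm f = L2_norm g.
Proof.
move=> mf mg fg; rewrite !L2_normE; congr poweR.
apply: ae_eq_integral => //; [exact: measurable_sqr_EFin..|].
by apply: filterS fg => x -> _.
Qed.

Lemma integral_sqr_ge0 f : (0 <= \int[mu2]_x (f x ^+ 2)%:E)%E.
Proof. by apply: integral_ge0 => x _; rewrite lee_fin sqr_ge0. Qed.

Lemma L2_norm_le f g (c : R) : measurable_fun setT f -> measurable_fun setT g -> 0 <= c ->
  (forall x, f x ^+ 2 <= c ^+ 2 * g x ^+ 2) -> (L2_norm f <= c%:E * L2_norm g)%E.
Proof.
move=> mf mg c0 fg; rewrite !L2_normE.
have -> : (c%:E = ((c ^+ 2)%:E) `^ 2^-1)%E.
  by rewrite /= powR12_sqrt ?sqr_ge0// sqrtr_sqr ger0_norm.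
rewrite -poweRM ?lee_fin ?sqr_ge0 ?integral_sqr_ge0//.
rewrite -ge0_integralZl_EFin ?sqr_ge0//; last 2 first.
- by move=> x _; rewrite lee_fin sqr_ge0.
- exact: measurable_sqr_EFin.
apply: gt0_ler_poweR.
- by rewrite invr_ge0.
- by rewrite in_itv/= integral_sqr_ge0 leey.
- rewrite in_itv/= leey andbT; apply: integral_ge0 => x _.
  by rewrite lee_fin mulr_ge0 ?sqr_ge0.
apply: ge0_le_integral => //.
- by move=> x _; rewrite lee_fin sqr_ge0.
- exact: measurable_sqr_EFin.
- by apply: measurable_funeM; exact: measurable_sqr_EFin.
- by move=> x _; rewrite lee_fin.
Qed.

Lemma L2_norm_le_EFin f (e : R) : 0 <= e ->
  (\int[mu2]_x (f x ^+ 2)%:E <= (e ^+ 2)%:E)%E -> (L2_norm f <= e%:E)%E.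
Proof.
move=> e0 fe; rewrite L2_normE.
have -> : (e%:E = ((e ^+ 2)%:E) `^ 2^-1)%E.
  by rewrite /= powR12_sqrt ?sqr_ge0// sqrtr_sqr ger0_norm.
apply: gt0_ler_poweR => //.
- by rewrite in_itv/= integral_sqr_ge0 leey.
- by rewrite in_itv/= leey lee_fin sqr_ge0.
Qed.

Lemma Lfun2_sqr f : measurable_fun setT f -> L1 (fun x => f x ^+ 2) ->
  f \in Lfun mu2 2%:E.
Proof.
move=> mf /integrableP[_ foo]; rewrite inE; apply/andP; split; rewrite inE//=.
rewrite /finite_norm -[X in (X < _)%E]/(L2_norm f) L2_normE poweR_lty//.
apply: le_lt_trans foo; rewrite le_eqVlt; apply/orP; left; apply/eqP.
by apply: eq_integral => x _; rewrite gee0_abs// lee_fin sqr_ge0.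
Qed.

End L2Norm.

(** * Mollified potentials as approximants, and uniqueness *)

Section MollifiedPotential.
Context {R : realType}.
Local Notation mu2 := (@lebesgue2 R).
Implicit Types (f g phi rho psi w : R * R -> R) (i : 'I_2) (A B L e : R).

Lemma measurable_opp2 : measurable_fun setT (-%R : R * R -> R * R).
Proof.
exact: (@measurable_fun_pair _ _ _ (R * R)%type R R (fun x => - x.1) (fun x => - x.2)
  (measurableT_comp (@oppr_measurable R setT) (@measurable_fst _ _ R R))
  (measurableT_comp (@oppr_measurable R setT) (@measurable_snd _ _ R R))).
Qed.

Lemma test_mollify rho g A : test_function rho -> L1 g -> vanishes_off A g ->
  test_function (mollify rho g).
Proof.
move=> trho Ig gA.
apply: (@test_average _ _ _ mu2 g -%R Ig measurable_opp2 _ A (test_reflect 0 trho)).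
by move=> y /(vanishes_off_neq0 gA)[y1 y2]; rewrite !normrN !ltW.
Qed.

Lemma partial2_reflect phi i x : test_function phi ->
  partial i (partial i (fun z => phi (x - z))) = fun y => partial i (partial i phi) (x - y).
Proof.
move=> tphi.
have E : partial i (fun z => phi (x - z)) = fun y => cst (-1) y * partial i phi (x - y).
  by apply/funext => y; have [_ ->] := is_derive_reflect i x y tphi.
rewrite E; apply/funext => y.
have [D1 D2] := is_derive_reflect i x y (test_partial i tphi).
rewrite (partialM (f := cst (-1)) (g := fun y => partial i phi (x - y)) (derivable_cst _ _ _) D1).
rewrite D2 [X in _ + _ * X](_ : _ = 0); last by rewrite /partial derive_cst.
by rewrite mulr0 addr0 /= mulrA mulrNN !mulr1 mul1r.
Qed.

(** Both derivatives fall on the reflected kernel, itself a test function, against which the weak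
    equation is available; two reflections cancel the sign. *)
Lemma laplacian_mollify rho psi w A : test_function rho -> L1 psi -> vanishes_off A psi ->
  (forall phi, test_function phi ->
    \sum_i dist_of psi (partial i (partial i phi)) = dist_of w phi) ->
  laplacian (mollify rho psi) = mollify rho w.
Proof.
move=> trho Ip pA hw; have trt := test_reflect 0 trho.
apply/funext => x; rewrite /laplacian /mollify.
transitivity (dist_of w (fun y => rho (0 - (x - y)))); last by [].
rewrite -(hw _ (test_reflect x trt)); apply: eq_bigr => i _.
have -> : partial i (partial i (fun y => rho (0 - (x - y)))) = _ := partial2_reflect i x trt.
by rewrite !(@partial_average _ _ _ mu2 psi -%R Ip measurable_opp2)//; exact: test_partial.
Qed.

Lemma dist_of_gap f g eta (C : R) : L1 f -> L1 g -> test_function eta ->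
  0 <= C -> (forall x, `|eta x| <= C) ->
  (`|dist_of f eta - dist_of g eta|%:E <= C%:E * gap f g)%E.
Proof.
move=> If Ig te C0 hC; have me := test_measurable te.
have mf := L1_measurable If; have mg := L1_measurable Ig.
have -> : dist_of f eta - dist_of g eta = (\int[mu2]_x ((f x - g x) * eta x))%R.
  by rewrite /dist_of -RintegralB//; [|exact: L1_mul_test..]; apply: eq_Rintegral => x _; rewrite mulrBl.
have If' := L1_mul_test (L1B If Ig) te.
apply: (le_trans (y := (\int[mu2]_x (`|(f x - g x) * eta x|)%:E)%E)).
  by rewrite /Rintegral -abse_EFin fineK ?(integrable_fin_num measurableT If')//; exact: le_abse_integral (measurable_int _ If').
rewrite /gap -ge0_integralZl_EFin//; last exact: measurable_gap.
apply: ge0_le_integral => //.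
- by apply/measurable_EFinP; apply: measurableT_comp => //; apply: measurable_funM => //; exact: measurable_funB.
- by apply: measurable_funeM; exact: measurable_gap.
- by move=> x _; rewrite lee_fin normrM mulrC ler_wpM2r.
Qed.

Lemma homogeneous_H20_potential psi w A : L1 psi -> vanishes_off A psi ->
  L1 w -> L1 (fun x => w x ^+ 2) -> vanishes_off A w ->
  (forall phi, test_function phi ->
    \sum_i dist_of psi (partial i (partial i phi)) = dist_of w phi) ->
  homogeneous_H20 psi /\ is_weak_laplacian psi w.
Proof.
move=> Ip pA Iw Iw2 wA hw.
have W : is_weak_laplacian psi w.
  split; first exact: Lfun2_sqr (L1_measurable Iw) Iw2.
  move=> phi tphi; rewrite -hw// /dist_laplacian /dist_partial.
  by apply: eq_bigr => i _; rewrite opprK.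
split=> //; split.
  split; first exact: L1_measurable.
  move=> K cK; have /integrableP[mp poo] := Ip.
  apply: le_lt_trans poo; apply: ge0_subset_integral => //.
    by apply: closed_measurable2; apply: compact_closed cK; exact: norm_hausdorff.
  by apply/measurable_EFinP; apply: measurableT_comp => //; exact: L1_measurable Ip.
exists w; split=> //.
have Iww : L1 (fun x => w x * `|w x|).
  apply: (le_integrable measurableT _ _ Iw2).
    apply/measurable_EFinP; apply: measurable_funM; first exact: L1_measurable.
    by apply: measurableT_comp => //; exact: L1_measurable.
  by move=> x _; rewrite lee_fin normrM normr_id -expr2 normrX lexx.
(* Chosen so that the bound 2 * e n on the squared L2 distance is the square of 1 / (n + 1). *)
pose e n : R := (n.+1%:R^-1) ^+ 2 / 2.
have e0 n : 0 < e n by rewrite divr_gt0// exprn_gt0// invr_gt0.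
have /choice[rho_ hrho] n : exists rho, [/\ test_function rho,
    (gap (mollify rho psi) psi <= (e n)%:E)%E &
    (\int[mu2]_x ((mollify rho w x - w x) ^+ 2)%:E <= (2 * e n)%:E)%E].
  have [d1 d10 hd1] := translation_continuous Ip (e0 n).
  have [d2 d20 hd2] := translation_continuous Iww (e0 n).
  have [|rho [trho rho0 rhod rho1]] := @mollifier R (Num.min d1 d2).
    by rewrite lt_min d10.
  have mm g : L1 g -> vanishes_off A g -> measurable_fun setT (mollify rho g).
    by move=> Ig gA; exact: test_measurable (test_mollify trho Ig gA).
  exists rho; split=> //.
    apply: (mollify_gap trho rho0 rhod rho1 (ltW (e0 n)) Ip (mm _ Ip pA)).
    by move=> h; rewrite !lt_min => /andP[? _] /andP[? _]; exact: hd1.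
  apply: (mollify_gap_square trho rho0 rhod rho1 (ltW (e0 n)) Iw Iw2 (mm _ Iw wA)).
  by move=> h; rewrite !lt_min => /andP[_ ?] /andP[_ ?]; exact: hd2.
exists (fun n => mollify (rho_ n) psi); split.
- by move=> n; have [trho _ _] := hrho n; exact: test_mollify pA.
- move=> eta te; have [C C0 hC] := test_bounded te.
  apply/cvgrPdist_le => /= d d0.
  have Cd : 0 < d / (C + 1) by rewrite divr_gt0// ltr_wpDl.
  have /cvgr0Pnorm_le/(_ _ Cd) := @cvg_harmonic R.
  apply: filterS => n; rewrite /= /harmonic => hn.
  have [trho g1 _] := hrho n.
  rewrite distrC -lee_fin.
  apply: (le_trans (dist_of_gap (test_L1 (test_mollify trho Ip pA)) Ip te C0 hC)).
  apply: (le_trans (y := (C%:E * (e n)%:E)%E)); first by rewrite lee_wpmul2l// lee_fin.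
  rewrite -EFinM lee_fin.
  have n1 : n.+1%:R^-1 <= 1 :> R by rewrite invf_le1// ler1n.
  have n0 : 0 <= n.+1%:R^-1 :> R by rewrite invr_ge0.
  rewrite ger0_norm// in hn.
  have hn' : (C + 1) * n.+1%:R^-1 <= d by rewrite mulrC -ler_pdivlMr// ltr_wpDl.
  have en : e n <= n.+1%:R^-1.
    by rewrite /e; move: n0 n1; set q := (_^-1); nra.
  apply: le_trans hn'; apply: le_trans (ler_wpM2l C0 en) _.
  by rewrite ler_wpM2r// lerDl.
- have bound : \forall n \near \oo, (0 <=
      L2_norm (fun x => laplacian (mollify (rho_ n) psi) x - w x)%R <= (n.+1%:R^-1)%:E)%E.
    apply: nearW => n; rewrite L2_norm_ge0/=; have [trho _ h] := hrho n.
    apply: L2_norm_le_EFin; first by rewrite invr_ge0.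
    rewrite (laplacian_mollify trho Ip pA hw); apply: le_trans h _.
    by rewrite /e mulrC divfK.
  apply: (squeeze_cvge bound); first exact: cvg_cst.
  by apply: cvg_EFin; [exact: nearW|exact: cvg_harmonic].
Qed.

Lemma sliding_far v eta A B L : L1 v -> test_function eta -> 0 < A -> 0 < B ->
  vanishes_off A v -> vanishes_off B eta -> A + B <= L ->
  dist_of v (partial 0 (sliding 0 L eta)) = - dist_of v eta.
Proof.
move=> Iv te A0 B0 vA eB ABL.
rewrite (@dist_of_ext _ v _ (fun x => (-1) * eta x)) ?dist_ofZ ?mulN1r//.
move=> x /(vanishes_off_neq0 vA)[x1 x2]; rewrite partial_sliding_same//; last lra.
rewrite translate0 eB ?sub0r ?mulN1r//=; left.
by move: x1; rewrite ltr_norml ler_normr => /andP[? ?]; apply/orP; left; lra.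
Qed.

Lemma dist_of_eq0_ae v A : L1 v -> 0 < A -> vanishes_off A v ->
  (forall phi, test_function phi -> dist_of v phi = 0) -> {ae mu2, forall x, v x = 0}.
Proof.
move=> Iv A0 vA v0.
have : {ae mu2, forall x : R * R, (`](- A), A[ `*` `](- A), A[) x -> v x = 0}.
  apply: du_bois_reymond_box.
    apply: (@integrableS _ _ _ mu2 setT) => //.
    by apply: measurableX; exact: measurable_itv.
  move=> p q sp sq p0 q0; apply: v0; apply: (test_tensor A0) => // s hs.
    by apply: p0; rewrite in_itv/= -ltr_norml -leNgt.
  by apply: q0; rewrite in_itv/= -ltr_norml -leNgt.
apply: filterS => x h; have [//|/(vanishes_off_neq0 vA)[x1 x2]] := eqVneq (v x) 0.
by apply: h; split; rewrite /= in_itv/= -ltr_norml.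
Qed.

(** Up to translates that miss the support of v, every phi is a second horizontal derivative of an
    iterated sliding integral, so v is orthogonal to all test functions. *)
Lemma dist_of_partial2_eq0_ae v A : L1 v -> 0 < A -> vanishes_off A v ->
  (forall phi, test_function phi -> dist_of v (partial 0 (partial 0 phi)) = 0) ->
  {ae mu2, forall x, v x = 0}.
Proof.
move=> Iv A0 vA v0; apply: (dist_of_eq0_ae Iv A0 vA) => phi tphi.
have h eta : test_function eta -> exists2 L, 0 < L &
    dist_of v (partial 0 (sliding 0 L eta)) = - dist_of v eta.
  move=> te; have [B B0 eB] := test_vanishes_off te; exists (A + B); first by rewrite addr_gt0.
  exact: (sliding_far Iv te A0 B0 vA eB (lexx _)).
have [L L0 hL] := h phi tphi.
have tS := test_sliding 0 L tphi.
have [L' L'0 hL'] := h _ (test_partial 0 tS).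
move: hL'; rewrite -partial_sliding// v0; last exact: test_sliding.
by rewrite hL opprK => <-.
Qed.

End MollifiedPotential.

(** * Truncation and the main theorem *)

Section Truncation.
Context {R : realType}.
Local Notation mu2 := (@lebesgue2 R).
Implicit Types (f g h phi : R * R -> R) (i j : 'I_2) (A B : R).

Lemma ord2_cases i : i = 0 \/ i = 1.
Proof. by case: i => [[|[|//]]] h; [left|right]; exact: val_inj. Qed.

Lemma sum2E (V : nmodType) (F : 'I_2 -> V) : \sum_i F i = F 0 + F 1.
Proof.
by rewrite !big_ord_recl big_ord0 addr0; congr (F _ + F _); exact: val_inj.
Qed.

Lemma vanishes_offW A B f : A <= B -> vanishes_off A f -> vanishes_off B f.
Proof. by move=> AB fA x hx; apply: fA; case: hx => hx; [left|right]; exact: le_trans hx. Qed.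

Lemma vanishes_offD A f g : vanishes_off A f -> vanishes_off A g ->
  vanishes_off A (fun x => f x + g x).
Proof. by move=> fA gA x hx; rewrite fA// gA// addr0. Qed.

(** A function supported in [Omega] is 0 outside only almost everywhere. Its truncation changes it
    on a null set, makes it vanish pointwise off a square, and turns L2 or local integrability into
    integrability. *)
Definition truncate A f x : R := f x * \1_(square A) x.

Lemma truncateE A f x : square A x -> truncate A f x = f x.
Proof. by move=> sx; rewrite /truncate indicE mem_set// mulr1. Qed.

Lemma truncate_eq0 A f x : ~ square A x -> truncate A f x = 0.
Proof. by move=> sx; rewrite /truncate indicE memNset// mulr0. Qed.

Lemma vanishes_off_truncate A f : vanishes_off (A + 1) (truncate A f).
Proof. by move=> x hx; apply: truncate_eq0 => /squareP[x1 x2]; case: hx => hx; lra. Qed.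

Lemma measurable_truncate A f : measurable_fun setT f -> measurable_fun setT (truncate A f).
Proof.
by move=> mf; apply: measurable_funM => //; apply: measurable_indic; exact: measurable_square.
Qed.

Lemma Lfun2_measurable f : f \in Lfun mu2 2%:E -> measurable_fun setT f.
Proof. by rewrite inE => /andP[+ _]; rewrite inE. Qed.

Lemma L1_dominated f g : measurable_fun setT f -> L1 g -> (forall x, `|f x| <= g x) -> L1 f.
Proof.
move=> mf Ig fg; apply: (le_integrable measurableT _ _ Ig); first exact/measurable_EFinP.
by move=> x _; rewrite lee_fin (le_trans (fg x))// ler_norm.
Qed.

Lemma norm_le_sqrD (a b : R) : `|a * b| <= a ^+ 2 + b ^+ 2.
Proof.
rewrite normrM -(real_normK (num_real a)) -(real_normK (num_real b)).
have : 0 <= (`|a| - `|b|) ^+ 2 by exact: sqr_ge0.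
have := mulr_ge0 (normr_ge0 a) (normr_ge0 b); nra.
Qed.

Lemma L1_mul_Lfun2 f g : f \in Lfun mu2 2%:E -> measurable_fun setT g ->
  L1 (fun x => g x ^+ 2) -> L1 (fun x => f x * g x).
Proof.
move=> f2 mg Ig.
apply: (L1_dominated _ (L1D (Lfun2_integrable_sqr f2) Ig)).
  by apply: measurable_funM => //; exact: Lfun2_measurable.
by move=> x; exact: norm_le_sqrD.
Qed.

Lemma L1_truncate A f : f \in Lfun mu2 2%:E -> L1 (truncate A f).
Proof.
move=> f2; apply: L1_mul_Lfun2 => //.
  by apply: measurable_indic; exact: measurable_square.
have := L1_square (R := R) A; congr L1; apply/funext => x.
by rewrite indicE; case: (_ \in _); rewrite ?expr1n ?expr0n.
Qed.

Lemma dist_ofD f g phi : L1 f -> L1 g -> test_function phi ->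
  dist_of (fun x => f x + g x) phi = dist_of f phi + dist_of g phi.
Proof.
move=> If Ig tp; rewrite /dist_of -RintegralD//; [|exact: L1_mul_test..].
by apply: eq_Rintegral => x _; rewrite mulrDl.
Qed.

Lemma dist_ofZl (c : R) f phi : L1 f -> test_function phi ->
  dist_of (fun x => c * f x) phi = c * dist_of f phi.
Proof.
move=> If tp; rewrite /dist_of -RintegralZl//; last exact: L1_mul_test.
by apply: eq_Rintegral => x _; rewrite mulrA.
Qed.

Lemma ess_support_truncate_ae (V : nmodType) (f : R * R -> V) g A :
  ess_support f `<=` square A -> (forall x, f x = 0 -> g x = 0) ->
  {ae mu2, forall x, truncate A g x = g x}.
Proof.
move=> fA fg; apply: filterS (ess_support_ae f) => x hx.
have [sx|nsx] := pselect (square A x); first by rewrite truncateE.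
by rewrite truncate_eq0// fg// hx// => /fA.
Qed.

Lemma bounded_set_square (Omega : set (R * R)) : bounded_set Omega ->
  exists2 A : R, 0 < A & forall x, Omega x -> `|x.1| < A /\ `|x.2| < A.
Proof.
move=> [M [_ hM]]; exists (`|M| + 1 + 1); first by rewrite ltr_wpDl// addr_ge0.
have /hM h : M < `|M| + 1 by rewrite ltr_pwDr// ler_norm.
move=> x /h /=; rewrite prod_normE ge_max => /andP[x1 x2].
by split; rewrite ltr_pwDr.
Qed.

(** Makes the norm independent of the weak Laplacian that [xget] selects. That one is only in L2 and
    perhaps not integrable on the plane, so the comparison is made on growing boxes. *)
Lemma weak_laplacian_unique psi (w w' : R * R -> R) : L1 w ->
  is_weak_laplacian psi w -> is_weak_laplacian psi w' -> {ae mu2, forall x, w' x = w x}.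
Proof.
move=> Iw [_ hw] [w2 hw'].
have mw := L1_measurable Iw; have mw' := Lfun2_measurable w2.
pose f x := w' x - w x.
have f0 n : {ae mu2, forall x : R * R,
    (`](- n%:R), n%:R[ `*` `](- n%:R), n%:R[) x -> f x = 0}.
  apply: du_bois_reymond_box.
    apply: (@eq_integrable _ _ _ mu2 _ _ (EFin \o (fun x => truncate n%:R w' x - w x))).
    - by apply: measurableX; exact: measurable_itv.
    - move=> x; rewrite inE => -[]; rewrite /= !in_itv/= -!ltr_norml => x1 x2.
      by rewrite /f truncateE//; apply/squareP; rewrite !ltW.
    apply: (@integrableS _ _ _ mu2 setT) => //.
      by apply: measurableX; exact: measurable_itv.
    exact: L1B (L1_truncate _ w2) Iw.
  move=> p q sp sq p0 q0.
  (* For n = 0 the box is empty, so the test function is 0. *)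
  have [n0|n0] := ltnP 0 n; last first.
    rewrite dist_of0// => x _; rewrite /tensor p0 ?mul0r// in_itv/=.
    by move: n0; rewrite leqn0 => /eqP ->; rewrite oppr0; case: ltgtP.
  have tT : test_function (tensor p q).
    apply: (@test_tensor _ _ _ n%:R) => //; first by rewrite ltr0n.
      by move=> s hs; apply: p0; rewrite in_itv/= -ltr_norml -leNgt.
    by move=> s hs; apply: q0; rewrite in_itv/= -ltr_norml -leNgt.
  have I' : L1 (fun x => w' x * tensor p q x).
    apply: L1_mul_Lfun2 => //; first exact: test_measurable.
    exact: test_L1 (testMl (fun n => test_Cn n tT) tT).
  transitivity (dist_of w' (tensor p q) - dist_of w (tensor p q)); last first.
    by rewrite -(hw _ tT) -(hw' _ tT) subrr.
  rewrite /dist_of -RintegralB//; last exact: L1_mul_test.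
  by apply: eq_Rintegral => x _; rewrite mulrBl.
apply: filterS (ae_foralln f0) => x h.
have xn := archi_boundP (addr_ge0 (normr_ge0 x.1) (normr_ge0 x.2)).
have /eqP : f x = 0.
  apply: (h (Num.bound (`|x.1| + `|x.2|))).
  split; rewrite /= in_itv/= -ltr_norml; apply: le_lt_trans xn.
    by rewrite lerDl.
  by rewrite lerDr.
by rewrite subr_eq0 => /eqP.
Qed.

Lemma nabla_perp0E (T : @dist R) phi : nabla_perp 0 T phi = T (partial 1 phi).
Proof. exact: opprK. Qed.

Lemma nabla_perp1E (T : @dist R) phi : nabla_perp 1 T phi = - T (partial 0 phi).
Proof. by []. Qed.

(** The row potentials supply both orders of mixed differentiation; S 1 0 = S 0 1 makes them agree,
    and the symmetrisation is then the mean of two equal values. *)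
Lemma dperp_dperp_components (P : @dist R) (S : 'I_2 -> 'I_2 -> R) phi :
  P (partial 0 (partial 0 phi)) = S 1 1 -> P (partial 1 (partial 1 phi)) = S 0 0 ->
  P (partial 0 (partial 1 phi)) = - S 0 1 -> P (partial 1 (partial 0 phi)) = - S 0 1 ->
  S 1 0 = S 0 1 -> forall i j, S i j = dperp_vector (dperp_scalar P) i j phi.
Proof.
move=> h00 h11 h01 h10 S10 i j.
have half (a b c : R) : a = b -> a = c -> a = 2^-1 * (b + c) by clear; move=> <- <-; lra.
have e00 : nabla_perp 0 (nabla_perp 0 P) phi = S 0 0.
  exact: etrans (nabla_perp0E _ _) (etrans (nabla_perp0E _ _) h11).
have e11 : nabla_perp 1 (nabla_perp 1 P) phi = S 1 1.
  apply: etrans (nabla_perp1E _ _) _; rewrite -h00.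
  by apply: etrans (congr1 -%R (nabla_perp1E _ _)) _; exact: opprK.
have e01 : nabla_perp 0 (nabla_perp 1 P) phi = S 0 1.
  apply: etrans (nabla_perp0E _ _) (etrans (nabla_perp1E _ _) _).
  by apply: etrans (congr1 -%R h01) _; exact: opprK.
have e10 : nabla_perp 1 (nabla_perp 0 P) phi = S 0 1.
  apply: etrans (nabla_perp1E _ _) (etrans (congr1 -%R (nabla_perp0E _ _)) _).
  by apply: etrans (congr1 -%R h10) _; exact: opprK.
clear h00 h11 h01 h10; rewrite /dperp_vector /dperp_scalar.
case: (ord2_cases i) => ->; case: (ord2_cases j) => ->; apply: half;
  by rewrite ?S10; apply: esym.
Qed.

Lemma dperp_dperp11 (P : @dist R) phi :
  dperp_vector (dperp_scalar P) 1 1 phi = P (partial 0 (partial 0 phi)).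
Proof.
have e : nabla_perp 1 (nabla_perp 1 P) phi = P (partial 0 (partial 0 phi)).
  by apply: etrans (nabla_perp1E _ _) (etrans (congr1 -%R (nabla_perp1E _ _)) _); exact: opprK.
rewrite /dperp_vector /dperp_scalar e; move: (P _) => a; lra.
Qed.

End Truncation.

Theorem proposition1 (R : realType) (Omega : set (R * R)) :
  open Omega -> bounded_set Omega -> simply_connected Omega ->
  lipschitz_boundary Omega ->
  exists2 M : R, 0 < M &
  forall sigma : R * R -> 'M[R]_2,
    L2_sym_tensor sigma ->
    ess_support sigma `<=` Omega ->
    (forall i, dist_eq (dist_Div (dist_of_tensor sigma) i) (fun=> 0)) ->
  exists psi : R * R -> R,
    [/\ [/\ homogeneous_H20 psi,
            ess_support psi `<=` Omega &
            forall i j, dist_eq (dist_of_tensor sigma i j)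
              (dperp_vector (dperp_scalar (dist_of psi)) i j)],
        forall psi' : R * R -> R,
          homogeneous_H20 psi' ->
          ess_support psi' `<=` Omega ->
          (forall i j, dist_eq (dist_of_tensor sigma i j)
             (dperp_vector (dperp_scalar (dist_of psi')) i j)) ->
          {ae lebesgue2, forall x, psi' x = psi x} &
        (homogeneous_H20_norm psi <= M%:E * L2_norm_tensor sigma)%E].
Proof.
(* The square of the trace is at most 2 (sigma_11^2 + sigma_22^2), hence at most 2^2 times the
   squared norm of sigma: the same constant serves every [Omega]. *)
move=> oO bO scO lipO; exists 2 => // sigma [sym s2] sO div.
have [A0 A00 OA0] := bounded_set_square bO.
have OS : Omega `<=` square A0 by move=> x /OA0[x1 x2]; apply/squareP; rewrite !ltW.
(* Truncation to the closed square of half-side A0 leaves the boundary values; the margin gives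
   vanishing from A on. *)
pose A := A0 + 1.
have A0A : A0 < A by rewrite ltrDl.
have Apos : 0 < A by exact: lt_trans A0A.
have OA x : Omega x -> `|x.1| < A /\ `|x.2| < A.
  by move=> /OA0[x1 x2]; split; apply: lt_trans A0A.
pose s i j := truncate A0 (fun x => sigma x i j).
have Is i j : L1 (s i j) by apply: L1_truncate; exact: s2.
have sA i j : vanishes_off A (s i j) by exact: vanishes_off_truncate.
have s0 i j x : sigma x = 0 -> sigma x i j = 0 by move=> ->; rewrite mxE.
have sae i j : {ae lebesgue2, forall x, s i j x = sigma x i j}.
  by apply: (ess_support_truncate_ae (f := sigma)); [exact: subset_trans OS|exact: s0].
have sOm i j : ess_support (s i j) `<=` Omega.
  apply: subset_trans sO; apply: ess_support_ae_eq; apply: aeW => x /s0 sx.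
  by rewrite /s /truncate sx mul0r.
have sD i j phi : test_function phi -> dist_of (fun x => sigma x i j) phi = dist_of (s i j) phi.
  move=> tphi; symmetry; apply: dist_of_ae => //.
  - exact: L1_measurable.
  - exact: Lfun2_measurable (s2 i j).
  - exact: test_measurable.
have sdiv i phi : test_function phi ->
    dist_of (s i 0) (partial 0 phi) + dist_of (s i 1) (partial 1 phi) = 0.
  move=> tphi; have := div i phi tphi; rewrite /dist_Div sum2E /dist_partial /dist_of_tensor.
  rewrite !sD; [|exact: test_partial..].
  by rewrite -opprD => /eqP; rewrite oppr_eq0 => /eqP.
have ssym phi : dist_of (s 1 0) phi = dist_of (s 0 1) phi.
  apply: eq_Rintegral => x _; congr (_ * _); rewrite /s /truncate; congr (_ * _).
  by rewrite -[in LHS](sym x) mxE.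
have sle x : (s 0 0 x + s 1 1 x) ^+ 2 <= 2 ^+ 2 * (sigma x 0 0 ^+ 2 + sigma x 1 1 ^+ 2).
  rewrite /s; have [sx|nsx] := pselect (square A0 x).
    by rewrite !truncateE//; have := sqr_ge0 (sigma x 0 0 - sigma x 1 1); nra.
  by rewrite !truncate_eq0// addr0 expr0n/= mulr_ge0// addr_ge0// sqr_ge0.
clearbody s.
have row i := divfree_potential (Is i 0) (Is i 1) Apos (sA i 0) (sA i 1) (sdiv i)
  OA oO scO lipO (@sOm i 0) (@sOm i 1).
have [u1 [Iu1 u1A u10 u11 u1O]] := row 0.
have [u2 [Iu2 u2A u20 u21 u2O]] := row 1.
have A1pos : 0 < A + 1 by rewrite addr_gt0.
have OA1 x : Omega x -> `|x.1| < A + 1 /\ `|x.2| < A + 1.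
  by move=> /OA[x1 x2]; split; rewrite ltr_pwDr// ltW.
(* The two terms are - sigma_12 and sigma_21 tested against phi. *)
have udiv phi : test_function phi -> dist_of u1 (partial 0 phi) + dist_of u2 (partial 1 phi) = 0.
  by move=> tphi; rewrite u10// u21// ssym addNr.
have [psi [Ipsi psiA psi0 psi1 psiO]] := divfree_potential Iu1 Iu2 A1pos u1A u2A udiv
  OA1 oO scO lipO u1O u2O.
have h00 phi : test_function phi -> dist_of psi (partial 0 (partial 0 phi)) = dist_of (s 1 1) phi.
  by move=> tphi; rewrite psi0 ?u20 ?opprK//; exact: test_partial.
have h11 phi : test_function phi -> dist_of psi (partial 1 (partial 1 phi)) = dist_of (s 0 0) phi.
  by move=> tphi; rewrite psi1 ?u11//; exact: test_partial.
have h01 phi : test_function phi -> dist_of psi (partial 0 (partial 1 phi)) = - dist_of (s 0 1) phi.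
  by move=> tphi; rewrite psi0 ?u21 ?ssym//; exact: test_partial.
have h10 phi : test_function phi -> dist_of psi (partial 1 (partial 0 phi)) = - dist_of (s 0 1) phi.
  by move=> tphi; rewrite psi1 ?u10//; exact: test_partial.
pose w x := s 0 0 x + s 1 1 x.
have Iw : L1 w by exact: L1D (Is 0 0) (Is 1 1).
have wA : vanishes_off (A + 1 + 1) w.
  have AA : A <= A + 1 + 1 by rewrite -addrA lerDl.
  exact: vanishes_offD (vanishes_offW AA (sA 0 0)) (vanishes_offW AA (sA 1 1)).
have wD phi : test_function phi -> dist_of w phi = dist_of (s 0 0) phi + dist_of (s 1 1) phi.
  exact: dist_ofD.
have wle x : w x ^+ 2 <= 2 ^+ 2 * (sigma x 0 0 ^+ 2 + sigma x 1 1 ^+ 2) by exact: sle.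
clearbody w.
have mw := L1_measurable Iw.
have Iw2 : L1 (fun x => w x ^+ 2).
  apply: (L1_dominated _ (L1Z (2 ^+ 2) (L1D (Lfun2_integrable_sqr (s2 0 0)) (Lfun2_integrable_sqr (s2 1 1))))).
    exact: measurable_funX.
  by move=> x; rewrite ger0_norm ?sqr_ge0.
have lapl phi : test_function phi ->
    \sum_i dist_of psi (partial i (partial i phi)) = dist_of w phi.
  by move=> tphi; rewrite sum2E (wD _ tphi) addrC; congr (_ + _); [exact: h11|exact: h00].
have [Hpsi Lpsi] := homogeneous_H20_potential Ipsi psiA Iw Iw2 wA lapl.
have dperp i j : dist_eq (dist_of_tensor sigma i j)
    (dperp_vector (dperp_scalar (dist_of psi)) i j).
  move=> phi tphi; apply: (etrans (sD i j phi tphi)).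
  exact: (@dperp_dperp_components R (dist_of psi) (fun i j => dist_of (s i j) phi) phi
    (h00 _ tphi) (h11 _ tphi) (h01 _ tphi) (h10 _ tphi) (ssym phi)).
exists psi; split=> //.
- move=> psi' [[mpsi' lpsi'] _] psi'O dperp'.
  (* A competitor is merely locally integrable; its truncation is integrable and equal to it almost
     everywhere, because its support lies in [Omega]. *)
  pose q := truncate A0 psi'.
  have qae : {ae lebesgue2, forall x, q x = psi' x}.
    by apply: (ess_support_truncate_ae (f := psi')) => //; exact: subset_trans OS.
  have Iq : L1 q.
    apply/integrableP; split; first by apply/measurable_EFinP; exact: measurable_truncate.
    apply: le_lt_trans (lpsi' _ (@closed_square_compact R A0)).
    rewrite [leRHS]integral_mkcond le_eqVlt; apply/orP; left; apply/eqP.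
    apply: eq_integral => x _; rewrite patchE /q.
    case: ifPn => [/set_mem sx|/negP nsx]; first by rewrite /= truncateE.
    by rewrite /= truncate_eq0 ?normr0// => sx; apply: nsx; rewrite inE.
  have qA : vanishes_off (A + 1 + 1) (fun x => (-1) * psi x) by move=> x hx; rewrite psiA ?mulr0.
  pose v x := q x + (-1) * psi x.
  have : {ae lebesgue2, forall x, v x = 0}.
    apply: (@dist_of_partial2_eq0_ae _ v (A + 1 + 1)).
    + by apply: L1D => //; exact: L1Z.
    + by rewrite addr_gt0.
    + apply: vanishes_offD => //; apply: (vanishes_offW (A := A)); first by rewrite -addrA lerDl.
      exact: vanishes_off_truncate.
    move=> phi tphi.
    have t2 : test_function (partial 0 (partial 0 phi)) by do 2 apply: test_partial.
    rewrite (dist_ofD Iq (L1Z (-1) Ipsi) t2).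
    have -> : dist_of q (partial 0 (partial 0 phi)) = dist_of (s 1 1) phi.
      rewrite -sD//; apply: etrans (esym (dperp' 1 1 phi tphi)).
      rewrite dperp_dperp11; apply: dist_of_ae => //; last exact: test_measurable.
      exact: L1_measurable Iq.
    have -> : dist_of (fun x => (-1) * psi x) (partial 0 (partial 0 phi)) = - dist_of (s 1 1) phi.
      by rewrite -(h00 _ tphi) dist_ofZl// mulN1r.
    by rewrite subrr.
  apply: filterS2 qae => x qx; rewrite /v qx mulN1r => /eqP.
  by rewrite subr_eq0 => /eqP.
(* The trace w is a weak Laplacian, so the default value of [xget] is not reached. *)
- have wl' : is_weak_laplacian psi (xget (fun=> 0) [set w | is_weak_laplacian psi w]).
    by apply: (@xgetPex _ (fun=> 0) [set w | is_weak_laplacian psi w]); exists w.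
  have ae' := weak_laplacian_unique Iw Lpsi wl'.
  rewrite /homogeneous_H20_norm; move: ae' wl'; set w' := xget _ _ => ae' [w'2 _].
  rewrite (L2_norm_ae (Lfun2_measurable w'2) mw ae').
  pose N x := Num.sqrt (\sum_i \sum_j sigma x i j ^+ 2).
  have N0 x : 0 <= \sum_i \sum_j sigma x i j ^+ 2.
    by apply: sumr_ge0 => i _; apply: sumr_ge0 => j _; exact: sqr_ge0.
  apply: (@L2_norm_le _ w N) => // [|x].
    apply: measurableT_comp.
      by apply: continuous_measurable_fun; exact: sqrt_continuous.
    apply: measurable_sum => i; apply: measurable_sum => j.
    by apply: measurable_funX; exact: Lfun2_measurable (s2 i j).
  rewrite sqr_sqrtr//; apply: le_trans (wle x) _.
  rewrite ler_wpM2l// ?sqr_ge0// !sum2E -addrA lerD2l.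
  by rewrite addrCA addrA lerDr addr_ge0// sqr_ge0.
Qed.
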